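(* Fix $n>0$ and an $n$-tuple of positive integers $\underline{d}=(d_1,\dots,d_n)$. For $k\geq -1$, the $\mathrm{FI}^n$-module $\mathcal{H}_k$ defined by $$(\mathcal{H}_k)_{\mathcal{A}}=\tilde{H}_k\left(\mathcal{C}_{\mathcal{A}}^{\underline{d}}\right)$$ for every $n$-tuple $\mathcal{A}$ of finite sets is representation superstable and trivial. Moreover, if $r<n$, and if we fix $n-r$ finite sets $A_{r+1},\dots,A_n$ of cardinalities $N_{r+1},\dots,N_n$ respectively, and if we let $$m=\min_{j=r+1,\dots,n}\left\lfloor\frac{N_j}{d_j}\right\rfloor,$$ then the pull-back $\mathrm{FI}^r$-module $\mathcal{H}_k(N_{r+1},\dots,N_n)$ defined by $$\mathcal{H}_k(N_{r+1},\dots,N_n)_{(A_1,\dots,A_r)}=(\mathcal{H}_k)_{(A_1,\dots,A_n)}$$ has stable range $\underline{N}'\geq\underline{N}$, where $\underline{N}=2m\cdot(d_1,d_2,\dots,d_r)$.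
   Context: $\mathbb{K}$ is a field of characteristic zero; $\mathrm{Vec}$ is the category of finite dimensional $\mathbb{K}$-vector spaces. Packing complexes: for an $n$-tuple $\underline{d}=(d_1,\dots,d_n)$ of positive integers and an $n$-tuple $\mathcal{A}=(A_1,\dots,A_n)$ of finite sets, let $V$ be the set of $n$-tuples $\alpha=(\alpha_1,\dots,\alpha_n)$ with $\alpha_i\subset A_i$ of size $d_i$. The packing complex $\mathcal{C}_{\mathcal{A}}^{\underline{d}}$ is the simplicial complex whose $(r-1)$-simplices are the subsets $\{\alpha^1,\dots,\alpha^r\}\subset V$ such that $\alpha^i_k\cap\alpha^j_k=\emptyset$ for all $i\neq j$ and all $1\le k\le n$. $\tilde{H}_k$ denotes reduced homology with coefficients in $\mathbb{K}$ (with $\tilde{H}_{-1}(\emptyset)=\mathbb{K}$). Injections of the sets $A_i$ induce maps of packing complexes, hence maps on homology, which gives the functoriality of $\mathcal{H}_k$. $\mathrm{FI}^n$-modules: let $\mathrm{Set}$ be the category of finite sets with injective maps. An $\mathrm{FI}^n$-module is a functor $V:\mathrm{Set}^n\to\mathrm{Vec}$. For an $n$-tuple $\underline{N}=(N_1,\dots,N_n)$ of integers, $V_{\underline{N}}$ is its value on $(\{1,\dots,N_1\},\dots,\{1,\dots,N_n\})$, a representation of $\mathfrak{S}_{\underline{N}}=\mathfrak{S}_{N_1}\times\cdots\times\mathfrak{S}_{N_n}$; for $\underline{N}\leq\underline{N}'$ (componentwise), $\phi_{\underline{N},\underline{N}'}:V_{\underline{N}}\to V_{\underline{N}'}$ is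 the map induced by the standard inclusions. ''For $\underline{N}\gg0$'' means for all sufficiently large values of all $N_1,\dots,N_n$. An $n$-partition is an $n$-tuple $\lambda=(\lambda^1,\dots,\lambda^n)$ of partitions. $\lambda[\underline{N}]$ denotes the $n$-partition with $i$-th entry $(N_i-|\lambda^i|,\lambda^i_1,\lambda^i_2,\dots)$, defined when $N_i\geq|\lambda^i|+\lambda^i_1$ for all $i$. For an $n$-partition $\mu$ of $\underline N$ (i.e. $|\mu^i|=N_i$), $[\mu]=[\mu^1]\otimes\cdots\otimes[\mu^n]$ is the corresponding irreducible $\mathfrak{S}_{\underline{N}}$-representation and $U_\mu$ is the $\mu$-isotypic component of a representation $U$; $U_{\lambda[\underline N]}=0$ if $\lambda[\underline{N}]$ is undefined. For $\underline N\le\underline N'$ and $\lambda$, the maps $\phi$ induce $$\phi_{\underline{N},\underline{N}'}(\lambda):\left(\mathrm{Ind}_{\mathfrak{S}_{\underline{N}}}^{\mathfrak{S}_{\underline{N}'}}\left((V_{\underline{N}})_{\lambda[\underline{N}]}\right)\right)_{\lambda[\underline{N}']}\longrightarrow (V_{\underline{N}'})_{\lambda[\underline{N}']}.$$ $V$ has stable range $\underline{N}'\geq\underline{N}$ if $\phi_{\underline{N},\underline{N}'}(\lambda)$ is an isomorphism for all $\lambda$ and all $\underline N'\geq\underline{N}$. $V$ is representation stable if for $\underline{N}\gg 0$ the maps $\phi_{\underline{N},\underline{N}'}(\lambda)$ are isomorphisms for all $\lambda$ and all $\underline{N}'\geq\underline{N}$ (the bound on $\underline N$ being uniform in $\lambda$).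 Given $I\subset\{1,\dots,n\}$ with $|I|=s$ and fixed finite sets $A_i$, $i\in I$, the restriction (pull-back) of $V$ is the $\mathrm{FI}^{n-s}$-module $(A_j)_{j\notin I}\mapsto V(A_1,\dots,A_n)$. $V$ is representation superstable if all its restrictions are representation stable. $V$ is trivial if $V_{\underline{N}}=0$ for $\underline{N}\gg 0$. *)

(* Defs.v *)
From HB Require Import structures.
From mathcomp Require Import all_boot all_order all_algebra all_fingroup all_solvable.
From mathcomp Require Import boolp.

Set Implicit Arguments.
Unset Strict Implicit.
Unset Printing Implicit Defensive.
Import GRing.Theory.
Local Open Scope ring_scope.

Section VectorSpaces.
Variables (K : fieldType) (U : vectType K).
Implicit Types (P : {vspace U} -> Prop) (X Y Z B W : {vspace U}).

Lemma vsum_exists P : exists X, (forall W, P W -> (W <= X)%VS) /\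
  (forall Y, (forall W, P W -> (W <= Y)%VS) -> (X <= Y)%VS).
Proof.
pose Q n := `[< exists s : seq {vspace U}, (forall W, W \in s -> P W) /\
  \dim (\sum_(W <- s) W)%VS = n >].
have exQ : exists n, Q n.
  by exists (\dim (\sum_(W <- [::]) W : {vspace U})%VS); apply/asboolP; exists [::].
have ubQ n : Q n -> (n <= \dim {: U})%N.
  by move=> /asboolP[s [_ <-]]; apply/dimvS/subvf.
case: (ex_maxnP exQ ubQ) => n /asboolP[s [Ps dims]] maxn.
exists (\sum_(W <- s) W)%VS; split=> [W PW|Y PY]; last first.
  rewrite big_seq; elim/big_ind: _ => [|A A' sA sA'|W /Ps/PY//].
    exact: sub0v.
  by rewrite subv_add sA.
have : Q (\dim (\sum_(W' <- W :: s) W')%VS).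
  apply/asboolP; exists (W :: s); split=> // W'.
  by rewrite inE => /predU1P[->//|/Ps].
move/maxn; rewrite -dims big_cons => le_dim.
have /eqP -> : (\sum_(W' <- s) W' == W + \sum_(W' <- s) W')%VS.
  by rewrite eqEdim addvSr le_dim.
exact: addvSl.
Qed.

Definition vsum P : {vspace U} := projT1 (cid (vsum_exists P)).

Lemma vsum_sup P W : P W -> (W <= vsum P)%VS.
Proof. by rewrite /vsum; case: cid => X [+ _] /=; apply. Qed.

Lemma vsum_least P Y : (forall W, P W -> (W <= Y)%VS) -> (vsum P <= Y)%VS.
Proof. by rewrite /vsum; case: cid => X [_ +] /=; apply. Qed.

(* The quotient Z / B (for B a subspace of Z), carried by a complement of B in *)
(* Z; the class map Z -> Z / B is onto with kernel B, by the lemmas below.     *)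
Definition quotv Z B : vectType K := subvs_of (Z :\: B)%VS.

Definition quotv_class Z B : 'Hom(U, quotv Z B) :=
  (linfun (vsproj (Z :\: B)%VS) \o addv_pi1 Z B)%VF.

Definition quotv_repr Z B : 'Hom(quotv Z B, U) := linfun (@vsval _ _ (Z :\: B)%VS).

Lemma quotv_repr_in Z B x : quotv_repr Z B x \in Z.
Proof. by rewrite lfunE; exact: subvP (diffvSl Z B) _ (subvsP x). Qed.

Lemma quotv_reprK Z B : cancel (quotv_repr Z B) (quotv_class Z B).
Proof.
move=> x; rewrite comp_lfunE !lfunE /= /addv_pi1 daddv_pi_id ?vsvalK ?subvsP //.
exact: capv_diff.
Qed.

Lemma quotv_classK Z B z : z \in Z -> z - quotv_repr Z B (quotv_class Z B z) \in B.
Proof.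
move=> zZ; have zZB : z \in (Z + B)%VS by apply: subvP (addvSl Z B) _ zZ.
rewrite comp_lfunE !lfunE /= vsprojK ?memv_pi //.
by rewrite -{1}(addv_pi1_pi2 zZB) addrAC subrr add0r memv_pi.
Qed.

Lemma quotv_class0 Z B z : z \in B -> quotv_class Z B z = 0.
Proof.
move=> zB; have zZB : z \in (Z + B)%VS by apply: subvP (addvSr Z B) _ zB.
rewrite comp_lfunE; have := addv_pi1_pi2 zZB.
by rewrite addv_pi2_id // => /(canRL (addrK _)); rewrite subrr => ->; rewrite linear0.
Qed.

Lemma quotv_class_eq0 Z B z : (B <= Z)%VS -> z \in Z ->
  (quotv_class Z B z == 0) = (z \in B).
Proof.
move=> sBZ zZ; apply/eqP/idP => [z0|]; last exact: quotv_class0.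
by have := quotv_classK B zZ; rewrite z0 linear0 subr0.
Qed.

End VectorSpaces.

Section QuotMap.
Variables (K : fieldType).

Definition quotv_map (U U' : vectType K) Z B Z' B' (f : 'Hom(U, U')) :
    'Hom(quotv Z B, quotv Z' B') :=
  (quotv_class Z' B' \o f \o quotv_repr Z B)%VF.

Lemma quotv_map_repr (U U' : vectType K) (Z B : {vspace U}) (Z' B' : {vspace U'})
    (f : 'Hom(U, U')) x :
  quotv_map Z B Z' B' f x = quotv_class Z' B' (f (quotv_repr Z B x)).
Proof. by rewrite [LHS]comp_lfunE [LHS]comp_lfunE. Qed.

Lemma quotv_mapE (U U' : vectType K) (Z B : {vspace U}) (Z' B' : {vspace U'})
    (f : 'Hom(U, U')) z :
  (f @: B <= B')%VS -> z \in Z ->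
  quotv_map Z B Z' B' f (quotv_class Z B z) = quotv_class Z' B' (f z).
Proof.
move=> fB zZ; rewrite quotv_map_repr; apply/esym/eqP.
rewrite -subr_eq0 -(linearB (quotv_class Z' B')) -(linearB f).
by apply/eqP/quotv_class0; apply: (subvP fB); apply: memv_img; exact: quotv_classK.
Qed.

Lemma quotv_map_id (U : vectType K) (Z B : {vspace U}) :
  quotv_map Z B Z B \1%VF = \1%VF.
Proof.
by apply/lfunP=> x; rewrite quotv_map_repr !id_lfunE quotv_reprK.
Qed.

Lemma quotv_map_comp (U1 U2 U3 : vectType K) (Z1 B1 : {vspace U1})
    (Z2 B2 : {vspace U2}) (Z3 B3 : {vspace U3}) (g : 'Hom(U2, U3)) (f : 'Hom(U1, U2)) :
  (f @: Z1 <= Z2)%VS -> (g @: B2 <= B3)%VS ->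
  quotv_map Z1 B1 Z3 B3 (g \o f) =
    (quotv_map Z2 B2 Z3 B3 g \o quotv_map Z1 B1 Z2 B2 f)%VF.
Proof.
move=> fZ gB; apply/lfunP=> x; rewrite comp_lfunE (quotv_map_repr Z2 B2 f).
rewrite quotv_mapE // ?quotv_map_repr ?comp_lfunE //.
by apply: subvP fZ _ _; apply/memv_img/quotv_repr_in.
Qed.

End QuotMap.

(* Reduced simplicial homology of a finite abstract simplicial complex X, given *)
(* as the family of its simplices, the empty one included.  Everything is       *)
(* indexed by the number p of vertices, which is the dimension plus one.        *)

Section Simplicial.
Variable K : fieldType.

(* A p-chain is a function c on p-tuples of vertices: c t is the coefficient of *)
(* the oriented simplex t, so that c is alternating.                            *)
Definition osimplex (T : finType) p (t : p.-tuple T) : {ffun p.-tuple T -> K^o} :=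
  [ffun u : p.-tuple T => \sum_(s : 'S_p | u == [tuple tnth t (s i) | i < p]) (-1) ^+ s].

Definition chains (T : finType) (X : {set {set T}}) p :
    {vspace {ffun p.-tuple T -> K^o}} :=
  <<[seq osimplex t | t <- enum [pred t : p.-tuple T | uniq t & [set x in t] \in X]]>>%VS.

(* The coefficient of [t] in the boundary of [v0, ..., vp] is nonzero only if   *)
(* [v0, ..., vp] = +/- [v :: t] for some v, and is then that sign.              *)
Definition boundary_fun (T : finType) p (c : {ffun p.+1.-tuple T -> K^o}) :
    {ffun p.-tuple T -> K^o} := [ffun t : p.-tuple T => \sum_v c [tuple of v :: t]].

Definition boundary (T : finType) p :
    'Hom({ffun p.+1.-tuple T -> K^o}, {ffun p.-tuple T -> K^o}) :=
  linfun (@boundary_fun T p).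

Definition cycles (T : finType) (X : {set {set T}}) p :
    {vspace {ffun p.-tuple T -> K^o}} :=
  match p with
  | 0 => chains X 0
  | q.+1 => (chains X q.+1 :&: lker (boundary T q))%VS
  end.

Definition boundaries (T : finType) (X : {set {set T}}) p :
    {vspace {ffun p.-tuple T -> K^o}} := (boundary T p @: chains X p.+1)%VS.

Definition homology (T : finType) (X : {set {set T}}) p : vectType K :=
  quotv (cycles X p) (boundaries X p).

Definition push_fun (T T' : finType) (f : T -> T') p (c : {ffun p.-tuple T -> K^o}) :
    {ffun p.-tuple T' -> K^o} :=
  [ffun u : p.-tuple T' => \sum_(t : p.-tuple T | [tuple of map f t] == u) c t].

Definition push (T T' : finType) (f : T -> T') p :
    'Hom({ffun p.-tuple T -> K^o}, {ffun p.-tuple T' -> K^o}) :=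
  linfun (@push_fun T T' f p).

Definition homology_map (T T' : finType) (X : {set {set T}}) (X' : {set {set T'}})
    (f : T -> T') p : 'Hom(homology X p, homology X' p) :=
  quotv_map (cycles X p) (boundaries X p) (cycles X' p) (boundaries X' p) (push f p).

Fact boundary_is_linear (T : finType) p : linear (@boundary_fun T p).
Proof.
move=> a c c'; apply/ffunP=> t; rewrite !ffunE scaler_sumr -big_split /=.
by apply: eq_bigr => v _; rewrite !ffunE.
Qed.
HB.instance Definition _ (T : finType) p :=
  GRing.isLinear.Build K _ _ _ (@boundary_fun T p) (@boundary_is_linear T p).

Lemma boundaryE (T : finType) p c (t : p.-tuple T) :
  boundary T p c t = \sum_v c [tuple of v :: t].
Proof. by rewrite lfunE ffunE. Qed.

Fact push_is_linear (T T' : finType) (f : T -> T') p : linear (@push_fun T T' f p).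
Proof.
move=> a c c'; apply/ffunP=> t; rewrite !ffunE scaler_sumr -big_split /=.
by apply: eq_bigr => v _; rewrite !ffunE.
Qed.
HB.instance Definition _ (T T' : finType) (f : T -> T') p :=
  GRing.isLinear.Build K _ _ _ (@push_fun T T' f p) (@push_is_linear T T' f p).

Lemma pushE (T T' : finType) (f : T -> T') p c (u : p.-tuple T') :
  push f p c u = \sum_(t : p.-tuple T | [tuple of map f t] == u) c t.
Proof. by rewrite lfunE ffunE. Qed.

Lemma push_id (T : finType) p : push id p = \1%VF :> 'End({ffun p.-tuple T -> K^o}).
Proof.
apply/lfunP=> c; rewrite id_lfunE; apply/ffunP=> u; rewrite pushE.
rewrite (eq_bigl (pred1 u)) ?big_pred1_eq // => t /=.
by congr (_ == u); apply: val_inj; rewrite /= map_id.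
Qed.

Lemma push_comp (T T' T'' : finType) (g : T' -> T'') (f : T -> T') p :
  push (g \o f) p = (push g p \o push f p)%VF.
Proof.
apply/lfunP=> c; rewrite comp_lfunE; apply/ffunP=> w; rewrite !pushE.
rewrite (partition_big (fun t : p.-tuple T => [tuple of map f t])
           (fun u => [tuple of map g u] == w)) /=; last first.
  by move=> t; rewrite -!val_eqE /= map_comp.
apply: eq_bigr => u /eqP <-; rewrite pushE; apply: eq_bigl => t.
apply/andP/idP => [[]//|/eqP <-]; split=> //.
by rewrite -val_eqE /= map_comp.
Qed.

Lemma push_osimplex (T T' : finType) (f : T -> T') p (t : p.-tuple T) :
  push f p (osimplex t) = osimplex [tuple of map f t].
Proof.
have tE (s : 'S_p) : [tuple tnth [tuple of map f t] (s i) | i < p] =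
                     [tuple of map f [tuple tnth t (s i) | i < p]].
  by apply: eq_from_tnth => i; rewrite !(tnth_mktuple, tnth_map).
apply/ffunP=> u; rewrite pushE ffunE.
under eq_bigr do rewrite ffunE big_mkcond.
rewrite exchange_big [RHS]big_mkcond /=; apply: eq_bigr => s _; rewrite tE.
case: eqP => [->|neq].
  rewrite (bigD1 [tuple tnth t (s i) | i < p]) //= eqxx big1 ?addr0 // => v.
  by case/andP=> _ /negPf->.
by rewrite big1 // => v /eqP vu; case: eqP => // vt; case: neq; rewrite -vt vu.
Qed.

Lemma push_boundary (T T' : finType) (f : T -> T') p :
  (push f p \o boundary T p)%VF = (boundary T' p \o push f p.+1)%VF.
Proof.
apply/lfunP=> c; rewrite !comp_lfunE; apply/ffunP=> u; rewrite pushE boundaryE.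
under eq_bigr do rewrite boundaryE.
under [RHS]eq_bigr do rewrite pushE.
rewrite pair_big_dep /= [RHS](exchange_big_dep predT) //=.
rewrite (reindex (fun t : p.+1.-tuple T => ([tuple of behead t], thead t))) /=.
  rewrite big_mkcond; apply: eq_bigr => t _; rewrite -tuple_eta andbT.
  have eqE w : ([tuple of map f t] == [tuple of w :: u]) =
      (w == f (thead t)) && ([tuple of map f [tuple of behead t]] == u).
    by case/tupleP: t => v t; rewrite -!val_eqE /= eqseq_cons eq_sym theadE.
  under [RHS]eq_bigl do rewrite eqE.
  by case: eqP => _; [rewrite (big_pred1 (f (thead t)))|rewrite big_pred0] => // w;
    rewrite ?andbT ?andbF.
exists (fun x : p.-tuple T * T => [tuple of x.2 :: x.1]) => [t _|[t v] _].
  by rewrite -tuple_eta.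
by rewrite /= theadE; congr pair; apply: val_inj.
Qed.

Lemma push_chains (T T' : finType) (X : {set {set T}}) (X' : {set {set T'}})
    (f : T -> T') p : injective f -> (forall s, s \in X -> f @: s \in X') ->
  (push f p @: chains X p <= chains X' p)%VS.
Proof.
move=> inj_f fX; rewrite limg_span; apply/span_subvP=> _ /mapP[_ /mapP[t + ->] ->].
rewrite mem_enum inE => /andP[uniq_t Xt]; rewrite push_osimplex memv_span //.
apply/mapP; exists [tuple of map f t] => //; rewrite mem_enum inE.
rewrite map_inj_uniq // uniq_t /=.
have -> : [set x in map f t] = f @: [set x in t]; last exact: fX.
apply/setP=> y; rewrite inE; apply/mapP/imsetP => [] [x xt ->]; exists x => //.
  by rewrite inE.
by move: xt; rewrite inE.
Qed.

Lemma push_boundaries (T T' : finType) (X : {set {set T}}) (X' : {set {set T'}})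
    (f : T -> T') p : injective f -> (forall s, s \in X -> f @: s \in X') ->
  (push f p @: boundaries X p <= boundaries X' p)%VS.
Proof.
by move=> *; rewrite -limg_comp push_boundary limg_comp limgS // push_chains.
Qed.

Lemma push_cycles (T T' : finType) (X : {set {set T}}) (X' : {set {set T'}})
    (f : T -> T') p : injective f -> (forall s, s \in X -> f @: s \in X') ->
  (push f p @: cycles X p <= cycles X' p)%VS.
Proof.
case: p => [|p] inj_f fX; first exact: push_chains.
apply/subvP=> _ /memv_imgP[c + ->]; rewrite !memv_cap !memv_ker => /andP[Xc /eqP c0].
rewrite (subvP (push_chains _ inj_f fX)) ?memv_img //=.
by rewrite -comp_lfunE -push_boundary comp_lfunE c0 linear0.
Qed.

Lemma homology_map_id (T : finType) (X : {set {set T}}) p :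
  homology_map X X id p = \1%VF.
Proof. by rewrite /homology_map push_id quotv_map_id. Qed.

Lemma homology_map_comp (T1 T2 T3 : finType) (X1 : {set {set T1}})
    (X2 : {set {set T2}}) (X3 : {set {set T3}}) (g : T2 -> T3) (f : T1 -> T2) p :
  injective f -> (forall s, s \in X1 -> f @: s \in X2) ->
  injective g -> (forall s, s \in X2 -> g @: s \in X3) ->
  homology_map X1 X3 (g \o f) p = (homology_map X2 X3 g p \o homology_map X1 X2 f p)%VF.
Proof.
move=> inj_f fX inj_g gX; rewrite /homology_map push_comp; apply: quotv_map_comp.
  exact: push_cycles.
exact: push_boundaries.
Qed.

End Simplicial.

Section FImodules.
Variables (K : fieldType) (J : finType).

Record FIhom (A B : J -> finType) := FIHom {
  FIhom_fun :> forall j, A j -> B j;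
  FIhom_inj : forall j, injective (@FIhom_fun j) }.
#[global] Arguments FIhom_fun [A B] _ j _.

Lemma FIhom_eq A B (f g : FIhom A B) : (forall j, f j =1 g j) -> f = g.
Proof.
case: f g => [f fi] [g gi] /= fg.
have e : f = g by apply: functional_extensionality_dep => j; apply/funext/fg.
by case: _ / e gi => gi; congr FIHom; apply: Prop_irrelevance.
Qed.

Definition FIid A : FIhom A A := FIHom (fun j => @inj_id (A j)).

Definition FIcomp A B C (g : FIhom B C) (f : FIhom A B) : FIhom A C :=
  FIHom (fun j => inj_comp (@FIhom_inj _ _ g j) (@FIhom_inj _ _ f j)).

Record FImod := FIMod {
  FIobj :> (J -> finType) -> vectType K;
  FImap : forall A B, FIhom A B -> 'Hom(FIobj A, FIobj B);
  FImap_id : forall A, FImap (FIid A) = \1%VF;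
  FImap_comp : forall A B C (g : FIhom B C) (f : FIhom A B),
    FImap (FIcomp g f) = (FImap g \o FImap f)%VF }.

End FImodules.

Section Packing.
Variables (K : fieldType) (J : finType) (d : J -> nat).
Implicit Types A B C : J -> finType.

Definition subset_tuple A : finType := {dffun forall j, {set A j}}.

Definition packing A : {set {set subset_tuple A}} :=
  [set s : {set subset_tuple A} |
    [forall a in s, forall j, #|a j| == d j] &&
    [forall a in s, forall b in s, (a != b) ==> [forall j, [disjoint a j & b j]]]].

Definition subset_map A B (f : FIhom A B) (a : subset_tuple A) : subset_tuple B :=
  [ffun j => f j @: a j].

Lemma subset_map_inj A B (f : FIhom A B) : injective (subset_map f).
Proof.
move=> a b /ffunP ab; apply/ffunP=> j; move: (ab j); rewrite !ffunE.
exact/imset_inj/FIhom_inj.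
Qed.

Lemma subset_map_packing A B (f : FIhom A B) s :
  s \in packing A -> subset_map f @: s \in packing B.
Proof.
rewrite !inE => /andP[/forall_inP sz /forall_inP disj]; apply/andP; split.
  apply/forall_inP=> _ /imsetP[a sa ->]; apply/forallP=> j; rewrite ffunE.
  by rewrite card_imset ?(forallP (sz a sa)) //; exact: FIhom_inj.
apply/forall_inP=> _ /imsetP[a sa ->]; apply/forall_inP=> _ /imsetP[b sb ->].
apply/implyP=> neq; have {neq}ab: a != b by apply: contraNneq neq => ->.
have /forallP dab := implyP (forall_inP (disj a sa) b sb) ab.
apply/forallP=> j; rewrite !ffunE -setI_eq0 -imsetI; last first.
  by move=> x y _ _; exact: FIhom_inj.
by have := dab j; rewrite -setI_eq0 => /eqP->; rewrite imset0.
Qed.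

Lemma subset_map_id A : subset_map (FIid A) = id.
Proof. by apply/funext=> a; apply/ffunP=> j; rewrite ffunE imset_id. Qed.

Lemma subset_map_comp A B C (g : FIhom B C) (f : FIhom A B) :
  subset_map (FIcomp g f) = subset_map g \o subset_map f.
Proof.
by apply/funext=> a; apply/ffunP=> j; rewrite /= !ffunE imset_comp.
Qed.

Fact packing_map_id p A :
  homology_map K (packing A) (packing A) (subset_map (FIid A)) p = \1%VF.
Proof. by rewrite subset_map_id homology_map_id. Qed.

Fact packing_map_comp p A B C (g : FIhom B C) (f : FIhom A B) :
  homology_map K (packing A) (packing C) (subset_map (FIcomp g f)) p =
  (homology_map K (packing B) (packing C) (subset_map g) p \o
   homology_map K (packing A) (packing B) (subset_map f) p)%VF.
Proof.
rewrite subset_map_comp; apply: homology_map_comp.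
- exact: subset_map_inj.
- exact: subset_map_packing.
- exact: subset_map_inj.
exact: subset_map_packing.
Qed.

(* k is the dimension; only k >= -1 is meaningful. *)
Definition packing_homology (k : int) : FImod K J :=
  FIMod (@packing_map_id (absz (k + 1))) (@packing_map_comp (absz (k + 1))).

End Packing.

(* In MathComp s * t is the permutation "s, then t".  A representation of the   *)
(* symmetric group for the usual composition is thus a family of endomorphisms  *)
(* rho with rho (s * t) = rho t \o rho s, and everything below is written for   *)
(* such (right) actions.                                                        *)

Section Representations.
Variable K : fieldType.

Definition translate_fun (G : finGroupType) (U : vectType K) (x : G)
    (f : {ffun G -> U}) : {ffun G -> U} := [ffun g => f (g * x^-1)%g].

Fact translate_is_linear (G : finGroupType) (U : vectType K) (x : G) :
  linear (@translate_fun G U x).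
Proof. by move=> a f f'; apply/ffunP=> g; rewrite !ffunE. Qed.
HB.instance Definition _ (G : finGroupType) (U : vectType K) (x : G) :=
  GRing.isLinear.Build K _ _ _ (@translate_fun G U x) (@translate_is_linear G U x).

(* For U = K^o this is right multiplication by x on the group algebra, where f  *)
(* stands for the sum of the f g *: g.                                          *)
Definition translate (G : finGroupType) (U : vectType K) (x : G) :
  'End({ffun G -> U}) := linfun (@translate_fun G U x).

Lemma translateE (G : finGroupType) (U : vectType K) (x : G) (f : {ffun G -> U}) g :
  translate U x f g = f (g * x^-1)%g.
Proof. by rewrite lfunE ffunE. Qed.

Definition subrep_iso (G : finType) (U1 U2 : vectType K) (rho1 : G -> 'End(U1))
    (rho2 : G -> 'End(U2)) (X1 : {vspace U1}) (X2 : {vspace U2}) : Prop :=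
  exists f : 'Hom(U1, U2),
    [/\ (f @: X1)%VS = X2, (X1 :&: lker f)%VS = 0%VS
      & forall g, {in X1, forall u, f (rho1 g u) = rho2 g (f u)}].

Definition isotypic (G : finType) (U0 U : vectType K) (rho0 : G -> 'End(U0))
    (rho : G -> 'End(U)) (S : {vspace U0}) (X : {vspace U}) : {vspace U} :=
  vsum (fun W => (W <= X)%VS /\ subrep_iso rho0 rho S W).

(* The Specht module of the partition sh of N: the right ideal of the group     *)
(* algebra of 'S_N generated by the Young symmetrizer of the tableau of shape   *)
(* sh filled with 0, ..., N.-1 row by row, so that sh = [:: N] gives the        *)
(* trivial representation.                                                      *)
Section Specht.
Variables (N : nat) (sh : seq nat).

Definition row_stab : {set 'S_N} :=
  [set s : 'S_N | [forall i, reshape_index sh (s i) == reshape_index sh i]].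

Definition col_stab : {set 'S_N} :=
  [set s : 'S_N | [forall i, reshape_offset sh (s i) == reshape_offset sh i]].

Definition young_symmetrizer : {ffun 'S_N -> K^o} :=
  [ffun g => \sum_(p in row_stab) \sum_(q in col_stab | (p * q)%g == g) (-1) ^+ q].

Definition specht : {vspace {ffun 'S_N -> K^o}} :=
  <<[seq translate K^o g young_symmetrizer | g <- enum 'S_N]>>%VS.

End Specht.

(* The external tensor product of spaces W j of functions on finite sets, as    *)
(* the space of functions on the product set spanned by the pure tensors.       *)
Definition pure_tensor (J : finType) (X : J -> finType)
    (w : forall j, {ffun X j -> K^o}) : {ffun {dffun forall j, X j} -> K^o} :=
  [ffun x : {dffun forall j, X j} => \prod_j (w j (x j) : K)].

Definition tensor (J : finType) (X : J -> finType)
    (W : forall j, {vspace {ffun X j -> K^o}}) :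
    {vspace {ffun {dffun forall j, X j} -> K^o}} :=
  vsum (fun L => exists2 w, forall j, w j \in W j & L = <[pure_tensor w]>%VS).

End Representations.

Definition is_partition (sh : seq nat) : bool := sorted geq sh && (0%N \notin sh).

Definition embed_perm_fun m n (le_mn : (m <= n)%N) (s : 'S_m) (i : 'I_n) : 'I_n :=
  if insub (i : nat) is Some x then widen_ord le_mn (s x) else i.

Fact embed_perm_inj m n (le_mn : (m <= n)%N) (s : 'S_m) :
  injective (embed_perm_fun le_mn s).
Proof.
move=> i j; rewrite /embed_perm_fun.
case: insubP => [x _ xi|ni]; case: insubP => [y _ yj|nj] => /(congr1 val) /= e.
- by apply: val_inj; rewrite /= -xi -yj; congr val; apply/(@perm_inj _ s)/val_inj.
- by case/negP: nj; rewrite -e.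
- by case/negP: ni; rewrite e.
exact: val_inj.
Qed.

Definition embed_perm m n (le_mn : (m <= n)%N) (s : 'S_m) : 'S_n :=
  perm (@embed_perm_inj m n le_mn s).

Section Stability.
Variables (K : fieldType) (J : finType).
Implicit Types (N : J -> nat) (la : J -> seq nat).

Definition symJ N : finGroupType := {dffun forall j, 'S_(N j)}.

Definition ordJ N : J -> finType := fun j => 'I_(N j).

Definition leJ N N' := forall j, (N j <= N' j)%N.

Definition perm_hom N (s : symJ N) : FIhom (ordJ N) (ordJ N) :=
  FIHom (fun j => @perm_inj _ (s j)).

Fact widen_ord_inj m n (le_mn : (m <= n)%N) : injective (widen_ord le_mn).
Proof. by move=> i j /(congr1 val) /= /val_inj. Qed.

Definition incl_hom N N' (le : leJ N N') : FIhom (ordJ N) (ordJ N') :=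
  FIHom (fun j => widen_ord_inj (le_mn := le j)).

Definition embed_sym N N' (le : leJ N N') (s : symJ N) : symJ N' :=
  [ffun j => embed_perm (le j) (s j)].

Variable V : FImod K J.

Definition sym_action N (s : symJ N) : 'End(V (ordJ N)) := FImap V (perm_hom s).

Lemma sym_actionM N (s t : symJ N) :
  sym_action (s * t)%g = (sym_action t \o sym_action s)%VF.
Proof.
rewrite -FImap_comp; congr FImap; apply: FIhom_eq => j x /=.
by rewrite ffunE permM.
Qed.

Lemma sym_action1 N : sym_action (1%g : symJ N) = \1%VF.
Proof.
rewrite -FImap_id; congr FImap; apply: FIhom_eq => j x /=.
by rewrite ffunE perm1.
Qed.

Lemma sym_action_incl N N' (le : leJ N N') (s : symJ N) :
  (sym_action (embed_sym le s) \o FImap V (incl_hom le))%VF =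
  (FImap V (incl_hom le) \o sym_action s)%VF.
Proof.
rewrite -!FImap_comp; congr FImap; apply: FIhom_eq => j x /=.
rewrite ffunE permE /embed_perm_fun insubT /=; first exact: ltn_ord.
by move=> lt; congr widen_ord; congr (_ _); apply: val_inj.
Qed.

Definition irrep N (mu : J -> seq nat) : {vspace {ffun symJ N -> K^o}} :=
  tensor (fun j => specht K (N j) (mu j)).

(* la[N], and the condition under which it is defined. *)
Definition pad la N : J -> seq nat := fun j => ((N j - sumn (la j))%N :: la j).

Definition pad_defined la N : bool :=
  [forall j, sumn (la j) + head 0 (la j) <= N j]%N.

Definition pad_isotypic la N (U : vectType K) (rho : symJ N -> 'End(U))
    (X : {vspace U}) : {vspace U} :=
  if pad_defined la N
  then isotypic (@translate K (symJ N) K^o) rho (irrep N (pad la N)) X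
  else 0%VS.

(* The representation induced from a subrepresentation X of V_N: the functions  *)
(* f from the big group to X with f (h g) = f(g) h^-1 for h in the small group, *)
(* with (f x)(g) = f (g x^-1).  Such an f stands for the sum of the f(g) (x) g  *)
(* over representatives g of the cosets of the small group.                     *)
Definition eval_at (G : finType) (U : vectType K) (g : G) : 'Hom({ffun G -> U}, U) :=
  linfun (fun f : {ffun G -> U} => f g).

Fact eval_at_is_linear (G : finType) (U : vectType K) (g : G) :
  linear (fun f : {ffun G -> U} => f g).
Proof. by move=> a f f'; rewrite !ffunE. Qed.

Lemma eval_atE (G : finType) (U : vectType K) (g : G) f : eval_at U g f = f g.
Proof.
pose ev := GRing.isLinear.Build K _ _ _ _ (@eval_at_is_linear G U g).
pose lin : {linear {ffun G -> U} -> U} := HB.pack (fun f : {ffun G -> U} => f g) ev.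
exact: (lfunE lin).
Qed.

Definition induced N N' (le : leJ N N') (X : {vspace V (ordJ N)}) :
    {vspace {ffun symJ N' -> V (ordJ N)}} :=
  ((\bigcap_(g : symJ N') (eval_at _ g @^-1: X)) :&:
   (\bigcap_(h : symJ N) \bigcap_(g : symJ N')
      lker ((sym_action h \o eval_at _ (embed_sym le h * g)%g)%VF - eval_at _ g)))%VS.

Lemma inducedP N N' (le : leJ N N') (X : {vspace V (ordJ N)}) f :
  f \in induced le X <-> (forall g, f g \in X) /\
    (forall h g, sym_action h (f (embed_sym le h * g)%g) = f g).
Proof.
split=> [|[fX fh]].
  rewrite memvE subv_cap => /andP[/subv_bigcapP fX /subv_bigcapP fh].
  split=> [g|h g]; first by have := fX g isT; rewrite -memvE -memv_preim eval_atE.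
  have /subv_bigcapP/(_ g isT) := fh h isT.
  by rewrite -memvE memv_ker !lfun_simp !eval_atE subr_eq0 => /eqP.
rewrite memvE subv_cap; apply/andP; split; apply/subv_bigcapP => g _.
  by rewrite -memvE -memv_preim eval_atE.
apply/subv_bigcapP => g' _.
by rewrite -memvE memv_ker !lfun_simp !eval_atE subr_eq0 fh.
Qed.

(* The sum over cosets is taken as the average over the small group. *)
Definition induced_map_fun N N' (le : leJ N N') (f : {ffun symJ N' -> V (ordJ N)}) :
    V (ordJ N') :=
  (#|symJ N|%:R : K)^-1 *:
    \sum_(g : symJ N') sym_action g (FImap V (incl_hom le) (f g)).

Definition induced_map N N' (le : leJ N N') :
    'Hom({ffun symJ N' -> V (ordJ N)}, V (ordJ N')) := linfun (induced_map_fun le).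

Fact induced_map_is_linear N N' (le : leJ N N') : linear (induced_map_fun le).
Proof.
move=> a f f'; rewrite /induced_map_fun scalerA mulrC -scalerA -scalerDr.
congr (_ *: _); rewrite scaler_sumr -big_split /=; apply: eq_bigr => g _.
by rewrite !ffunE !linearP.
Qed.
HB.instance Definition _ N N' (le : leJ N N') :=
  GRing.isLinear.Build K _ _ _ (induced_map_fun le) (induced_map_is_linear le).

Lemma induced_mapE N N' (le : leJ N N') f : induced_map le f = induced_map_fun le f.
Proof. exact: lfunE. Qed.

Definition phi_source N N' (le : leJ N N') la : {vspace {ffun symJ N' -> V (ordJ N)}} :=
  pad_isotypic la (@translate K (symJ N') (V (ordJ N)))
    (induced le (pad_isotypic la (@sym_action N) fullv)).

Definition phi_target N' la : {vspace V (ordJ N')} :=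
  pad_isotypic la (@sym_action N') fullv.

Definition phi_iso N N' (le : leJ N N') la : Prop :=
  (induced_map le @: phi_source le la)%VS = phi_target N' la /\
  (phi_source le la :&: lker (induced_map le))%VS = 0%VS.

Definition stable_range N : Prop :=
  forall N' (le : leJ N N') la, (forall j, is_partition (la j)) -> phi_iso le la.

Definition representation_stable : Prop :=
  exists N0, forall N, leJ N0 N -> stable_range N.

Definition trivial_FImod : Prop :=
  exists N0, forall N, leJ N0 N -> fullv = 0%VS :> {vspace V (ordJ N)}.

End Stability.

(* The restriction of V along the fixed sets A j, for j in I (the other values  *)
(* of A are not used), a module over the remaining variables.                   *)

Section Restriction.
Variables (K : fieldType) (J : finType) (V : FImod K J).
Variables (I : {set J}) (A : J -> finType).
Implicit Types B C D : {j | j \notin I} -> finType.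

Definition glue B : J -> finType := fun j => oapp B (A j) (insub j).

Definition glue_fun B C (f : FIhom B C) j : glue B j -> glue C j :=
  match insub j as o return oapp B (A j) o -> oapp C (A j) o with
  | Some x => f x
  | None => id
  end.

Fact glue_fun_inj B C (f : FIhom B C) j : injective (@glue_fun B C f j).
Proof.
rewrite /glue_fun /glue; case: (insub j) => [x|] //=; exact: FIhom_inj.
Qed.

Definition glue_hom B C (f : FIhom B C) : FIhom (glue B) (glue C) :=
  FIHom (@glue_fun_inj B C f).

Fact glue_id B : FImap V (glue_hom (FIid B)) = \1%VF.
Proof.
rewrite -FImap_id; congr FImap; apply: FIhom_eq => j; rewrite /= /glue_fun /glue.
by case: (insub j).
Qed.

Fact glue_comp B C D (g : FIhom C D) (f : FIhom B C) :
  FImap V (glue_hom (FIcomp g f)) =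
  (FImap V (glue_hom g) \o FImap V (glue_hom f))%VF.
Proof.
rewrite -FImap_comp; congr FImap; apply: FIhom_eq => j; rewrite /= /glue_fun /glue.
by case: (insub j).
Qed.

Definition restriction : FImod K {j | j \notin I} := FIMod glue_id glue_comp.

End Restriction.

Definition representation_superstable (K : fieldType) (J : finType) (V : FImod K J) :
    Prop :=
  forall (I : {set J}) (A : J -> finType), representation_stable (restriction V I A).

Definition is_min_over (J : finType) (P : pred J) (F : J -> nat) (m : nat) : Prop :=
  (exists2 j, P j & F j = m) /\ (forall j, P j -> m <= F j)%N.

(* Main.v *)
From HB Require Import structures.
Require Import Defs.
From mathcomp Require Import all_boot all_order all_algebra all_fingroup.
From mathcomp Require Import zify.

(* Let a and b be the row symmetrizer and the column antisymmetrizer of a       *)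
(* tableau of shape la[N], filled so that the tableau of la[N'] only adds boxes *)
(* at the end of the first row; a' and b' are those of la[N'], and b' = b.      *)
(* Chains are spanned by fillings of the boxes in which at most p d_j boxes are *)
(* used.  On chains, (1) phi(f) b a' = 0 implies f b a = 0, because two         *)
(* fillings have the same row contents if and only if they do after adding      *)
(* unused boxes, and (2) every c b a' is some phi(f) b a' as soon as N_j >= 2 p *)
(* d_j, because b kills a filling with two unused boxes in a column, and        *)
(* otherwise there is room to bring the used boxes inside N.  As b a is quasi-  *)
(* idempotent, (1) and (2) pass to homology. They imply the theorem: b K[S_N']  *)
(* a' = K b a' (von Neumann), hence the image of the induced representation     *)
(* under b a' consists of the y (x) b a' for y in V_N. The vanishing of         *)
(* homology for large N is an independent cone argument.                        *)

Set Implicit Arguments.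
Unset Strict Implicit.
Unset Printing Implicit Defensive.
Import GRing.Theory Num.Theory.
Local Open Scope ring_scope.

(** * Group algebras *)

(** Write y = b a and y' = b' a' for the symmetrizers [ysym] of la[N] and la[N'], acting on the
    right. The la[N]-isotypic component of V_N is V_N y K[S_N] ([pad_isotypicE], from the general
    [isotypic_alggen]), and V_N y measures its multiplicity. By [phi_iso_criterion], phi(la) is an
    isomorphism as soon as (1) phi(u) y' = 0 implies u y = 0, and (2) every v y' equals some phi(u)
    y'. This rests on two facts about Young symmetrizers: y is quasi-idempotent with a nonzero
    scalar ([ba_sqr]), and, by von Neumann's lemma for the pair N, N' ([alt_sym_delta]), y g y' is a
    multiple of y' for every g in the large group, so that inducing creates no new vector in the
    multiplicity space.

    Both conditions are checked on chains, whose basis elements are fillings of the boxes. Condition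
    (1) is a comparison of orbits of row stabilizers before and after adding empty boxes
    ([same_orbit], [sym_incl_eq0]). As y and y' commute with boundaries and are idempotent up to a
    scalar, the conditions for p and p + 1 vertices descend to homology ([class_ysym_inj],
    [class_ysym_generated]).

    For fixed k only two values of q occur, which gives a uniform bound and superstability. When
    some of the sets are fixed, the vertices of a simplex are disjoint in each of them, so q <= m
    ([simplex_bound]), which gives the range 2 m d. Triviality is proved apart by cones and links
    ([packing_acyclic]). *)

Lemma span_ind (K : fieldType) (U : vectType K) (s : seq U) (P : U -> Prop) :
  P 0 -> (forall k u v, P u -> P v -> P (k *: u + v)) -> (forall u, u \in s -> P u) ->
  forall v, v \in <<s>>%VS -> P v.
Proof.
move=> P0 PD Ps v /(@coord_span _ _ _ (in_tuple _)) ->.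
elim/big_rec: _ => // i u _; apply: PD; apply: Ps; exact: mem_nth.
Qed.

Section GroupAlgebra.
Variables (K : fieldType) (G : finGroupType).
Implicit Types (x y z e : {ffun G -> K^o}) (g h : G).

Definition right_rep (U : vectType K) (rho : G -> 'End(U)) : Prop :=
  rho 1%g = \1%VF /\ forall g h, rho (g * h)%g = (rho h \o rho g)%VF.

Definition algact (U : vectType K) (rho : G -> 'End(U)) x : 'End(U) :=
  \sum_g (x g : K) *: rho g.

(** The product of the group algebra: [translate] is right multiplication, so x ** y is x acted on
    by y, and associativity is an instance of [algactM]. *)
Definition conv x y : {ffun G -> K^o} := algact (@translate K G K^o) y x.

Definition gdelta g : {ffun G -> K^o} := [ffun h => (h == g)%:R].

(** The anti-automorphism inverting group elements. It serves for positivity: x ** star x has the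
    sum of the squares of the coefficients of x at 1. *)
Definition star x : {ffun G -> K^o} := [ffun g => x g^-1%g].

Local Notation "x ** y" := (conv x y) (at level 40, left associativity).

Lemma translate_rep (U : vectType K) : right_rep (@translate K G U).
Proof.
split=> [|g h]; apply/lfunP=> f; apply/ffunP=> k.
  by rewrite translateE invg1 mulg1 lfunE.
by rewrite comp_lfunE !translateE invMg mulgA.
Qed.

Lemma convE x y g : (x ** y) g = \sum_h (y h : K) * x (g * h^-1)%g.
Proof.
rewrite /conv /algact sum_lfunE sum_ffunE; apply: eq_bigr => h _.
by rewrite scale_lfunE !ffunE translateE.
Qed.

Lemma algact_hom (U U' : vectType K) (rho : G -> 'End(U)) (rho' : G -> 'End(U'))
    (P : 'Hom(U, U')) x u :
  (forall g u, P (rho g u) = rho' g (P u)) ->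
  P (algact rho x u) = algact rho' x (P u).
Proof.
move=> Pr; rewrite /algact !sum_lfunE linear_sum; apply: eq_bigr => g _.
by rewrite !scale_lfunE linearZ /= Pr.
Qed.

Section Rep.
Variables (U : vectType K) (rho : G -> 'End(U)).
Implicit Types (u : U) (X Y L : {vspace U}).

Lemma algactE x u : algact rho x u = \sum_g (x g : K) *: rho g u.
Proof. by rewrite sum_lfunE; apply: eq_bigr => g _; rewrite scale_lfunE. Qed.

Lemma algact_gdelta g : algact rho (gdelta g) = rho g.
Proof.
rewrite /algact (bigD1 g) //= big1 => [|h /negPf gh]; rewrite !ffunE ?gh ?eqxx.
  by rewrite scale1r addr0.
by rewrite scale0r.
Qed.

Lemma algact_is_linear u : linear (fun x => algact rho x u).
Proof.
move=> k x y; rewrite !algactE scaler_sumr -big_split /=; apply: eq_bigr => g _.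
by rewrite !ffunE scalerA -scalerDl.
Qed.

Definition algact_on u x := algact rho x u.
HB.instance Definition _ u :=
  GRing.isLinear.Build K {ffun G -> K^o} U _ (algact_on u) (algact_is_linear u).

Lemma algactZ k x u : algact rho (k *: x) u = k *: algact rho x u.
Proof. by rewrite -[LHS]/(algact_on u (k *: x)) linearZ. Qed.

Lemma algact0 u : algact rho 0 u = 0.
Proof. by rewrite -[LHS]/(algact_on u 0) linear0. Qed.

Lemma algactD x y u : algact rho (x + y) u = algact rho x u + algact rho y u.
Proof. by rewrite -[LHS]/(algact_on u (x + y)) linearD. Qed.

Lemma algact_sum (I : finType) (F : I -> {ffun G -> K^o}) u :
  algact rho (\sum_i F i) u = \sum_i algact rho (F i) u.
Proof. by rewrite -[LHS]/(algact_on u (\sum_i F i)) linear_sum. Qed.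

Hypothesis rhoP : right_rep rho.

Lemma rho1 u : rho 1%g u = u.
Proof. by case: rhoP => -> _; rewrite lfunE. Qed.

Lemma rhoM g h u : rho (g * h)%g u = rho h (rho g u).
Proof. by case: rhoP => _ ->; rewrite comp_lfunE. Qed.

Lemma algactM x y u : algact rho (x ** y) u = algact rho y (algact rho x u).
Proof.
rewrite !algactE; under eq_bigr do rewrite convE scaler_suml.
rewrite exchange_big /=; apply: eq_bigr => h _.
rewrite linear_sum scaler_sumr (reindex_inj (mulIg h)) /=.
by apply: eq_bigr => g _; rewrite mulgK linearZ scalerA rhoM.
Qed.

Definition is_subrep (X : {vspace U}) := forall g, {in X, forall u, rho g u \in X}.

Lemma algact_inv X x : is_subrep X -> {in X, forall u, algact rho x u \in X}.
Proof.
by move=> Xi u uX; rewrite algactE; apply: memv_suml => g _; apply/memvZ/Xi.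
Qed.

(* The subrepresentation X e K[G] generated by X e. *)
Definition alggen e (X : {vspace U}) : {vspace U} :=
  (\sum_g (rho g @: (algact rho e @: X)))%VS.

Lemma mem_alggen e X u g : u \in X -> rho g (algact rho e u) \in alggen e X.
Proof.
move=> uX; apply: (subvP (sumv_sup g _ (subvv _))) => //.
by do 2!apply: memv_img.
Qed.

Lemma alggen_least e X Y : is_subrep Y -> {in X, forall u, algact rho e u \in Y} ->
  (alggen e X <= Y)%VS.
Proof.
move=> Yi XY; apply/subv_sumP => g _; apply/subvP => _ /memv_imgP[_ /memv_imgP[u uX ->] ->].
exact/Yi/XY.
Qed.

Lemma alggen_inv e X : is_subrep (alggen e X).
Proof.
move=> g u /memv_sumP[v vX ->]; rewrite linear_sum; apply: memv_suml => h _.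
have /memv_imgP[_ /memv_imgP[w wX ->] ->] := vX h isT.
by rewrite /= -rhoM mem_alggen.
Qed.

Lemma alggen_sub e f x y X : is_subrep X -> e = x ** f ** y -> (alggen e X <= alggen f X)%VS.
Proof.
move=> Xi ->; apply: alggen_least => [|u uX]; first exact: alggen_inv.
rewrite !algactM; apply: algact_inv; first exact: alggen_inv.
by rewrite -[algact rho f _]rho1; apply/mem_alggen/algact_inv.
Qed.

Hypothesis cardG : #|G|%:R != 0 :> K.

(** Any linear projection onto L, averaged over G. *)
Lemma maschke L : is_subrep L ->
  exists P : 'End(U), [/\ forall g u, P (rho g u) = rho g (P u),
    forall u, P u \in L & {in L, forall u, P u = u}].
Proof.
move=> Li; exists ((#|G|%:R : K)^-1 *: \sum_g (rho g \o projv L \o rho g^-1%g)%VF).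
have E u : ((#|G|%:R : K)^-1 *: \sum_g (rho g \o projv L \o rho g^-1%g)%VF) u =
    (#|G|%:R : K)^-1 *: \sum_g rho g (projv L (rho g^-1%g u)).
  by rewrite scale_lfunE sum_lfunE; congr (_ *: _); apply: eq_bigr => g _; rewrite !comp_lfunE.
split=> [g u|u|u uL]; rewrite !E.
- rewrite linearZ; congr (_ *: _); rewrite linear_sum (reindex_inj (mulIg g)) /=.
  apply: eq_bigr => h _; rewrite rhoM; congr (rho g (rho h (projv L _))).
  by rewrite -rhoM invMg mulKVg.
- by apply/memvZ/memv_suml => g _; apply/Li/memv_proj.
rewrite (eq_bigr (fun=> u)) ?sumr_const ?cardT -?cardE => [|g _].
  by rewrite -scaler_nat scalerA mulVf ?scale1r.
by rewrite projv_id ?Li // -rhoM mulVg rho1.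
Qed.

(** The equivariant projection P onto L sends (w e) g to ((P w) e) g = 0, so it kills X e K[G],
    which contains L; but P is the identity on L. *)
Lemma alggen_kill e X L : is_subrep L -> (L <= alggen e X)%VS ->
  {in L, forall u, algact rho e u = 0} -> L = 0%VS.
Proof.
move=> Li sL L0; have [P [Pr PL Pid]] := maschke Li.
apply/eqP; rewrite -subv0; apply/subvP => l lL.
rewrite memv0 -(Pid l lL); have /memv_sumP[v vX ->] := subvP sL l lL.
rewrite linear_sum big1 // => g _.
have /memv_imgP[_ /memv_imgP[w wX ->] ->] := vX g isT.
by rewrite /= Pr (algact_hom _ _ Pr) L0 // linear0.
Qed.

End Rep.

Lemma convA x y z : x ** (y ** z) = x ** y ** z.
Proof. exact: (algactM (translate_rep _)). Qed.

Lemma conv_delta_r x g : x ** gdelta g = translate K^o g x.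
Proof. by rewrite /conv algact_gdelta. Qed.

Lemma conv_deltaE_r x g h : (x ** gdelta g) h = x (h * g^-1)%g.
Proof. by rewrite conv_delta_r translateE. Qed.

Lemma conv_deltaE_l x g h : (gdelta g ** x) h = x (g^-1 * h)%g.
Proof.
rewrite convE (bigD1 (g^-1 * h)%g) //= big1 => [|k kn].
  by rewrite ffunE invMg invgK mulKVg eqxx mulr1 addr0.
rewrite ffunE; case: eqP => [E|]; last by rewrite mulr0.
by case/eqP: kn; rewrite -E invMg invgK mulgKV.
Qed.

Lemma gdeltaM g h : gdelta g ** gdelta h = gdelta (g * h)%g.
Proof.
by apply/ffunP=> k; rewrite conv_deltaE_r !ffunE -[in RHS](can_eq (mulgK h^-1)%g) mulgK.
Qed.

Lemma conv1 x : x ** gdelta 1%g = x.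
Proof. by apply/ffunP => g; rewrite conv_deltaE_r invg1 mulg1. Qed.

Lemma convZl k x y : (k *: x) ** y = k *: (x ** y).
Proof. by rewrite /conv linearZ. Qed.

Lemma convZr k x y : x ** (k *: y) = k *: (x ** y).
Proof. by rewrite /conv algactZ. Qed.

Lemma conv0l y : 0 ** y = 0.
Proof. by rewrite /conv linear0. Qed.

Lemma conv_suml (I : finType) (F : I -> {ffun G -> K^o}) y :
  (\sum_i F i) ** y = \sum_i (F i ** y).
Proof. by rewrite /conv linear_sum. Qed.

Lemma conv_sumr (I : finType) (F : I -> {ffun G -> K^o}) y :
  y ** (\sum_i F i) = \sum_i (y ** F i).
Proof. exact: algact_sum. Qed.

Lemma galg_sum x : x = \sum_g (x g : K) *: gdelta g.
Proof.
apply/ffunP=> h; rewrite sum_ffunE (bigD1 h) //= big1 => [|k /negPf kh].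
  by rewrite !ffunE eqxx /= addr0 /GRing.scale /= mulr1.
by rewrite !ffunE eq_sym kh /GRing.scale /= mulr0.
Qed.

Lemma starK x : star (star x) = x.
Proof. by apply/ffunP=> g; rewrite !ffunE invgK. Qed.

Lemma star_conv x y : star (x ** y) = star y ** star x.
Proof.
apply/ffunP=> g; rewrite ffunE !convE (reindex_inj (mulIg g^-1%g)) /=.
by apply: eq_bigr => h _; rewrite !ffunE !invMg !invgK mulKg mulrC.
Qed.

Lemma starZ k x : star (k *: x) = k *: star x.
Proof. by apply/ffunP=> g; rewrite !ffunE. Qed.

Lemma conv_star1 x : (x ** star x) 1%g = \sum_g (x g : K) ^+ 2.
Proof.
rewrite convE [RHS](reindex_inj invg_inj); apply: eq_bigr => g _.
by rewrite ffunE mul1g expr2.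
Qed.

Definition ideal e : {vspace {ffun G -> K^o}} :=
  <<[seq translate K^o g e | g <- enum G]>>%VS.

Lemma mem_ideal e x : e ** x \in ideal e.
Proof.
rewrite /conv algactE; apply: memv_suml => g _; apply/memvZ/memv_span.
by apply: map_f; rewrite mem_enum.
Qed.

Lemma idealP e u : u \in ideal e -> exists x, u = e ** x.
Proof.
move=> /(@coord_span _ _ _ (in_tuple _)) ->.
elim/big_ind: _ => [|_ _ [x ->] [y ->]|i _].
- by exists 0; rewrite /conv algact0.
- by exists (x + y); rewrite /conv algactD.
have /mapP[g _ ->] := mem_nth 0 (ltn_ord i).
by exists (coord (in_tuple _) i u *: gdelta g); rewrite convZr conv_delta_r.
Qed.

Section Isotypic.
Variables (e : {ffun G -> K^o}) (c : K).
Hypotheses (cardG : #|G|%:R != 0 :> K) (c0 : c != 0) (ee : e ** e = c *: e).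
Hypothesis eAe : forall x, exists k, e ** x ** e = k *: e.
Variables (U : vectType K) (rho : G -> 'End(U)).
Hypothesis rhoP : right_rep rho.
Implicit Type X : {vspace U}.

(** A morphism f from e K[G] to X satisfies f(e) = c^-1 f(e) e, so its image lies in X e K[G].
    Conversely, if u e is nonzero, x -> u x is injective on e K[G]: by [alggen_kill] it is enough
    that e kill the kernel, and for e x in the kernel, e x e = k e gives k (u e) = 0, hence k =
    0. *)
Lemma isotypic_alggen X : is_subrep rho X ->
  isotypic (@translate K G K^o) rho (ideal e) X = alggen rho e X.
Proof.
move=> Xi; have eS : e \in ideal e.
  by have := memvZ c^-1 (mem_ideal e e); rewrite ee scalerA mulVf ?scale1r.
have Si : is_subrep (@translate K G K^o) (ideal e).
  by move=> g _ /idealP[x ->]; rewrite -conv_delta_r -convA mem_ideal.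
apply/eqP; rewrite eqEsubv; apply/andP; split.
  apply: vsum_least => W [WX [f [fS _ fr]]].
  have fe : f e = algact rho e (c^-1 *: f e).
    rewrite linearZ /= -[LHS]scale1r -(mulVf c0) -scalerA; congr (_ *: _).
    rewrite -linearZ /= -ee algactE /conv algactE linear_sum; apply: eq_bigr => g _.
    by rewrite linearZ /= fr.
  have feX : f e \in X by rewrite (subvP WX) // -fS memv_img.
  rewrite -fS limg_span; apply/span_subvP => _ /mapP[_ /mapP[g _ ->] ->].
  by rewrite fr // fe mem_alggen // memvZ.
apply/subv_sumP => g _; apply/subvP => _ /memv_imgP[_ /memv_imgP[u uX ->] ->].
have [->|neu] := eqVneq (algact rho e u) 0; first by rewrite linear0 mem0v.
pose f : 'Hom({ffun G -> K^o}, U) := linfun (algact_on rho u).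
have fE x : f x = algact rho x u by rewrite lfunE.
have fg x h : f (translate K^o h x) = rho h (f x).
  by rewrite !fE -conv_delta_r algactM // algact_gdelta.
suff sW : (f @: ideal e <= isotypic (@translate K G K^o) rho (ideal e) X)%VS.
  by apply: (subvP sW); rewrite -fE -fg memv_img // Si.
apply: vsum_sup; split.
  by apply/subvP => _ /memv_imgP[x _ ->]; rewrite fE; apply: algact_inv.
exists f; split=> // [|h x _]; last exact: fg.
(* Writing e = c^-1 e e puts e K[G] in the form X e K[G] that [alggen_kill] asks for. *)
have Lg : (ideal e :&: lker f <= alggen (@translate K G K^o) e fullv)%VS.
  apply: (subv_trans (capvSl _ _)); apply/span_subvP => _ /mapP[h _ ->].
  rewrite -[e in translate _ _ e]scale1r -(mulVf c0) -scalerA -ee -convZl.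
  by apply: mem_alggen; rewrite memvf.
apply: (alggen_kill (translate_rep _) cardG _ Lg).
  move=> h x; rewrite !memv_cap !memv_ker => /andP[xS /eqP fx].
  by rewrite Si //= fg fx linear0.
move=> x; rewrite memv_cap memv_ker => /andP[/idealP[y ->] /eqP f0].
rewrite -/(conv (e ** y) e); have [k Ek] := eAe y; rewrite Ek.
have : f (k *: e) = 0 by rewrite -Ek fE algactM // -fE f0 linear0.
rewrite linearZ /= fE => /eqP; rewrite scaler_eq0 (negPf neu) orbF => /eqP->.
by rewrite scale0r.
Qed.

End Isotypic.

End GroupAlgebra.

Notation "x ** y" := (conv x y) (at level 40, left associativity).

(** * Tableaux and their symmetrizers *)

Section Symmetrizers.
Variables (K : fieldType) (J : finType).
Implicit Types (N : J -> nat) (f : J -> nat -> nat).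

(** The row or the column stabilizer of a tableau, according to whether f gives the rows or the
    columns of the boxes. *)
Definition stab N f : {set symJ N} :=
  [set s : symJ N | [forall j, forall i, f j (s j i) == f j i]].

Definition sgnJ N (s : symJ N) : K := \prod_j (-1) ^+ (s j).

Definition sym N f : {ffun symJ N -> K^o} := [ffun s => (s \in stab N f)%:R].

Definition alt N f : {ffun symJ N -> K^o} :=
  [ffun s => (s \in stab N f)%:R * sgnJ s].

Section Fixed.
Variables (N : J -> nat) (f : J -> nat -> nat).
Implicit Types s t : symJ N.

Lemma stabP s : reflect (forall j i, f j (s j i) = f j i) (s \in stab N f).
Proof.
rewrite inE; apply: (iffP forallP) => [sf j i|sf j].
  by apply/eqP; move/forallP: (sf j).
by apply/forallP => i; rewrite sf.
Qed.

Lemma symJME s t j i : (s * t)%g j i = t j (s j i).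
Proof. by rewrite ffunE permM. Qed.

Lemma symJVE s j : (s^-1)%g j = (s j)^-1%g.
Proof. by rewrite ffunE. Qed.

Lemma symJ1E j : (1%g : symJ N) j = 1%g.
Proof. by rewrite ffunE. Qed.

Lemma stab_group_set : group_set (stab N f).
Proof.
apply/group_setP; split=> [|s t /stabP sf /stabP tf]; apply/stabP => j i.
  by rewrite symJ1E perm1.
by rewrite symJME tf sf.
Qed.
Canonical stab_group := Group stab_group_set.

Lemma sgnJM s t : sgnJ (s * t)%g = sgnJ s * sgnJ t.
Proof.
rewrite /sgnJ -big_split; apply: eq_bigr => j _ /=.
by rewrite ffunE odd_permM signr_addb.
Qed.

Lemma sgnJ1 : sgnJ (1%g : symJ N) = 1.
Proof. by rewrite /sgnJ big1 // => j _; rewrite symJ1E odd_perm1. Qed.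

Lemma sgnJV s : sgnJ s^-1%g = sgnJ s.
Proof. by apply: eq_bigr => j _; rewrite symJVE odd_permV. Qed.

Lemma sgnJ_sqr s : sgnJ s * sgnJ s = 1.
Proof. by rewrite -{2}sgnJV -sgnJM mulgV sgnJ1. Qed.

Lemma star_sym : star (sym N f) = sym N f.
Proof. by apply/ffunP=> s; rewrite !ffunE groupV. Qed.

Lemma star_alt : star (alt N f) = alt N f.
Proof. by apply/ffunP=> s; rewrite !ffunE groupV sgnJV. Qed.

Lemma sym_stab_r s : s \in stab N f -> sym N f ** gdelta K s = sym N f.
Proof.
by move=> sf; apply/ffunP=> t; rewrite conv_deltaE_r !ffunE groupMr ?groupV.
Qed.

Lemma sym_stab_l s : s \in stab N f -> gdelta K s ** sym N f = sym N f.
Proof.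
by move=> sf; apply/ffunP=> t; rewrite conv_deltaE_l !ffunE groupMl ?groupV.
Qed.

Lemma alt_stab_r s : s \in stab N f -> alt N f ** gdelta K s = sgnJ s *: alt N f.
Proof.
move=> sf; apply/ffunP=> t; rewrite conv_deltaE_r !ffunE groupMr ?groupV //.
by rewrite sgnJM sgnJV mulrA mulrC.
Qed.

Lemma alt_stab_l s : s \in stab N f -> gdelta K s ** alt N f = sgnJ s *: alt N f.
Proof.
move=> sf; apply/ffunP=> t; rewrite conv_deltaE_l !ffunE groupMl ?groupV //.
by rewrite sgnJM sgnJV mulrCA.
Qed.

Lemma symE : sym N f = \sum_(s in stab N f) gdelta K s.
Proof.
rewrite [LHS]galg_sum [RHS]big_mkcond; apply: eq_bigr => s _; rewrite ffunE.
by case: ifP; rewrite ?scale1r ?scale0r.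
Qed.

Lemma altE : alt N f = \sum_(s in stab N f) sgnJ s *: gdelta K s.
Proof.
rewrite [LHS]galg_sum [RHS]big_mkcond; apply: eq_bigr => s _; rewrite ffunE.
by case: ifP; rewrite ?mul1r ?mul0r ?scale0r.
Qed.

Lemma sym_sqr : sym N f ** sym N f = #|stab N f|%:R *: sym N f.
Proof.
rewrite {2}symE big_mkcond conv_sumr.
rewrite (eq_bigr (fun s => if s \in stab N f then sym N f else 0)).
  by rewrite -big_mkcond sumr_const scaler_nat.
by move=> s _; case: ifP => [/sym_stab_r //|_]; rewrite /conv algact0.
Qed.

Lemma alt_sqr : alt N f ** alt N f = #|stab N f|%:R *: alt N f.
Proof.
rewrite {2}altE big_mkcond conv_sumr.
rewrite (eq_bigr (fun s => if s \in stab N f then alt N f else 0)).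
  by rewrite -big_mkcond sumr_const scaler_nat.
move=> s _; case: ifP => [sf|_]; last by rewrite /conv algact0.
by rewrite convZr alt_stab_r // scalerA sgnJ_sqr scale1r.
Qed.

End Fixed.

Lemma stab_conj N f f' (s : symJ N) :
  (forall j (i : 'I_(N j)), f' j i = f j (s j i)) ->
  forall t, (t \in stab N f') = ((s^-1 * t * s)%g \in stab N f).
Proof.
move=> ff' t; apply/stabP/stabP => tf j i.
  rewrite !symJME -ff' tf symJVE ff'; congr (f j); congr (nat_of_ord _).
  by rewrite permKV.
by have := tf j (s j i); rewrite !symJME -!ff' symJVE permK.
Qed.

Lemma sym_conj N f f' (s : symJ N) : (forall j (i : 'I_(N j)), f' j i = f j (s j i)) ->
  sym N f = gdelta K s^-1%g ** sym N f' ** gdelta K s.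
Proof.
move=> ff'; apply/ffunP=> t; rewrite conv_deltaE_r conv_deltaE_l !ffunE.
by rewrite (stab_conj ff') invgK !mulgA mulVg mul1g mulgKV.
Qed.

Lemma alt_conj N f f' (s : symJ N) : (forall j (i : 'I_(N j)), f' j i = f j (s j i)) ->
  alt N f = gdelta K s^-1%g ** alt N f' ** gdelta K s.
Proof.
move=> ff'; apply/ffunP=> t; rewrite conv_deltaE_r conv_deltaE_l !ffunE.
rewrite (stab_conj ff') invgK !mulgA mulVg mul1g mulgKV; congr (_ * _).
by rewrite !sgnJM sgnJV mulrAC sgnJ_sqr mul1r.
Qed.

Section Embed.
Variables (N N' : J -> nat) (le : leJ N N').

Lemma embed_perm_widen m n (le_mn : (m <= n)%N) (s : 'S_m) i :
  embed_perm le_mn s (widen_ord le_mn i) = widen_ord le_mn (s i).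
Proof.
rewrite permE /embed_perm_fun insubT /=; first exact: ltn_ord.
by move=> lt; congr widen_ord; congr (_ _); apply: val_inj.
Qed.

Lemma embed_perm_new m n (le_mn : (m <= n)%N) (s : 'S_m) (i : 'I_n) :
  (m <= i)%N -> embed_perm le_mn s i = i.
Proof. by move=> mi; rewrite permE /embed_perm_fun insubN // -leqNgt. Qed.

Lemma ord_widenP m n (le_mn : (m <= n)%N) (i : 'I_n) :
  (exists i', i = widen_ord le_mn i') \/ (m <= i)%N.
Proof.
case: (ltnP i m) => [im|]; [left|by right].
by exists (Ordinal im); apply: val_inj.
Qed.

Lemma embed_permM m n (le_mn : (m <= n)%N) (s t : 'S_m) :
  embed_perm le_mn (s * t) = (embed_perm le_mn s * embed_perm le_mn t)%g.
Proof.
apply/permP=> i; rewrite permM; have [[i' ->]|mi] := ord_widenP le_mn i.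
  by rewrite !embed_perm_widen permM.
by rewrite !embed_perm_new.
Qed.

Lemma embed_perm1 m n (le_mn : (m <= n)%N) : embed_perm le_mn 1 = 1%g.
Proof.
apply/permP=> i; rewrite perm1; have [[i' ->]|mi] := ord_widenP le_mn i.
  by rewrite embed_perm_widen perm1.
by rewrite embed_perm_new.
Qed.

Lemma embed_perm_tperm m n (le_mn : (m <= n)%N) (x y : 'I_m) :
  embed_perm le_mn (tperm x y) = tperm (widen_ord le_mn x) (widen_ord le_mn y).
Proof.
apply/permP=> i; have [[i' ->]|mi] := ord_widenP le_mn i.
  rewrite embed_perm_widen; case: tpermP => [->|->|/eqP nx /eqP ny].
  - by rewrite tpermL.
  - by rewrite tpermR.
  by rewrite tpermD // (inj_eq (@widen_ord_inj _ _ le_mn)) eq_sym.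
have lt (z : 'I_m) : widen_ord le_mn z != i.
  by apply: contraTneq mi => <-; rewrite -ltnNge /=.
by rewrite embed_perm_new // tpermD.
Qed.

Lemma odd_embed_perm m n (le_mn : (m <= n)%N) (s : 'S_m) :
  odd_perm (embed_perm le_mn s) = odd_perm s.
Proof.
have [ts -> _] := prod_tpermP s; elim: ts => [|t ts IH].
  by rewrite !big_nil embed_perm1 !odd_perm1.
rewrite !big_cons embed_permM !odd_permM IH embed_perm_tperm !odd_tperm.
by rewrite (inj_eq (@widen_ord_inj _ _ le_mn)).
Qed.

Lemma embed_symM (s t : symJ N) :
  embed_sym le (s * t)%g = (embed_sym le s * embed_sym le t)%g.
Proof. by apply/ffunP=> j; rewrite !ffunE embed_permM. Qed.

Lemma embed_sym1 : embed_sym le 1%g = 1%g.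
Proof. by apply/ffunP=> j; rewrite !ffunE embed_perm1. Qed.

Lemma embed_symV (s : symJ N) : embed_sym le s^-1%g = (embed_sym le s)^-1%g.
Proof. by apply: (mulgI (embed_sym le s)); rewrite -embed_symM !mulgV embed_sym1. Qed.

Lemma embed_symE (s : symJ N) j i :
  embed_sym le s j (widen_ord (le j) i) = widen_ord (le j) (s j i).
Proof. by rewrite ffunE embed_perm_widen. Qed.

Lemma embed_sym_new (s : symJ N) j (i : 'I_(N' j)) :
  (N j <= i)%N -> embed_sym le s j i = i.
Proof. by move=> Ni; rewrite ffunE embed_perm_new. Qed.

Lemma embed_sym_inj : injective (@embed_sym J N N' le).
Proof.
move=> s t /ffunP st; apply/ffunP=> j; apply/permP=> i.
by apply: (@widen_ord_inj _ _ (le j)); rewrite -!embed_symE st.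
Qed.

Lemma sgnJ_embed s : sgnJ (embed_sym le s) = sgnJ s.
Proof. by apply: eq_bigr => j _; rewrite ffunE odd_embed_perm. Qed.

Lemma stab_embed f s : (embed_sym le s \in stab N' f) = (s \in stab N f).
Proof.
apply/stabP/stabP => sf j i.
  by have := sf j (widen_ord (le j) i); rewrite embed_symE.
have [[i' ->]|Ni] := ord_widenP (le j) i; first by rewrite embed_symE /= sf.
by rewrite embed_sym_new.
Qed.

(** The morphism of group algebras that extends [embed_sym]. *)
Definition emb (x : {ffun symJ N -> K^o}) : {ffun symJ N' -> K^o} :=
  \sum_s (x s : K) *: gdelta K (embed_sym le s).

Lemma embM x y : emb (x ** y) = emb x ** emb y.
Proof.
rewrite /emb conv_sumr; under eq_bigr do rewrite convE scaler_suml.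
rewrite exchange_big; apply: eq_bigr => t _ /=; rewrite convZr conv_suml scaler_sumr.
rewrite (reindex_inj (mulIg t)) /=; apply: eq_bigr => s _.
by rewrite mulgK convZl gdeltaM scalerA embed_symM.
Qed.

Lemma emb_sym_abs f : emb (sym N f) ** sym N' f = #|stab N f|%:R *: sym N' f.
Proof.
rewrite /emb conv_suml.
rewrite (eq_bigr (fun s => if s \in stab N f then sym N' f else 0)).
  by rewrite -big_mkcond sumr_const scaler_nat.
move=> s _; rewrite convZl ffunE; case: ifP => sf; last by rewrite scale0r.
by rewrite scale1r sym_stab_l // stab_embed.
Qed.

(** A box outside N is alone in its class, so t fixes it; hence t preserves the boxes of N and comes
    from its restriction to them. *)
Lemma stab_embedE f :
  (forall j (x y : 'I_(N' j)), (N j <= x)%N -> f j x = f j y -> x = y) ->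
  stab N' f = @embed_sym J N N' le @: stab N f.
Proof.
move=> fnew; apply/eqP; rewrite eq_sym eqEsubset; apply/andP; split.
  by apply/subsetP=> _ /imsetP[s sf ->]; rewrite stab_embed.
apply/subsetP=> t tf; have /stabP tfE := tf.
have tfix j (x : 'I_(N' j)) : (N j <= x)%N -> t j x = x.
  by move=> Nx; apply/esym/fnew => //; rewrite tfE.
have told j (x : 'I_(N j)) : (t j (widen_ord (le j) x) < N j)%N.
  rewrite ltnNge; apply/negP => Nt; have /perm_inj E := tfix _ _ Nt.
  by move: Nt; rewrite E leqNgt /= ltn_ord.
pose s0 j (x : 'I_(N j)) : 'I_(N j) := Ordinal (told j x).
have s0i j : injective (s0 j).
  by move=> x y /(congr1 val)/= /val_inj/perm_inj/widen_ord_inj.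
pose s : symJ N := [ffun j => perm (s0i j)].
suff ts : t = embed_sym le s by rewrite ts imset_f // -stab_embed -ts.
apply/ffunP=> j; apply/permP=> x; have [[x' ->]|Nx] := ord_widenP (le j) x.
  by apply: val_inj; rewrite embed_symE /= ffunE permE.
by rewrite embed_sym_new // tfix.
Qed.

Lemma emb_alt f :
  (forall j (x y : 'I_(N' j)), (N j <= x)%N -> f j x = f j y -> x = y) ->
  emb (alt N f) = alt N' f.
Proof.
move=> fnew; rewrite [RHS]altE stab_embedE // big_imset /=; last first.
  by move=> s t _ _ /embed_sym_inj.
rewrite /emb [RHS]big_mkcond; apply: eq_bigr => s _; rewrite ffunE sgnJ_embed.
by case: ifP; rewrite ?mul1r ?mul0r ?scale0r.
Qed.

End Embed.
End Symmetrizers.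

(** * Von Neumann's lemma *)

Lemma leq_card_inj (T : finType) (A : {set T}) (f : T -> nat) m :
  {in A &, injective f} -> (forall x, x \in A -> (f x < m)%N) -> (#|A| <= m)%N.
Proof.
move=> fi fm; rewrite cardE -(size_map f) -(size_iota 0 m); apply: uniq_leq_size.
  by rewrite map_inj_in_uniq ?enum_uniq // => x y; rewrite !mem_enum; apply: fi.
by move=> _ /mapP[x + ->]; rewrite mem_enum mem_iota => /fm.
Qed.

(* The row that an entry gets when its column is sorted by r is at most its r; *)
(* comparing the sums of both forces equality everywhere.                      *)
Lemma column_sort n (row col r : 'I_n -> nat) :
  (forall x i, (i < row x)%N -> exists2 y, col y = col x & row y = i) ->
  (forall x y, col x = col y -> row x = row y -> x = y) ->
  (forall x y, col x = col y -> r x = r y -> x = y) ->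
  (\sum_x r x <= \sum_x row x)%N ->
  exists q : 'S_n, forall x, col (q x) = col x /\ row (q x) = r x.
Proof.
move=> closed inj rinj le_sum.
pose below x := [set y | (col y == col x) && (r y < r x)%N].
pose column x := [set y | col y == col x].
(* The rank of x in its column for the order given by r, that is, its row once the column is
   sorted. *)
pose k x := #|below x|.
have below_col x : (k x < #|column x|)%N.
  apply: proper_card; apply/properP; split.
    by apply/subsetP=> y; rewrite !inE => /andP[].
  by exists x; rewrite !inE ?eqxx ?ltnn.
have kr x : (k x <= r x)%N.
  apply: (@leq_card_inj _ _ r) => [y z|y]; rewrite !inE; last by case/andP.
  by move=> /andP[/eqP cy _] /andP[/eqP cz _]; apply: rinj; rewrite cy cz.
have kinj x y : col x = col y -> k x = k y -> x = y.
  move=> cxy; have lt a b : col a = col b -> (r a < r b)%N -> (k a < k b)%N.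
    move=> cab rab; apply: proper_card; apply/properP; split.
      apply/subsetP=> z; rewrite !inE cab => /andP[-> /=] /ltn_trans; exact.
    by exists a; rewrite !inE ?cab ?eqxx ?ltnn ?andbF.
  move=> kxy; apply: rinj => //; case: (ltngtP (r x) (r y)) => // /lt.
    by move/(_ cxy); rewrite kxy ltnn.
  by move/(_ (esym cxy)); rewrite kxy ltnn.
(* The rows of the boxes of a column are distinct and form an initial segment, so a column of more
   than i boxes meets row i. *)
have exrow x i : (i < #|column x|)%N -> exists2 y, col y = col x & row y = i.
  move=> ih; have [/existsP[z /andP[/eqP cz]]|no] :=
      boolP [exists z, (col z == col x) && (i <= row z)%N].
    rewrite leq_eqVlt => /predU1P[->|iz]; first by exists z.
    by have [y cy ry] := closed z i iz; exists y; rewrite ?cy.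
  suff : (#|column x| <= i)%N by rewrite leqNgt ih.
  apply: (@leq_card_inj _ _ row) => [y z|y]; rewrite !inE.
    by move=> /eqP cy /eqP cz; apply: inj; rewrite cy cz.
  move=> cy; rewrite ltnNge; apply: contra no => iy.
  by apply/existsP; exists y; rewrite cy.
pose q x := odflt x [pick y | (col y == col x) && (row y == k x)].
have qP x : col (q x) = col x /\ row (q x) = k x.
  rewrite /q; case: pickP => [y /andP[/eqP -> /eqP ->]//|no].
  have [y cy ry] := exrow x (k x) (below_col x).
  by have := no y; rewrite cy ry !eqxx.
have qi : injective q.
  move=> x y qxy; have [cx rx] := qP x; have [cy ry] := qP y.
  by apply: kinj; rewrite -?cx -?cy -?rx -?ry qxy.
have sumk : (\sum_x k x = \sum_x row x)%N.
  rewrite [RHS](reindex_inj (@perm_inj _ (perm qi))) /=.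
  by apply: eq_bigr => x _; rewrite permE; have [] := qP x.
have krE x : k x = r x.
  apply/eqP; have /leqif_sum : forall i, true -> (k i <= r i ?= iff (k i == r i))%N.
    by move=> i _; apply/leqif_eq/kr.
  move=> [_]; rewrite sumk.
  have -> : (\sum_i row i == \sum_i r i)%N.
    by rewrite eqn_leq le_sum -sumk leq_sum.
  by move=> /esym/forallP/(_ x).
by exists (perm qi) => x; rewrite permE -krE.
Qed.

Section Swap.
Variables (K : fieldType) (J : finType) (N : J -> nat).

Definition swapJ j (x y : 'I_(N j)) : symJ N :=
  [ffun k => dfwith (fun k => 1%g : 'S_(N k)) (tperm x y) k].

Lemma swapJ_in j (x y : 'I_(N j)) : swapJ x y j = tperm x y.
Proof. by rewrite ffunE dfwith_in. Qed.

Lemma swapJ_out j (x y : 'I_(N j)) k : k != j -> swapJ x y k = 1%g.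
Proof. by move=> kj; rewrite ffunE dfwith_out // eq_sym. Qed.

Lemma sgn_swapJ j (x y : 'I_(N j)) : x != y -> sgnJ K (swapJ x y) = -1.
Proof.
move=> xy; rewrite /sgnJ (bigD1 j) //= big1 ?mulr1 => [|k kj].
  by rewrite swapJ_in odd_tperm xy.
by rewrite swapJ_out // odd_perm1.
Qed.

Lemma swapJ_conj j (x y : 'I_(N j)) (g : symJ N) :
  (swapJ x y * g = g * swapJ (g j x) (g j y))%g.
Proof.
apply/ffunP=> k; rewrite !ffunE; have [->|kj] := eqVneq k j.
  by rewrite !dfwith_in -tpermJ conjgC.
by rewrite !dfwith_out ?mul1g ?mulg1 // eq_sym.
Qed.

Lemma swapJ_stab (f : J -> nat -> nat) j (x y : 'I_(N j)) : f j x = f j y -> swapJ x y \in stab N f.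
Proof.
move=> fxy; apply/stabP => k i; have [kj|kj] := eqVneq k j; last first.
  by rewrite swapJ_out // perm1.
by subst k; rewrite swapJ_in; case: tpermP => [->|->|].
Qed.

End Swap.

(* For each j the boxes are the numbers below N j; row and col place them. *)
Definition tableau (J : finType) (N : J -> nat) (row col : J -> nat -> nat) : Prop :=
  (forall j (x : 'I_(N j)) i, (i < row j x)%N ->
     exists2 y : 'I_(N j), col j y = col j x & row j y = i) /\
  (forall j (x y : 'I_(N j)), col j x = col j y -> row j x = row j y -> x = y).

(* Condition for the boxes added from N to N' to sit at the end of the first *)
(* row, beyond all the other columns.                                        *)
Definition first_row_ext (J : finType) (N N' : J -> nat) (row col : J -> nat -> nat) :
    Prop :=
  forall j (x : 'I_(N' j)), (N j <= x)%N ->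
    row j x = 0%N /\ forall y : 'I_(N' j), col j x = col j y -> x = y.

Lemma sum_widen m n (le : (m <= n)%N) (F : 'I_n -> nat) :
  (\sum_x F x = \sum_(x : 'I_m) F (widen_ord le x) + \sum_(x : 'I_n | (m <= x)%N) F x)%N.
Proof.
rewrite (bigID (fun x : 'I_n => (x < m)%N)) /=; congr (_ + _)%N; last first.
  by apply: eq_bigl => x; rewrite -leqNgt.
case: (posnP m) => [m0|mpos].
  rewrite !big_pred0 // => x; last by rewrite m0.
  by have := ltn_ord x; rewrite [X in (_ < X)%N]m0.
(* The default of [insubd] must be an element of 'I_m, hence the separate case m = 0; it is never
   taken, since x < m in this sum. *)
rewrite (reindex_onto (widen_ord le) (fun x => insubd (Ordinal mpos) (nat_of_ord x))) /=.
  apply: eq_bigl => x; rewrite ltn_ord /=; apply/eqP/val_inj.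
  by rewrite val_insubd /= ltn_ord.
by move=> x xN; apply: val_inj; rewrite /= val_insubd xN.
Qed.

Section VonNeumann.
Variables (K : fieldType) (J : finType) (row col : J -> nat -> nat).
Hypothesis char0 : [pchar K] =i pred0.

Lemma natr_neq0 n : (n%:R != 0 :> K) = (n != 0%N).
Proof. by rewrite (pcharf0P _).1. Qed.

Lemma eq_opp0 (U : vectType K) (u : U) : u = - u -> u = 0.
Proof.
move/eqP; rewrite -subr_eq0 opprK -mulr2n -scaler_nat scaler_eq0.
by rewrite (negPf (_ : 2%:R != 0)) ?natr_neq0 //= => /eqP.
Qed.

(** If g sends two boxes of one column to one row, then swapping them first changes the sign through
    the column group and nothing through the row group, so the product is 0. Otherwise [column_sort]
    yields q' in the column group such that g and q' send each box to the same row; then q'^-1 g is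
    in the row group and the product is sgn(q') times that for g = 1. *)
Lemma alt_sym_delta N N' (le : leJ N N') (g : symJ N') :
  tableau N row col -> first_row_ext N N' row col ->
  exists k, alt K N' col ** gdelta K g ** sym K N' row =
            k *: (alt K N' col ** sym K N' row).
Proof.
move=> [closed inj] new; pose w j (x : 'I_(N j)) := widen_ord (le j) x.
have [/existsP[j /existsP[x /existsP[y /and3P[xy /eqP cxy /eqP rxy]]]]|noclash] :=
    boolP [exists j, exists x : 'I_(N j), exists y : 'I_(N j),
      [&& x != y, col j x == col j y & row j (g j (w j x)) == row j (g j (w j y))]].
  exists 0; rewrite scale0r; set E := LHS.
  have xy' : w j x != w j y by rewrite (inj_eq (@widen_ord_inj _ _ (le j))).
  have E1 : alt K N' col ** gdelta K (swapJ (w j x) (w j y)) ** gdelta K g ** sym K N' row =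
      -1 *: E.
    by rewrite alt_stab_r ?swapJ_stab // sgn_swapJ // !convZl.
  apply: eq_opp0.
  rewrite -scaleN1r -E1 -(convA _ (gdelta K (swapJ _ _))) gdeltaM swapJ_conj -gdeltaM.
  by rewrite convA -(convA _ _ (sym _ _ _)) sym_stab_l // swapJ_stab.
pose r j (x : 'I_(N j)) := row j (g j (w j x)).
(* The new boxes are in row 0, so they add nothing to the sum of all row numbers, which g
   preserves. *)
have sumr j : (\sum_(x : 'I_(N j)) r j x + \sum_(x : 'I_(N' j) | (N j <= x)%N) row j (g j x) =
               \sum_(x : 'I_(N j)) row j x)%N.
  rewrite -(sum_widen (le j) (fun x => row j (g j x))).
  have -> : (\sum_x row j (g j x) = \sum_(x : 'I_(N' j)) row j x)%N.
    by rewrite [RHS](reindex_inj (@perm_inj _ (g j))).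
  rewrite (sum_widen (le j)) [X in (_ + X)%N]big1 ?addn0 // => x Nx.
  by have [] := new j x Nx.
have qj j : exists q : 'S_(N j), forall x, col j (q x) = col j x /\ row j (q x) = r j x.
  apply: (@column_sort _ (fun x => row j x) (fun x => col j x) (r j)) => [x i|x y|x y cxy rxy|].
  - exact: closed.
  - exact: inj.
  - apply/eqP; move: noclash; apply: contraNT => xy.
    apply/existsP; exists j; apply/existsP; exists x; apply/existsP; exists y.
    by rewrite xy cxy /= /r in rxy *; rewrite rxy !eqxx.
  by rewrite -sumr leq_addr.
have [q qP] : exists q : symJ N, forall j x, col j (q j x) = col j x /\ row j (q j x) = r j x.
  pose Q j := [pred q : 'S_(N j) | [forall x, (col j (q x) == col j x) && (row j (q x) == r j x)]].
  exists [ffun j => odflt 1%g [pick q in Q j]] => j x; rewrite ffunE.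
  case: pickP => [q /forallP/(_ x)/andP[/eqP-> /eqP->]//|no].
  have [q qP] := qj j; case/negP: (no q); apply/forallP => y.
  by have [-> ->] := qP y; rewrite !eqxx.
(* The boxes of N already account for the whole sum of rows, so g sends the new boxes to row 0. *)
have rnew j (x : 'I_(N' j)) : (N j <= x)%N -> row j (g j x) = 0%N.
  move=> Nx; have E : (\sum_x r j x = \sum_(x : 'I_(N j)) row j x)%N.
    rewrite [RHS](reindex_inj (@perm_inj _ (q j))).
    by apply: eq_bigr => y _; have [_ ->] := qP j y.
  have /eqP := sumr j; rewrite E -[X in _ == X]addn0 eqn_add2l sum_nat_eq0.
  by move=> /forallP/(_ x); rewrite Nx => /eqP.
pose q' := embed_sym le q.
have q'C : q' \in stab N' col.
  by rewrite stab_embed; apply/stabP => j x; have [] := qP j x.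
exists (sgnJ K q').
have -> : g = (q' * (q'^-1 * g))%g by rewrite mulKVg.
rewrite -gdeltaM convA -convA alt_stab_r // sym_stab_l ?convZl //.
apply/stabP => j x; rewrite symJME symJVE.
set y := (q' j)^-1%g x; have -> : x = q' j y by rewrite permKV.
have [[y' ->]|Ny] := ord_widenP (le j) y.
  by rewrite embed_symE /=; have [_ ->] := qP j y'.
by rewrite rnew // embed_sym_new //; have [] := new j y Ny.
Qed.

Lemma alt_sym_conv N N' (le : leJ N N') x :
  tableau N row col -> first_row_ext N N' row col ->
  exists k, alt K N' col ** x ** sym K N' row = k *: (alt K N' col ** sym K N' row).
Proof.
move=> T new.
pose P y := exists k, alt K N' col ** y ** sym K N' row = k *: (alt K N' col ** sym K N' row).
rewrite (galg_sum x) -/(P _); elim/big_ind: _ => [|y z [k yk] [l zl]|g _].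
- by exists 0; rewrite /conv algact0 linear0 scale0r.
- by exists (k + l); rewrite scalerDl -yk -zl /conv algactD linearD.
have [k gk] := alt_sym_delta le g T new.
by exists (x g * k); rewrite convZr convZl gk scalerA.
Qed.

End VonNeumann.

(** * Quasi-idempotence of the symmetrizers *)

Section QuasiIdempotent.
Variables (K : fieldType) (J : finType) (N : J -> nat) (row col : J -> nat -> nat).
Hypothesis char0 : [pchar K] =i pred0.
Hypothesis T : tableau N row col.
Let a := sym K N row.
Let b := alt K N col.

Let lle : leJ N N := fun j => leqnn (N j).

Lemma ext_refl : first_row_ext N N row col.
Proof. by move=> j x; rewrite leqNgt ltn_ord. Qed.

Lemma alt_conv_sym x : exists k, b ** x ** a = k *: (b ** a).
Proof. exact: (alt_sym_conv char0 lle x T ext_refl). Qed.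

Lemma stab_row_col g : g \in stab N row -> g \in stab N col -> g = 1%g.
Proof.
move=> /stabP gr /stabP gc; apply/ffunP=> j; apply/permP=> x; rewrite symJ1E perm1.
by case: T => _; apply.
Qed.

(** Only the product of the two identities contributes, as a permutation preserving rows and columns
    is trivial. *)
Lemma ba1 : (b ** a) 1%g = 1.
Proof.
rewrite convE (bigD1 1%g) //= big1 ?addr0 => [|g g1]; rewrite !ffunE ?mul1g.
  by rewrite invg1 !group1 sgnJ1 !mulr1.
rewrite groupV; case: (boolP (g \in stab N row)) => [gr|_]; last by rewrite mul0r.
case: (boolP (g \in stab N col)) => [gc|_]; last by rewrite mul0r mulr0.
by case/eqP: g1; apply: stab_row_col.
Qed.

Definition integral (x : {ffun symJ N -> K^o}) := forall g, exists z : int, x g = z%:~R :> K.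

Lemma int_neq0 (z : int) : z != 0 -> z%:~R != 0 :> K.
Proof.
by case: z => n n0; rewrite ?NegzE ?mulrNz ?oppr_eq0 -pmulrn (natr_neq0 char0).
Qed.

Lemma integral_conv x y : integral x -> integral y -> integral (x ** y).
Proof.
move=> xi yi g; rewrite convE; elim/big_ind: _ => [|_ _ [z1 ->] [z2 ->]|h _].
- by exists 0.
- by exists (z1 + z2); rewrite rmorphD.
have [z1 ->] := yi h; have [z2 ->] := xi (g * h^-1)%g.
by exists (z1 * z2); rewrite rmorphM.
Qed.

Lemma integral_star x : integral x -> integral (star x).
Proof. by move=> xi g; rewrite ffunE. Qed.

Lemma integral_sym : integral a.
Proof. by move=> g; rewrite ffunE; exists (g \in stab N row)%:R; rewrite rmorph_nat. Qed.

Lemma integral_alt : integral b.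
Proof.
move=> g; rewrite ffunE; exists ((g \in stab N col)%:R * \prod_j (-1) ^+ (g j)).
rewrite rmorphM rmorph_nat rmorph_prod; congr (_ * _).
by apply: eq_bigr => j _; rewrite rmorph_sign.
Qed.

(** The coefficient at 1 is a sum of squares of integers, and the integers embed in K. *)
Lemma integral_star_eq0 x : integral x -> x ** star x = 0 -> x = 0.
Proof.
move=> xi xx; have [z zE] := fin_all_exists xi.
have /eqP : (\sum_g z g ^+ 2)%:~R = 0 :> K.
  have := conv_star1 x; rewrite xx ffunE => ->; rewrite rmorph_sum.
  by apply: eq_bigr => g _; rewrite zE rmorphXn.
move=> z0; have {z0} : \sum_g z g ^+ 2 == 0.
  by apply: contraLR z0; exact: int_neq0.
rewrite psumr_eq0 => [/allP z0|g _]; last exact: sqr_ge0.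
apply/ffunP=> g; rewrite ffunE zE; have := z0 g (mem_index_enum _).
by rewrite sqrf_eq0 => /eqP->.
Qed.

Lemma card_stab_neq0 (f : J -> nat -> nat) : #|stab N f|%:R != 0 :> K.
Proof. by rewrite natr_neq0 // -lt0n; apply/card_gt0P; exists 1%g; apply: group1. Qed.

(** [alt_conv_sym] gives the scalar c. If c = 0, let y = (b a) star (b a), which is a multiple of b
    a b and equal to star y. Then y y is a multiple of b a b a b = 0, so positivity gives first y =
    0 and then b a = 0, against [ba1]. *)
Lemma ba_sqr : exists2 c : K, c != 0 & (b ** a) ** (b ** a) = c *: (b ** a).
Proof.
have [c E] := alt_conv_sym (a ** b).
have {}E : (b ** a) ** (b ** a) = c *: (b ** a) by rewrite -E !convA.
exists c => //; apply/negP => /eqP c0.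
pose y := (b ** a) ** star (b ** a).
have ystar : star y = y by rewrite star_conv starK.
have yE : y = #|stab N row|%:R *: (b ** a ** b).
  rewrite /y star_conv star_sym star_alt convA -(convA b) sym_sqr convZr.
  by rewrite convZl.
have iba : integral (b ** a) by apply: integral_conv; [apply: integral_alt|apply: integral_sym].
have : y ** star y = 0.
  rewrite ystar yE convZl convZr scalerA -!convA (convA b b) alt_sqr.
  rewrite !(convZl, convZr) !convA; move: E; rewrite convA => ->.
  by rewrite c0 scale0r conv0l !scaler0.
move/integral_star_eq0 => y0.
have /integral_star_eq0 : (b ** a) ** star (b ** a) = 0.
  by apply: y0; apply: integral_conv => //; apply: integral_star.
move=> /(_ iba)/ffunP/(_ 1%g).
by rewrite ba1 ffunE => /eqP; rewrite oner_eq0.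
Qed.

End QuasiIdempotent.

(** * Specht modules *)

(** The index types X j vary with j, while [bigA_distr_big_dep] wants a single one; families are
    therefore read as functions into the tagged union. *)
Lemma prod_sum_dffun (R : comNzRingType) (J : finType) (X : J -> finType)
    (F : forall j, X j -> R) :
  \prod_j \sum_x F j x = \sum_(g : {dffun forall j, X j}) \prod_j F j (g j).
Proof.
pose F' j : {ffun X j -> R} := [ffun x => F j x].
rewrite (reindex (@dffun_of_fprod _ X)); last exact/onW_bij/dffun_of_fprod_bij.
under [RHS]eq_bigr => t _ do under eq_bigr => j _ do
  rewrite ffunE -[F j (t j)](ffunE (F j)) -/(F' j).
have -> : \sum_(t : fprod X) \prod_j F' j (t j) =
    \sum_(g in family (tagged_with X)) \prod_j untag 0 (F' j) (g j).
  exact: (@big_fprod R 0 1 *%R +%R J X F').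
under eq_bigr => j _.
  under eq_bigr => x _ do rewrite -[F j x](ffunE (F j)) -/(F' j).
  rewrite (big_tag (fun j x => F' j x)).
  over.
exact: (bigA_distr_big_dep (fun j => [in tagged_with X j]) (fun j u => untag 0 (F' j) u)).
Qed.

Lemma prod_nat_forall (R : comNzRingType) (J : finType) (P : pred J) :
  \prod_j (P j)%:R = [forall j, P j]%:R :> R.
Proof.
case: forallP => [Pj|nP]; first by rewrite big1 // => j _; rewrite Pj.
have [j nj] : exists j, ~~ P j.
  by apply/existsP; rewrite -negb_forall; apply/negP => /forallP.
by rewrite (bigD1 j) //= (negPf nj) mul0r.
Qed.

Section PureTensor.
Variables (K : fieldType) (J : finType) (N : J -> nat).
Implicit Types x y : forall j, {ffun 'S_(N j) -> K^o}.

Lemma pure_tensor_conv x y :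
  pure_tensor (fun j => x j ** y j) = pure_tensor x ** pure_tensor y
    :> {ffun symJ N -> K^o}.
Proof.
apply/ffunP=> g; rewrite ffunE convE.
under eq_bigr do rewrite convE.
rewrite prod_sum_dffun; apply: eq_bigr => h _; rewrite !ffunE -big_split.
by apply: eq_bigr => j _ /=; rewrite !ffunE.
Qed.

Lemma pure_tensor_delta (g : symJ N) :
  pure_tensor (fun j => gdelta K (g j)) = gdelta K g :> {ffun symJ N -> K^o}.
Proof.
apply/ffunP=> h; rewrite !ffunE; have [->|hg] := eqVneq h g.
  by rewrite big1 // => j _; rewrite ffunE eqxx.
have [j hj] : exists j, h j != g j.
  apply/existsP; rewrite -negb_forall; apply: contra hg => /forallP hg.
  by apply/eqP/ffunP => j; apply/eqP.
by rewrite (bigD1 j) //= ffunE (negPf hj) mul0r.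
Qed.

(** The tensor product of the e_j x_j is that of the e_j times that of the x_j, and every element of
    the product group is itself a pure tensor. *)
Lemma tensor_ideal (e : forall j, {ffun 'S_(N j) -> K^o}) :
  tensor (fun j => ideal (e j)) = ideal (pure_tensor e) :> {vspace {ffun symJ N -> K^o}}.
Proof.
apply/eqP; rewrite eqEsubv; apply/andP; split.
  apply: vsum_least => _ [w wX ->]; rewrite -memvE.
  have [y wy] : exists y : forall j, {ffun 'S_(N j) -> K^o}, forall j, w j = e j ** y j.
    have ex j : exists z, w j == e j ** z by have [z ->] := idealP (wX j); exists z.
    by exists (fun j => xchoose (ex j)) => j; apply/eqP/(xchooseP (ex j)).
  have -> : pure_tensor w = pure_tensor e ** pure_tensor y.
    rewrite -pure_tensor_conv; apply/ffunP=> g; rewrite !ffunE.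
    by apply: eq_bigr => j _; rewrite wy.
  exact: mem_ideal.
apply/span_subvP => _ /mapP[g _ ->].
rewrite -conv_delta_r -pure_tensor_delta -pure_tensor_conv memvE.
apply: vsum_sup; exists (fun j => e j ** gdelta K (g j)) => // j.
exact: mem_ideal.
Qed.

Definition std_row (mu : J -> seq nat) j := reshape_index (mu j).
Definition std_col (mu : J -> seq nat) j := reshape_offset (mu j).

Lemma young_pure_tensor (mu : J -> seq nat) :
  pure_tensor (fun j => young_symmetrizer K (N j) (mu j)) =
  sym K N (std_row mu) ** alt K N (std_col mu).
Proof.
pose x j : {ffun 'S_(N j) -> K^o} := [ffun s => (s \in row_stab (N j) (mu j))%:R].
pose y j : {ffun 'S_(N j) -> K^o} :=
  [ffun s : 'S_(N j) => (s \in col_stab (N j) (mu j))%:R * (-1) ^+ s].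
have -> : sym K N (std_row mu) = pure_tensor x.
  apply/ffunP=> s; rewrite !ffunE; under eq_bigr do rewrite ffunE.
  by rewrite prod_nat_forall inE; under [in RHS]eq_forallb do rewrite inE.
have -> : alt K N (std_col mu) = pure_tensor y.
  apply/ffunP=> s; rewrite !ffunE; under [RHS]eq_bigr do rewrite ffunE.
  rewrite big_split /= prod_nat_forall inE.
  by under [in RHS]eq_forallb do rewrite inE.
rewrite -pure_tensor_conv; apply/ffunP=> s; rewrite !ffunE; apply: eq_bigr => j _.
rewrite ffunE convE (exchange_big_dep [in col_stab (N j) (mu j)]) /=; last first.
  by move=> p q _ /andP[].
rewrite big_mkcond /=; apply: eq_bigr => q _; rewrite !ffunE.
case: (boolP (q \in col_stab _ _)) => [qC|_]; last by rewrite !mul0r.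
rewrite mul1r; case: (boolP (_ \in row_stab _ _)) => [sR|nsR].
  rewrite (big_pred1 (s j * q^-1)%g) ?mulr1 // => p /=.
  rewrite -(can_eq (mulgK q) p) mulgKV.
  by case: eqP => [E|]; rewrite ?andbF // andbT -[p](mulgK q) E sR.
rewrite mulr0 big_pred0 // => p; apply/negP => /andP[pR /eqP E].
by case/negP: nsR; rewrite -E mulgK.
Qed.

Lemma irrepE (mu : J -> seq nat) :
  irrep K N mu = ideal (sym K N (std_row mu) ** alt K N (std_col mu)).
Proof. by rewrite -young_pure_tensor -tensor_ideal. Qed.

End PureTensor.

(** * The tableau of la[N] and its isotypic component *)

Section PaddedTableau.
Variables (J : finType) (la : J -> seq nat).

(* The boxes below the first row come first, so that the tableau of la[N'] *)
(* extends the one of la[N].                                               *)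
Definition pad_row j x :=
  if (x < sumn (la j))%N then (reshape_index (la j) x).+1 else 0%N.
Definition pad_col j x :=
  if (x < sumn (la j))%N then reshape_offset (la j) x else (x - sumn (la j))%N.

Hypothesis laP : forall j, is_partition (la j).

Lemma part_nth j r s : (r <= s)%N -> (nth 0 (la j) s <= nth 0 (la j) r)%N.
Proof.
move=> rs; have [ss|ss] := ltnP s (size (la j)); last by rewrite nth_default.
have /andP[so _] := laP j.
have geq_trans : transitive geq by move=> a b c ba ac; apply: leq_trans ac ba.
by apply: (sorted_leq_nth geq_trans leqnn 0 so) => //; rewrite inE (leq_ltn_trans rs).
Qed.

Lemma nth_head (s : seq nat) : nth 0 s 0 = head 0 s.
Proof. by case: s. Qed.

Variable N : J -> nat.
Hypothesis laN : pad_defined la N.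

Lemma pad_definedP j : (sumn (la j) + head 0 (la j) <= N j)%N.
Proof. exact: (forallP laN). Qed.

Lemma sumn_le j : (sumn (la j) <= N j)%N.
Proof. exact: leq_trans (leq_addr _ _) (pad_definedP j). Qed.

Lemma pad_col_lt j x : (x < sumn (la j))%N ->
  (pad_col j x < nth 0 (la j) (reshape_index (la j) x))%N.
Proof. by move=> xs; rewrite /pad_col xs reshape_offsetP. Qed.

Lemma pad_col_head j x : (x < sumn (la j))%N -> (pad_col j x < head 0 (la j))%N.
Proof.
by move=> /pad_col_lt/leq_trans; apply; rewrite -nth_head part_nth.
Qed.

(** The parts of la decrease and, by [pad_defined], the first row is at least as long as the next
    one, so every place above a box is a box. The first row is treated apart because its boxes are
    numbered last. *)
Lemma pad_tableau : tableau N pad_row pad_col.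
Proof.
split=> [j x i|j x y].
  rewrite {1}/pad_row; case: ifP => // xs ir.
  have cx := pad_col_lt xs.
  case: i ir => [_|i ir].
    have yN : (sumn (la j) + pad_col j x < N j)%N.
      by apply: leq_trans (pad_definedP j); rewrite ltn_add2l pad_col_head.
    exists (Ordinal yN); rewrite /pad_row /= {1}/pad_col ltnNge leq_addr //=.
    by rewrite addKn.
  have ci : (pad_col j x < nth 0 (la j) i)%N.
    by apply: leq_trans cx (part_nth _ _); apply: ltnW.
  have ys := flatten_indexP ci.
  exists (Ordinal (leq_trans ys (sumn_le j))).
    by rewrite {1}/pad_col /= ys flatten_indexKr.
  by rewrite /pad_row /= ys flatten_indexKl.
rewrite /pad_row; case: ifP => xs; case: ifP => ys //.
  rewrite /pad_col xs ys => c [r]; apply: val_inj => /=.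
  by rewrite -(reshape_indexK (la j) x) -(reshape_indexK (la j) y) c r.
move/negbT: xs; move/negbT: ys; rewrite -!leqNgt /pad_col !ltnNge => ys xs.
rewrite xs ys /= => c _; apply: val_inj; rewrite /= -(subnK xs) -(subnK ys).
by rewrite c.
Qed.

(** A box numbered from |la| + la_1 on lies in the first row, to the right of all the columns of
    la. *)
Lemma pad_first_row_ext N' : first_row_ext N N' pad_row pad_col.
Proof.
move=> j x Nx; have sx := leq_trans (sumn_le j) Nx.
rewrite /pad_row ltnNge sx; split=> // y.
rewrite {1}/pad_col ltnNge sx /=; case: (ltnP y (sumn (la j))) => [ys|sy].
  move=> E; have := pad_col_head ys; rewrite -E ltnNge leq_subRL //.
  by rewrite (leq_trans (pad_definedP j)).
rewrite /pad_col ltnNge sy /= => E; apply: val_inj; rewrite /= -(subnK sx) -(subnK sy).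
by rewrite E.
Qed.

End PaddedTableau.

Lemma reshape_index_cons n sh i :
  reshape_index (n :: sh) i = if (i < n)%N then 0%N else (reshape_index sh (i - n)).+1.
Proof. by rewrite /reshape_index /= subn_eq0; case: ltnP => // ni; rewrite subSn. Qed.

Section PadIsotypic.
Variables (K : fieldType) (J : finType) (la : J -> seq nat) (N : J -> nat).
Hypothesis char0 : [pchar K] =i pred0.
Hypothesis laP : forall j, is_partition (la j).
Hypothesis laN : pad_defined la N.

(** Specht modules are defined with the boxes numbered row by row; [rot_fun] passes to that
    numbering by moving the first row to the front. *)
Definition rot_fun j (x : 'I_(N j)) : nat :=
  if (x < sumn (la j))%N then (N j - sumn (la j) + x)%N else (x - sumn (la j))%N.

Lemma rot_lt j (x : 'I_(N j)) : (rot_fun x < N j)%N.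
Proof.
rewrite /rot_fun; case: ifP => [xs|_]; last exact: leq_ltn_trans (leq_subr _ _) (ltn_ord x).
by rewrite -[X in (_ < X)%N](subnK (sumn_le laN j)) ltn_add2l.
Qed.

Lemma rot_inj j : injective (fun x : 'I_(N j) => Ordinal (rot_lt x)).
Proof.
have lt (x y : 'I_(N j)) : (x < sumn (la j))%N -> ~~ (y < sumn (la j))%N ->
    rot_fun x != rot_fun y.
  rewrite /rot_fun => xs ys; rewrite xs (negPf ys); rewrite -leqNgt in ys.
  by rewrite neq_ltn orbC (leq_trans _ (leq_addr _ _)) // ltn_sub2r ?(leq_ltn_trans ys).
move=> x y /(congr1 val)/= E; apply: val_inj => /=; move: E.
case: (boolP (x < sumn (la j))%N) => xs; case: (boolP (y < sumn (la j))%N) => ys.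
- by rewrite /rot_fun xs ys => /addnI.
- by move/eqP; rewrite (negPf (lt _ _ xs ys)).
- by move/esym/eqP; rewrite (negPf (lt _ _ ys xs)).
rewrite /rot_fun (negPf xs) (negPf ys); move: xs ys; rewrite -!leqNgt => xs ys E.
by rewrite -(subnK xs) E subnK.
Qed.

Definition rotJ : symJ N := [ffun j => perm (@rot_inj j)].

Lemma rotJE j x : rotJ j x = rot_fun x :> nat.
Proof. by rewrite ffunE permE. Qed.

Lemma pad_row_std j (x : 'I_(N j)) :
  pad_row la j x = std_row (pad la N) j (rotJ j x).
Proof.
rewrite rotJE /pad_row /std_row /pad /rot_fun reshape_index_cons.
case: ltnP => xs; first by rewrite ltnNge leq_addr addKn.
by rewrite ltn_sub2r // (leq_ltn_trans xs).
Qed.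

Lemma pad_col_std j (x : 'I_(N j)) :
  pad_col la j x = std_col (pad la N) j (rotJ j x).
Proof.
have := pad_row_std x; rewrite rotJE /pad_row /std_row /std_col /pad_col /reshape_offset.
rewrite /pad /rot_fun; case: ifP => xs <-; last by rewrite subn0.
by rewrite /= subnDl.
Qed.

Let a := sym K N (pad_row la).
Let b := alt K N (pad_col la).

(** With s = [rotJ], the generator of [irrep] is e = s^-1 a b s. Since (b a)^2 = c b a with c
    nonzero, each of e and b a is of the form x f z with f the other one, so by [alggen_sub] they
    generate the same subrepresentation. *)
Lemma pad_isotypicE (U : vectType K) (rho : symJ N -> 'End(U)) (X : {vspace U}) :
  right_rep rho -> is_subrep rho X -> pad_isotypic la rho X = alggen rho (b ** a) X.
Proof.
move=> rhoP Xi; rewrite /pad_isotypic laN irrepE.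
set e := _ ** _; pose s := rotJ.
have T := pad_tableau laP laN.
have [c c0 cE] := ba_sqr char0 T; rewrite -/a -/b in cE.
have eE : e = gdelta K s^-1%g ** a ** b ** gdelta K s.
  rewrite /e (sym_conj _ pad_row_std) (alt_conj _ pad_col_std) -/a -/b -/s !convA.
  by rewrite -(convA _ (gdelta K s)) gdeltaM mulgV conv1.
(* [star] exchanges b a and a b, and so carries the identity for b a to a b. *)
have abab : (a ** b) ** (a ** b) = c *: (a ** b).
  rewrite -[a]star_sym -[b]star_alt -star_conv -/a -/b -star_conv.
  by rewrite cE starZ.
have abxab x : exists k, (a ** b) ** x ** (a ** b) = k *: (a ** b).
  have [k E] := alt_conv_sym char0 T x; rewrite -/a -/b in E.
  exists (k * c).
  have -> : (a ** b) ** x ** (a ** b) = a ** (b ** x ** a) ** b by rewrite !convA.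
  rewrite E convZr convZl -scalerA -abab; congr (_ *: _).
  by rewrite !convA.
have eS x : e ** x ** e =
    gdelta K s^-1%g ** ((a ** b) ** (gdelta K s ** x ** gdelta K s^-1%g) ** (a ** b)) ** gdelta K s.
  by rewrite eE !convA.
have ee : e ** e = c *: e.
  have := eS (gdelta K 1%g); rewrite !conv1 gdeltaM mulgV conv1 abab => ->.
  by rewrite convZr convZl convA -eE.
have exe x : exists k, e ** x ** e = k *: e.
  have [k E] := abxab (gdelta K s ** x ** gdelta K s^-1%g); exists k.
  by rewrite eS E convZr convZl convA -eE.
rewrite (isotypic_alggen _ c0 ee exe) //; last first.
  by rewrite natr_neq0 // -lt0n; apply/card_gt0P; exists 1%g.
apply/eqP; rewrite eqEsubv; apply/andP; split.
  apply: (@alggen_sub _ _ _ _ rhoP _ _ (c^-1 *: (gdelta K s^-1%g ** a)) (b ** gdelta K s)) => //.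
  rewrite !convZl.
  have -> : gdelta K s^-1%g ** a ** (b ** a) ** (b ** gdelta K s) =
            gdelta K s^-1%g ** ((a ** b) ** (a ** b)) ** gdelta K s by rewrite !convA.
  by rewrite abab convZr convZl scalerA mulVf // scale1r eE !convA.
apply: (@alggen_sub _ _ _ _ rhoP _ _ (c^-1 *: (b ** gdelta K s)) (gdelta K s^-1%g ** a)) => //.
rewrite eE !convZl.
have -> : b ** gdelta K s ** (gdelta K s^-1%g ** a ** b ** gdelta K s) ** (gdelta K s^-1%g ** a) =
    b ** (gdelta K s ** gdelta K s^-1%g) ** a ** b ** (gdelta K s ** gdelta K s^-1%g) ** a.
  by rewrite !convA.
by rewrite gdeltaM mulgV !conv1 -convA cE scalerA mulVf ?scale1r.
Qed.

End PadIsotypic.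

(** * Permuting the vertices of packings *)

(** H and H' take the same values with the same multiplicities, and they agree from m on; removing
    these points leaves equal multisets for F and F'. *)
Lemma perm_restrict m n (le : (m <= n)%N) (Q : eqType) (F F' : 'I_m -> Q)
    (H H' : 'I_n -> Q) (g : 'S_n) :
  (forall x, H (widen_ord le x) = F x) -> (forall x, H' (widen_ord le x) = F' x) ->
  (forall x : 'I_n, (m <= x)%N -> H x = H' x) -> (forall x, H' (g x) = H x) ->
  exists s : 'S_m, forall x, F' (s x) = F x.
Proof.
move=> HF HF' new gH.
have /tuple_permP[s Es] : perm_eq [tuple F x | x < m] [tuple F' x | x < m].
  have cntE k (P : pred 'I_k) : count P (Finite.enum 'I_k) = (\sum_x P x)%N.
    by rewrite -sum1_count big_mkcond -enumT big_enum; apply: eq_bigr => x _; case: (P x).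
  apply/seq.permP => a; rewrite !count_map !cntE /=.
  have E0 : (\sum_x a (H x) = \sum_x a (H' x))%N.
    by rewrite [RHS](reindex_inj (@perm_inj _ g)); apply: eq_bigr => x _; rewrite gH.
  have E1 : (\sum_x a (H x) = \sum_x a (F x) + \sum_(x : 'I_n | (m <= x)%N) a (H' x))%N.
    rewrite (sum_widen le); congr (_ + _)%N; apply: eq_bigr => x; first by rewrite HF.
    by move=> mx; rewrite new.
  have E2 : (\sum_x a (H' x) = \sum_x a (F' x) + \sum_(x : 'I_n | (m <= x)%N) a (H' x))%N.
    by rewrite (sum_widen le); congr (_ + _)%N; apply: eq_bigr => x; rewrite HF'.
  by apply/eqP; rewrite -(eqn_add2r (\sum_(x : 'I_n | (m <= x)%N) a (H' x))) -E1 -E2 E0.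
exists s => x; have := congr1 (fun u : m.-tuple Q => tnth u x) (val_inj Es).
by rewrite !tnth_mktuple.
Qed.

Section Glue.
Variables (J0 : finType) (I : {set J0}) (A : J0 -> finType).
Local Notation J := {j | j \notin I}.
Implicit Types B C : J -> finType.

(** [glue A B (val j)] is B j only along the equation [valK j], hence the cast. *)
Definition gin B (j : J) (x : B j) : glue A B (val j) :=
  ecast o (Finite.sort (oapp B (A (val j)) o)) (esym (valK j)) x.

Lemma glue_fun_gin B C (f : FIhom B C) (j : J) (x : B j) :
  glue_fun f (gin x) = gin (f j x).
Proof. by rewrite /glue_fun /gin /glue; case: _ / (esym (valK j)). Qed.

Lemma gin_inj B j : injective (@gin B j).
Proof. by rewrite /gin /glue => x y; case: _ / (esym (valK j)). Qed.

Lemma gin_surj B j (y : glue A B (val j)) : exists x : B j, y = gin x.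
Proof.
by move: y; rewrite /gin /glue; case: _ / (esym (valK j)) => y; exists y.
Qed.

Lemma glue_fun_out B C (f f' : FIhom B C) j (y : glue A B j) :
  j \in I -> glue_fun f y = glue_fun f' y.
Proof.
move=> jI; move: y; rewrite /glue_fun /glue.
by case: insubP => // u; rewrite jI.
Qed.

Lemma glue_fun_out_surj B C (f : FIhom B C) j (y : glue A C j) :
  j \in I -> exists x : glue A B j, y = glue_fun f x.
Proof.
move=> jI; move: y; rewrite /glue_fun /glue.
by case: insubP => [u|_ y]; [rewrite jI|exists y].
Qed.

Lemma glue_fun_id B j (y : glue A B j) : glue_fun (FIid B) y = y.
Proof. by move: y; rewrite /glue_fun /glue; case: (insub j). Qed.

End Glue.

Section FIaction.
Variables (K : fieldType) (J : finType) (V : FImod K J).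

Lemma sym_action_rep N : right_rep (@sym_action K J V N).
Proof. by split=> [|s t]; [exact: sym_action1|exact: sym_actionM]. Qed.

Lemma sym_action_embed N N' (le : leJ N N') s u :
  sym_action V (embed_sym le s) (FImap V (incl_hom le) u) =
  FImap V (incl_hom le) (sym_action V s u).
Proof. by rewrite -comp_lfunE sym_action_incl comp_lfunE. Qed.

Lemma algact_emb N N' (le : leJ N N') x u :
  FImap V (incl_hom le) (algact (@sym_action K J V N) x u) =
  algact (@sym_action K J V N') (emb le x) (FImap V (incl_hom le) u).
Proof.
rewrite algactE linear_sum /emb algact_sum; apply: eq_bigr => s _.
by rewrite algactZ algact_gdelta sym_action_embed linearZ.
Qed.

End FIaction.

Section TupleModule.
Variables (K : fieldType) (J : finType) (p : nat).

Fact tuple_mod_id (A : J -> finType) :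
  push K (subset_map (FIid A)) p = \1%VF.
Proof. by rewrite subset_map_id push_id. Qed.

Fact tuple_mod_comp (A B C : J -> finType) (g : FIhom B C) (f : FIhom A B) :
  push K (subset_map (FIcomp g f)) p = (push K (subset_map g) p \o push K (subset_map f) p)%VF.
Proof. by rewrite subset_map_comp push_comp. Qed.

(* All functions on p-tuples of vertices; the p-chains form a submodule. *)
Definition tuple_mod : FImod K J := FIMod tuple_mod_id tuple_mod_comp.

End TupleModule.

Section Moves.
Variables (J0 : finType) (I : {set J0}) (A : J0 -> finType) (p : nat).
Local Notation J := {j | j \notin I}.
Local Notation T B := (subset_tuple (@glue J0 I A B)).
Local Notation gh f := (@glue_hom J0 I A _ _ f).
Local Notation gin := (@gin J0 I A _).
Implicit Types B C : J -> finType.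

Definition tuple_push B C (f : FIhom B C) (t : p.-tuple (T B)) : p.-tuple (T C) :=
  [tuple of map (subset_map (gh f)) t].

(** A tuple of vertices seen as a filling: the box x holds the set of the positions i whose vertex
    contains x. With the components in the fixed sets, the letters determine the tuple
    ([tuple_ext]). *)
Definition letter B (t : p.-tuple (T B)) (j : J) (x : B j) : {ffun 'I_p -> bool} :=
  [ffun i => gin x \in tnth t i (val j)].

Lemma letter_push B C (f : FIhom B C) (t : p.-tuple (T B)) j x :
  letter (tuple_push f t) (f j x) = letter t x.
Proof.
apply/ffunP=> i; rewrite !ffunE tnth_map ffunE -glue_fun_gin mem_imset //.
exact: glue_fun_inj.
Qed.

Lemma letter_new B C (f : FIhom B C) (t : p.-tuple (T B)) j y :
  (forall x, f j x <> y) -> letter (tuple_push f t) y = [ffun=> false].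
Proof.
move=> fy; apply/ffunP=> i; rewrite !ffunE tnth_map ffunE.
apply/imsetP => -[z _]; have [x ->] := gin_surj z.
by rewrite /= glue_fun_gin => /gin_inj /esym /fy.
Qed.

Lemma tuple_ext B (t u : p.-tuple (T B)) :
  (forall j (x : B j), letter t x = letter u x) ->
  (forall j i, j \in I -> tnth t i j = tnth u i j) -> t = u.
Proof.
move=> tu tuI; apply: eq_from_tnth => i; apply/ffunP=> j.
have [jI|jI] := boolP (j \in I); first exact: tuI.
apply/setP=> y; have [x ->] := @gin_surj _ _ _ _ (exist _ j jI) y.
by have /ffunP/(_ i) := tu _ x; rewrite !ffunE.
Qed.

Lemma tuple_push_comp B C D (g : FIhom C D) (f : FIhom B C) t :
  tuple_push g (tuple_push f t) = tuple_push (FIcomp g f) t.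
Proof.
apply: eq_from_tnth => i; rewrite !tnth_map; apply/ffunP=> j; rewrite !ffunE.
rewrite -imset_comp; apply: eq_imset => y /=; rewrite /glue_fun.
by move: y; rewrite /glue; case: (insub j).
Qed.

Lemma tuple_push_id B (t : p.-tuple (T B)) : tuple_push (FIid B) t = t.
Proof.
apply: eq_from_tnth => i; rewrite !tnth_map; apply/ffunP=> j; rewrite !ffunE.
rewrite (eq_imset (g := id)) ?imset_id // => y /=; exact: glue_fun_id.
Qed.

Lemma tuple_push_out B C (f f' : FIhom B C) t i j : j \in I ->
  tnth (tuple_push f t) i j = tnth (tuple_push f' t) i j.
Proof.
move=> jI; rewrite !tnth_map !ffunE; apply: eq_imset => y.
exact: glue_fun_out.
Qed.

Lemma tuple_push_out_inj B C (f : FIhom B C) t u i j : j \in I ->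
  tnth (tuple_push f t) i j = tnth (tuple_push f u) i j -> tnth t i j = tnth u i j.
Proof. by rewrite !tnth_map !ffunE => _; apply: imset_inj; exact: glue_fun_inj. Qed.

Section Perm.
Variable N : J -> nat.
Implicit Types (s : symJ N) (t u : p.-tuple (T (ordJ N))).

Definition tuple_perm s t := tuple_push (perm_hom s) t.

Lemma tuple_permM s1 s2 t : tuple_perm (s1 * s2)%g t = tuple_perm s2 (tuple_perm s1 t).
Proof.
rewrite /tuple_perm tuple_push_comp; congr tuple_push; apply: FIhom_eq => j x /=.
by rewrite ffunE permM.
Qed.

Lemma tuple_perm1 t : tuple_perm 1%g t = t.
Proof.
rewrite -[RHS]tuple_push_id; congr tuple_push; apply: FIhom_eq => j x /=.
by rewrite ffunE perm1.
Qed.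

Lemma letter_tuple_perm s t j (x : 'I_(N j)) : letter (tuple_perm s t) (s j x) = letter t x.
Proof. exact: letter_push. Qed.

Lemma tuple_perm_eq s t u :
  (forall j (x : 'I_(N j)), letter u (s j x) = letter t x) ->
  (forall j i, j \in I -> tnth t i j = tnth u i j) -> tuple_perm s t = u.
Proof.
move=> tu tuI; apply: tuple_ext => [j x|j i jI].
  have -> : x = s j ((s j)^-1%g x) by rewrite permKV.
  by rewrite letter_tuple_perm tu.
by rewrite -tuI // -[in RHS](tuple_push_id t); apply: tuple_push_out.
Qed.

(** The elements that take t to u form a coset of the stabilizer of u. *)
Lemma card_tuple_perm (R : {group symJ N}) s t u : s \in R -> tuple_perm s t = u ->
  #|[set g in R | tuple_perm g t == u]| = #|[set g in R | tuple_perm g u == u]|.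
Proof.
move=> sR stu; rewrite -(card_imset _ (mulgI s^-1%g)); apply: eq_card => g.
rewrite inE; apply/imsetP/andP => [[h + ->]|[gR /eqP gu]].
  rewrite inE => /andP[hR /eqP ht]; rewrite groupM ?groupV // tuple_permM.
  by rewrite -[in tuple_perm s^-1%g u]stu -(tuple_permM s) mulgV tuple_perm1 ht.
exists (s * g)%g; last by rewrite mulKg.
by rewrite inE groupM // tuple_permM stu gu /=.
Qed.

End Perm.

Section Inclusion.
Variables (N N' : J -> nat) (le : leJ N N').

Definition tuple_incl (t : p.-tuple (T (ordJ N))) := tuple_push (incl_hom le) t.

Lemma letter_tuple_incl t j (x : 'I_(N j)) :
  letter (tuple_incl t) (widen_ord (le j) x) = letter t x.
Proof. exact: (letter_push (incl_hom le)). Qed.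

Lemma letter_imove_new t j (x : 'I_(N' j)) : (N j <= x)%N ->
  letter (tuple_incl t) x = [ffun=> false].
Proof.
move=> Nx; apply: letter_new => y /(congr1 val)/= E.
by move: Nx; rewrite -E leqNgt ltn_ord.
Qed.

Lemma tuple_incl_embed s t :
  tuple_incl (tuple_perm s t) = tuple_perm (embed_sym le s) (tuple_incl t).
Proof.
rewrite /tuple_incl /tuple_perm !tuple_push_comp; congr tuple_push; apply: FIhom_eq => j x /=.
by rewrite embed_symE.
Qed.

(** [perm_restrict] applied to the pairs (row, letter): the new boxes hold the empty letter in both
    fillings and can be discarded. *)
Lemma same_orbit row (g : symJ N') t u : g \in stab N' row ->
  tuple_perm g (tuple_incl t) = tuple_incl u -> exists2 s, s \in stab N row & tuple_perm s t = u.
Proof.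
move=> /stabP gR gtu.
have sj j : exists s : 'S_(N j), forall x, (row j (s x), letter u (s x)) = (row j x, letter t x).
  pose H v (x : 'I_(N' j)) := (row j x, letter (tuple_incl v) x).
  apply: (@perm_restrict _ _ (le j) _ (fun x => (row j x, letter t x))
           (fun x => (row j x, letter u x)) (H t) (H u) (g j)).
  - by move=> x; rewrite /H letter_tuple_incl.
  - by move=> x; rewrite /H letter_tuple_incl.
  - by move=> x Nx; rewrite /H !letter_imove_new.
  by move=> x; rewrite /H gR -gtu letter_tuple_perm.
have [s sP] := fin_all_exists sj.
exists [ffun j => s j].
  by apply/stabP => j x; rewrite ffunE; have [] := sP j x.
apply: tuple_perm_eq => [j x|j i jI]; first by rewrite ffunE; have [] := sP j x.
apply: (tuple_push_out_inj (f := incl_hom le)) => //.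
rewrite -/(tuple_incl u) -gtu /tuple_perm tuple_push_comp; exact: tuple_push_out.
Qed.

End Inclusion.

End Moves.

(** * Injectivity on chains *)

Section Chains.
Variables (K : fieldType) (J0 : finType) (I : {set J0}) (A : J0 -> finType) (p : nat).
Hypothesis char0 : [pchar K] =i pred0.
Local Notation J := {j | j \notin I}.
Local Notation T B := (subset_tuple (@glue J0 I A B)).
Local Notation F := (restriction (tuple_mod K J0 p) I A).
Implicit Types B C : J -> finType.

Lemma F_mapE B C (f : FIhom B C) (c : F B) u :
  (FImap F f c : {ffun p.-tuple (T C) -> K^o}) u =
  \sum_(t : p.-tuple (T B) | tuple_push f t == u) (c : {ffun p.-tuple (T B) -> K^o}) t.
Proof. exact: pushE. Qed.

Lemma F_osimplex B C (f : FIhom B C) (t : p.-tuple (T B)) :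
  FImap F f (osimplex K t) = osimplex K (tuple_push f t).
Proof. exact: push_osimplex. Qed.

Lemma sym_evalE N row (h : {ffun p.-tuple (T (ordJ N)) -> K^o}) w :
  (algact (@sym_action K J F N) (sym K N row) h : {ffun p.-tuple (T (ordJ N)) -> K^o}) w =
  \sum_t (h t *+ #|[set g in stab N row | tuple_perm g t == w]|).
Proof.
rewrite algactE sum_ffunE (eq_bigr (fun g : symJ N => \sum_(t | tuple_perm g t == w)
    if g \in stab N row then h t else 0)) => [|g _]; last first.
  rewrite ffunE F_mapE ffunE; case: (g \in _); first by rewrite scale1r.
  by rewrite scale0r big1.
rewrite (exchange_big_dep predT) //=; apply: eq_bigr => t _.
rewrite -big_mkcondr /= sumr_const; congr (_ *+ _); apply: eq_card => g.
by rewrite [RHS]inE andbC.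
Qed.

(** The coefficient of h a at w is the sum of the h(t) n(t), and that of phi(h) a' at the image of w
    is the sum of the h(t) n'(t). These sums are proportional, because n'(t) / n(t) is the same for
    all t in the orbit of w and both counts vanish elsewhere. *)
Lemma sym_incl_eq0 N N' (le : leJ N N') row (h : F (ordJ N)) :
  algact (@sym_action K J F N') (sym K N' row) (FImap F (incl_hom le) h) = 0 ->
  algact (@sym_action K J F N) (sym K N row) h = 0.
Proof.
move=> h0; apply/ffunP=> w; rewrite sym_evalE [RHS]ffunE.
pose n t := #|[set g in stab N row | tuple_perm g t == w]|.
pose n' t := #|[set g in stab N' row | tuple_perm g (tuple_incl le t) == tuple_incl le w]|.
have sum0 : \sum_t (h t *+ n' t) = 0.
  have /ffunP/(_ (tuple_incl le w)) := h0; rewrite sym_evalE [RHS]ffunE => E0; apply: etrans E0.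
  under [RHS]eq_bigr do rewrite F_mapE -sumrMnl.
  rewrite [RHS](exchange_big_dep predT) //=; apply: eq_bigr => t _.
  by rewrite (big_pred1 (tuple_incl le t)) // => u; rewrite eq_sym.
pose s := #|[set g in stab N row | tuple_perm g w == w]|.
pose s' := #|[set g in stab N' row | tuple_perm g (tuple_incl le w) == tuple_incl le w]|.
have s'0 : s'%:R != 0 :> K.
  rewrite natr_neq0 // -lt0n; apply/card_gt0P; exists 1%g.
  by rewrite inE tuple_perm1 eqxx group1.
(* By [same_orbit], t is in the orbit of w before the inclusion exactly when it is after; the counts
   are then the orders s and s' of the stabilizers. *)
have nn' t : (s' * n t = s * n' t)%N.
  have [[g gR gt]|no] : (exists2 g, g \in stab N row & tuple_perm g t = w) \/
      ~ (exists2 g, g \in stab N row & tuple_perm g t = w).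
  - have [/existsP[g /andP[gR /eqP gt]]|no] :=
      boolP [exists g, (g \in stab N row) && (tuple_perm g t == w)]; [left; by exists g|right].
    by move=> [g gR gt]; case/negP: no; apply/existsP; exists g; rewrite gR gt /=.
  - rewrite /n /n' (card_tuple_perm (R := stab_group N row) gR gt).
    rewrite (card_tuple_perm (R := stab_group N' row) (s := embed_sym le g) (u := tuple_incl le w)).
    + by rewrite mulnC.
    + by rewrite /= stab_embed.
    by rewrite -tuple_incl_embed gt.
  have -> : n t = 0%N.
    apply/eqP; rewrite cards_eq0; apply/eqP/setP => g; rewrite inE in_set0; apply/negP.
    by case/andP=> gR /eqP gt; apply: no; exists g.
  have -> : n' t = 0%N.
    apply/eqP; rewrite cards_eq0; apply/eqP/setP => g; rewrite inE in_set0; apply/negP.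
    by case/andP=> gR /eqP gt; have [g' g'R g't] := same_orbit gR gt; apply: no; exists g'.
  by rewrite !muln0.
have : s'%:R * (\sum_t (h t *+ n t) : K) = 0.
  rewrite mulr_natl -sumrMnl.
  under eq_bigr do rewrite -mulrnA mulnC nn' mulnC mulrnA.
  by rewrite sumrMnl sum0 mul0rn.
by move/eqP; rewrite mulf_eq0 (negPf s'0) => /eqP.
Qed.

End Chains.

(** * A criterion for stability *)

Section Stable.
Variables (K : fieldType) (J : finType) (la : J -> seq nat).
Hypothesis char0 : [pchar K] =i pred0.
Hypothesis laP : forall j, is_partition (la j).

(* The generator b a of the ideal is more convenient than a b, since emb b = b'. *)
Definition ysym (N : J -> nat) : {ffun symJ N -> K^o} :=
  alt K N (pad_col la) ** sym K N (pad_row la).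

Lemma card_symJ (N : J -> nat) : #|symJ N|%:R != 0 :> K.
Proof. by rewrite natr_neq0 // -lt0n; apply/card_gt0P; exists 1%g. Qed.

Variables (N N' : J -> nat) (le : leJ N N').
Hypothesis laN : pad_defined la N.

Lemma pad_defined_leJ : pad_defined la N'.
Proof. by apply/forallP=> j; apply: leq_trans (pad_definedP laN j) (le j). Qed.

Lemma emb_alt_pad : emb le (alt K N (pad_col la)) = alt K N' (pad_col la).
Proof.
by apply: emb_alt => j x y Nx; have [_] := pad_first_row_ext laP laN Nx; apply.
Qed.

(** emb(b a) a' = b' emb(a) a', and a' absorbs emb(a) up to the order of the row stabilizer. *)
Lemma ysym_emb :
  ysym N' = (#|stab N (pad_row la)|%:R)^-1 *: (emb le (ysym N) ** sym K N' (pad_row la)).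
Proof.
rewrite /ysym embM emb_alt_pad -convA emb_sym_abs convZr scalerA mulVf ?scale1r //.
exact: card_stab_neq0.
Qed.

(** Von Neumann's lemma with the middle factor emb(a) x b'. *)
Lemma ysym_emb_conv x : exists k, emb le (ysym N) ** x ** ysym N' = k *: ysym N'.
Proof.
have [k E] := alt_sym_conv char0 le (emb le (sym K N (pad_row la)) ** x ** alt K N' (pad_col la))
  (pad_tableau laP laN) (pad_first_row_ext laP laN (N' := N')).
by exists k; rewrite /ysym -E embM emb_alt_pad !convA.
Qed.

Variable V : FImod K J.
Local Notation phi := (FImap V (incl_hom le)).
Local Notation rho := (@sym_action K J V N).
Local Notation rho' := (@sym_action K J V N').
Local Notation tau := (@translate K (symJ N') (V (ordJ N))).

Lemma ysym_incl0 u : algact rho (ysym N) u = 0 -> algact rho' (ysym N') (phi u) = 0.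
Proof.
move=> u0; rewrite ysym_emb algactZ algactM; last exact: sym_action_rep.
by rewrite -algact_emb u0 !linear0.
Qed.

(** u y - c u is killed by y, so its image is killed by y'. *)
Lemma ysym_incl_idem c u : ysym N ** ysym N = c *: ysym N ->
  algact rho' (ysym N') (phi (algact rho (ysym N) u)) = c *: algact rho' (ysym N') (phi u).
Proof.
move=> yy; apply/eqP; rewrite -subr_eq0 -!linearZ -!linearB /=; apply/eqP.
apply: ysym_incl0; rewrite linearB linearZ /= -algactM; last exact: sym_action_rep.
by rewrite yy algactZ subrr.
Qed.

(** The element y (x) 1 of the induced representation: it is supported on the small group, with
    value y g^-1 at g. The sum has at most one term. *)
Definition tens_fun (y : V (ordJ N)) : {ffun symJ N' -> V (ordJ N)} :=
  [ffun h : symJ N' => \sum_(g | embed_sym le g == h) rho g^-1%g y].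

Lemma tens_is_linear : linear tens_fun.
Proof.
move=> k x y; apply/ffunP=> h; rewrite !ffunE scaler_sumr -big_split /=.
by apply: eq_bigr => g _; rewrite linearP.
Qed.
HB.instance Definition _ :=
  GRing.isLinear.Build K (V (ordJ N)) {ffun symJ N' -> V (ordJ N)} _ tens_fun tens_is_linear.

Definition tens : 'Hom(V (ordJ N), {ffun symJ N' -> V (ordJ N)}) := linfun tens_fun.

Lemma tensE y h : tens y h = \sum_(g | embed_sym le g == h) rho g^-1%g y.
Proof. by rewrite lfunE ffunE. Qed.

Lemma tens_rho s y : tens (rho s y) = tau (embed_sym le s) (tens y).
Proof.
apply/ffunP=> h; rewrite translateE !tensE (reindex_inj (mulIg s)) /=.
apply: eq_big => g; first by rewrite embed_symM; apply/eqP/eqP => [<-|->]; rewrite ?mulgK ?mulgKV.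
by move=> _; rewrite -(rhoM (sym_action_rep V N)) invMg mulKVg.
Qed.

Lemma tens_algact x y : tens (algact rho x y) = algact tau (emb le x) (tens y).
Proof.
rewrite algactE linear_sum /emb algact_sum; apply: eq_bigr => s _.
by rewrite algactZ algact_gdelta linearZ /= tens_rho.
Qed.

Lemma induced_map_tens y : induced_map V le (tens y) = phi y.
Proof.
rewrite induced_mapE /induced_map_fun.
under eq_bigr do rewrite tensE !linear_sum /=.
rewrite (exchange_big_dep predT) //= (eq_bigr (fun=> phi y)) => [|g _].
  by rewrite sumr_const cardT -cardE -scaler_nat scalerA mulVf ?scale1r ?card_symJ.
rewrite (big_pred1 (embed_sym le g)) => [|h]; last by rewrite /= eq_sym.
by rewrite sym_action_embed -(rhoM (sym_action_rep V N)) mulVg (rho1 (sym_action_rep V N)).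
Qed.

Lemma induced_map_translate g f : induced_map V le (tau g f) = rho' g (induced_map V le f).
Proof.
rewrite !induced_mapE /induced_map_fun linearZ; congr (_ *: _); rewrite linear_sum /=.
rewrite (reindex_inj (mulIg g)) /=; apply: eq_bigr => h _.
by rewrite translateE mulgK (rhoM (sym_action_rep V N')).
Qed.

Lemma induced_map_algact x f :
  induced_map V le (algact tau x f) = algact rho' x (induced_map V le f).
Proof.
rewrite !algactE linear_sum; apply: eq_bigr => g _.
by rewrite linearZ /= induced_map_translate.
Qed.

Lemma induced_subrep X : is_subrep tau (induced le X).
Proof.
move=> g f /inducedP[fX fh]; apply/inducedP; split=> [h|h k]; rewrite !translateE //.
by rewrite -mulgA fh.
Qed.

Lemma tens_induced X y : is_subrep rho X -> y \in X -> tens y \in induced le X.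
Proof.
move=> Xi yX; apply/inducedP; split=> [h|h g].
  by rewrite tensE; apply: memv_suml => s _; exact: Xi.
rewrite !tensE linear_sum (reindex_inj (mulgI h)) /=; apply: eq_big => s.
  by rewrite embed_symM (can_eq (mulKg _)).
by move=> _; rewrite -(rhoM (sym_action_rep V N)) invMg mulgKV.
Qed.

(** f is the sum of the f(g) (x) g over cosets; a sum over all g counts each coset as many times as
    the small group has elements. *)
Lemma induced_expand X f : f \in induced le X ->
  f = (#|symJ N|%:R : K)^-1 *: \sum_g tau g (tens (f g)).
Proof.
case/inducedP=> _ fh; apply/ffunP=> h; rewrite ffunE sum_ffunE.
under eq_bigr do rewrite translateE tensE.
rewrite (exchange_big_dep predT) //= (eq_bigr (fun=> f h)) => [|g _].
  by rewrite sumr_const cardT -cardE -scaler_nat scalerA mulVf ?scale1r ?card_symJ.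
rewrite (big_pred1 (embed_sym le g^-1 * h)%g) => [|k /=]; first by rewrite fh.
by rewrite embed_symV; apply/eqP/eqP => ->; rewrite ?invMg ?invgK ?mulgKV ?mulKVg.
Qed.

(** By [induced_expand], f is a combination of elements (w y s (x) 1) g. Multiplied by y', such an
    element becomes (w (x) 1) emb(y) s g y', a multiple of (w (x) 1) y' by [ysym_emb_conv]. *)
Lemma induced_ysym f : f \in induced le (alggen rho (ysym N) fullv) ->
  exists y, algact tau (ysym N') f = algact tau (ysym N') (tens y).
Proof.
move=> fi; pose P f := exists y, algact tau (ysym N') f = algact tau (ysym N') (tens y).
have PD k f1 f2 : P f1 -> P f2 -> P (k *: f1 + f2).
  by move=> [y1 E1] [y2 E2]; exists (k *: y1 + y2); rewrite !linearP /= E1 E2.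
have P0 : P 0 by exists 0; rewrite !linear0.
have Psum (T : finType) (F : T -> _) : (forall i, P (F i)) -> P (\sum_i F i).
  move=> PF; elim/big_ind: _ => // f1 f2 P1 P2.
  by rewrite -[f1]scale1r; apply: PD.
have PZ k f1 : P f1 -> P (k *: f1) by move=> P1; rewrite -[_ *: _]addr0; apply: PD.
rewrite -/(P f) (induced_expand fi); apply/PZ/Psum => g.
have /inducedP[/(_ g) + _] := fi; move: (f g) => x /memv_sumP[v vX ->].
rewrite !linear_sum; apply: Psum => s.
have /memv_imgP[_ /memv_imgP[w _ ->] ->] := vX s isT.
have [k E] := ysym_emb_conv (gdelta K (embed_sym le s) ** gdelta K g).
exists (k *: w); rewrite /= tens_rho tens_algact -!(algact_gdelta tau) -!algactM;
  try exact: translate_rep.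
by rewrite linearZ /= linearZ /= -algactZ -E !convA.
Qed.

(** Surjectivity: v y' = phi(u) y' = c^-1 phi(u y) y', the image of c^-1 (u y (x) 1) y'.
    Injectivity: by [alggen_kill] it is enough that y' kill the kernel. If f is in the kernel, f y'
    = (w (x) 1) y' for some w by [induced_ysym], so phi(w) y' = 0 and w y = 0; then (w (x) 1) y', a
    multiple of (w y (x) 1) a', is 0. *)
Lemma phi_iso_criterion :
  (forall u, algact rho' (ysym N') (phi u) = 0 -> algact rho (ysym N) u = 0) ->
  (forall v, exists u, algact rho' (ysym N') v = algact rho' (ysym N') (phi u)) ->
  phi_iso V le la.
Proof.
move=> P1 P2; have laN' := pad_defined_leJ.
have rhoP := sym_action_rep V N; have rhoP' := sym_action_rep V N'.
have tauP : right_rep tau by exact: translate_rep.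
have [c c0 cE] := ba_sqr char0 (pad_tableau laP laN).
have XE : pad_isotypic la rho fullv = alggen rho (ysym N) fullv.
  by apply: pad_isotypicE => // g u _; exact: memvf.
pose ind := induced le (alggen rho (ysym N) fullv).
have indi : is_subrep tau ind by exact: induced_subrep.
have SE : phi_source V le la = alggen tau (ysym N') ind.
  by rewrite /phi_source XE pad_isotypicE.
have TE : phi_target V N' la = alggen rho' (ysym N') fullv.
  by apply: pad_isotypicE => // g u _; exact: memvf.
split; rewrite SE ?TE.
  apply/eqP; rewrite eqEsubv; apply/andP; split.
    apply/subvP => _ /memv_imgP[f /memv_sumP[h hS ->] ->]; rewrite linear_sum.
    apply: memv_suml => g _; have /memv_imgP[_ /memv_imgP[w _ ->] ->] := hS g isT.
    by rewrite /= induced_map_translate induced_map_algact mem_alggen ?memvf.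
  apply: alggen_least => [g|v _].
    move=> _ /memv_imgP[f fS ->]; rewrite -induced_map_translate memv_img //.
    exact: (alggen_inv tauP).
  have [u ->] := P2 v.
  have -> : algact rho' (ysym N') (phi u) =
      c^-1 *: algact rho' (ysym N') (phi (algact rho (ysym N) u)).
    by rewrite (ysym_incl_idem _ cE) scalerA mulVf ?scale1r.
  rewrite -induced_map_tens -induced_map_algact; apply/memvZ/memv_img.
  rewrite -[algact tau _ _](rho1 tauP); apply: mem_alggen; apply: tens_induced.
    exact: alggen_inv.
  by rewrite -[algact rho _ _](rho1 rhoP) mem_alggen ?memvf.
apply: (alggen_kill tauP (card_symJ _) (e := ysym N') (X := ind) _ (capvSl _ _)).
  move=> g f; rewrite !memv_cap !memv_ker => /andP[fS /eqP f0].
  by rewrite (alggen_inv tauP) //= induced_map_translate f0 linear0.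
move=> f; rewrite memv_cap memv_ker => /andP[fS /eqP f0].
have fi : f \in ind.
  by apply: subvP fS; apply: alggen_least => // u uX; exact: algact_inv.
have [y E] := induced_ysym fi; rewrite E.
have y0 : algact rho (ysym N) y = 0.
  by apply: P1; rewrite -induced_map_tens -induced_map_algact -E induced_map_algact f0 linear0.
by rewrite ysym_emb algactZ algactM // -tens_algact y0 !linear0.
Qed.

End Stable.

(** * Alternating chains and cones *)

Section Simplicial.
Variables (K : fieldType) (T : finType).
Hypothesis char0 : [pchar K] =i pred0.
Local Notation chain p := {ffun p.-tuple T -> K^o}.
Implicit Types (X : {set {set T}}).

Definition reorder p (u : p.-tuple T) (s : 'S_p) : p.-tuple T :=
  [tuple tnth u (s i) | i < p].

Lemma reorderM p (u : p.-tuple T) r s : reorder (reorder u r) s = reorder u (s * r)%g.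
Proof. by apply: eq_from_tnth => i; rewrite !tnth_mktuple permM. Qed.

Lemma reorder1 p (u : p.-tuple T) : reorder u 1%g = u.
Proof. by apply: eq_from_tnth => i; rewrite tnth_mktuple perm1. Qed.

Lemma reorder_perm_eq p (u : p.-tuple T) s : perm_eq (reorder u s) u.
Proof. by apply/tuple_permP; exists s. Qed.

Definition alternating p (c : chain p) :=
  forall u s, c (reorder u s) = (-1) ^+ s * c u.

Lemma osimplex_alternating p (t : p.-tuple T) : alternating (osimplex K t).
Proof.
move=> u s; rewrite !ffunE mulr_sumr !(big_mkcond (fun r => _ == _)) /=.
rewrite (reindex_inj (mulgI s)) /=; apply: eq_bigr => r _.
rewrite -!/(reorder _ _) -reorderM.
have -> : (reorder u s == reorder (reorder t r) s) = (u == reorder t r).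
  apply/eqP/eqP => [E|-> //]; rewrite -[u]reorder1 -(mulVg s) -reorderM E.
  by rewrite reorderM mulVg reorder1.
by case: ifP => _; rewrite ?mulr0 // odd_permM signr_addb.
Qed.

Lemma osimplex_neq0 p (t u : p.-tuple T) : osimplex K t u != 0 -> perm_eq u t.
Proof.
rewrite ffunE; apply: contraR => nut; rewrite big_pred0 // => s; apply/negP => /eqP ut.
by case/negP: nut; rewrite ut; apply: reorder_perm_eq.
Qed.

Lemma osimplex_reorder p (t : p.-tuple T) s :
  osimplex K (reorder t s) = (-1) ^+ s *: osimplex K t.
Proof.
apply/ffunP=> u; rewrite !ffunE scaler_sumr !(big_mkcond (fun r => _ == _)) /=.
rewrite [RHS](reindex_inj (mulIg s)) /=; apply: eq_bigr => r _.
rewrite -!/(reorder _ _) reorderM; case: ifP => _ //.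
by rewrite odd_permM signr_addb [RHS]mulrCA -signr_addb addbb mulr1.
Qed.

Lemma osimplex_not_uniq p (t : p.-tuple T) : ~~ uniq t -> osimplex K t = 0.
Proof.
move=> nut; have /injectivePn[i [j ij tij]] : ~~ injectiveb (tnth t).
  by apply: contra nut => /injectiveP/tuple_uniqP.
have tE : reorder t (tperm i j) = t.
  apply: eq_from_tnth => k; rewrite tnth_mktuple.
  by case: tpermP => [->|->|].
apply: (eq_opp0 char0); rewrite -[in LHS]tE osimplex_reorder odd_tperm ij.
by rewrite expr1 scaleN1r.
Qed.

Definition is_simplex X p (u : p.-tuple T) := uniq u && ([set x in u] \in X).

Lemma osimplex_chain X p (t : p.-tuple T) : is_simplex X t -> osimplex K t \in chains K X p.
Proof. by move=> ts; apply/memv_span/map_f; rewrite mem_enum. Qed.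

Lemma chains_ind X p (P : chain p -> Prop) : P 0 ->
  (forall k u v, P u -> P v -> P (k *: u + v)) ->
  (forall t, is_simplex X t -> P (osimplex K t)) -> forall c, c \in chains K X p -> P c.
Proof.
move=> P0 PD Ps; apply: span_ind => // _ /mapP[t + ->].
by rewrite mem_enum => /Ps.
Qed.

Lemma is_simplex_perm X p (t u : p.-tuple T) : perm_eq u t -> is_simplex X t -> is_simplex X u.
Proof.
move=> ut /andP[tu tX]; rewrite /is_simplex (perm_uniq ut) tu.
by have -> : [set x in u] = [set x in t] by apply/setP=> x; rewrite !inE (perm_mem ut).
Qed.

(** An alternating c is the sum of all c(u) times the oriented simplex u, divided by p! because each
    simplex is met in all its orderings. *)
Lemma chainsP X p (c : chain p) :
  c \in chains K X p <-> alternating c /\ forall u, c u != 0 -> is_simplex X u.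
Proof.
split=> [|[ca cX]].
  move: c; apply: chains_ind => [|k u v [ua uX] [va vX]|t tX].
  - by split=> [u s|u]; rewrite !ffunE ?mulr0 ?eqxx.
  - split=> [w s|w]; rewrite !ffunE; first by rewrite ua va mulrDr mulrCA.
    by have [->|/uX//] := eqVneq (u w) 0; rewrite scaler0 add0r; apply: vX.
  by split=> [|u /osimplex_neq0 ut]; [exact: osimplex_alternating|exact: is_simplex_perm tX].
have p0 : p`!%:R != 0 :> K by rewrite natr_neq0 // -lt0n fact_gt0.
have -> : c = (p`!%:R : K)^-1 *: \sum_u (c u : K) *: osimplex K u.
  apply/ffunP=> w; rewrite ffunE sum_ffunE.
  rewrite (eq_bigr (fun u => \sum_(s : 'S_p | u == reorder w s^-1%g) c w)) => [|u _].
    rewrite (exchange_big_dep predT) //= (eq_bigr (fun=> c w)) => [|s _].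
      by rewrite sumr_const card_Sn -scaler_nat scalerA mulVf ?scale1r.
    by rewrite big_pred1_eq.
  rewrite !ffunE scaler_sumr; apply: eq_big => s.
    by rewrite -/(reorder u s); apply/eqP/eqP => ->; rewrite reorderM ?mulgV ?mulVg reorder1.
  by move=> /eqP->; rewrite -/(reorder u s) ca mulrC.
apply/memvZ/memv_suml => u _; have [->|/cX uX] := eqVneq (c u) 0.
  by rewrite scale0r mem0v.
exact/memvZ/osimplex_chain.
Qed.

Lemma tnth_cons_lift p (x : T) (t : p.-tuple T) i :
  tnth [tuple of x :: t] (lift ord0 i) = tnth t i.
Proof. by rewrite tnthS. Qed.

Lemma reorder_cons p (x : T) (t : p.-tuple T) s :
  reorder [tuple of x :: t] (lift_perm ord0 ord0 s) = [tuple of x :: reorder t s].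
Proof.
apply: eq_from_tnth => k; rewrite tnth_mktuple.
case: (unliftP ord0 k) => [i|] ->; first by rewrite lift_perm_lift !tnth_cons_lift tnth_mktuple.
by rewrite lift_perm_id !tnth0.
Qed.

Lemma alternating_cons p (c : chain p.+1) x t s : alternating c ->
  c [tuple of x :: reorder t s] = (-1) ^+ s * c [tuple of x :: t].
Proof. by move=> ca; rewrite -reorder_cons ca odd_lift_perm. Qed.

Lemma alternating_swap p (c : chain p.+2) x y (t : p.-tuple T) : alternating c ->
  c [tuple of x :: [tuple of y :: t]] = - c [tuple of y :: [tuple of x :: t]].
Proof.
move=> ca; pose s : 'S_p.+2 := tperm ord0 (lift ord0 ord0).
have <- : reorder [tuple of y :: [tuple of x :: t]] s = [tuple of x :: [tuple of y :: t]].
  apply: eq_from_tnth => k; rewrite tnth_mktuple /s; case: tpermP => [->|->|].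
  - by rewrite tnth_cons_lift !tnth0.
  - by rewrite tnth_cons_lift !tnth0.
  case: (unliftP ord0 k) => [i|] -> //; case: (unliftP ord0 i) => [i'|] -> // _ _.
  by rewrite !tnth_cons_lift.
by rewrite ca odd_tperm /= expr1 mulN1r.
Qed.

Definition closed_complex X := forall s s' : {set T}, s \subset s' -> s' \in X -> s \in X.

Lemma is_simplex_behead X p x (t : p.-tuple T) : closed_complex X ->
  is_simplex X [tuple of x :: t] -> is_simplex X t.
Proof.
move=> Xc /andP[/= /andP[_ ut] tX]; rewrite /is_simplex ut; apply: Xc tX.
by apply/subsetP=> y; rewrite !inE => ->; rewrite orbT.
Qed.

Lemma boundary_chain X p c : closed_complex X ->
  c \in chains K X p.+1 -> boundary K T p c \in chains K X p.
Proof.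
move=> Xc /chainsP[ca cX]; apply/chainsP; split=> [t s|t].
  by rewrite !boundaryE mulr_sumr; apply: eq_bigr => x _; exact: alternating_cons.
rewrite boundaryE; apply: contraR => nt; rewrite big1 // => x _.
by apply/eqP; apply: contraNT nt => /cX; exact: is_simplex_behead.
Qed.

(** Exchanging the two added vertices changes the sign, so the double boundary is its own
    opposite. *)
Lemma boundary_boundary X p c : c \in chains K X p.+2 ->
  boundary K T p (boundary K T p.+1 c) = 0.
Proof.
move=> /chainsP[ca _]; apply: (eq_opp0 char0); apply/ffunP=> t; rewrite [RHS]ffunE.
have -> : boundary K T p (boundary K T p.+1 c) t =
    \sum_x \sum_y c [tuple of y :: [tuple of x :: t]].
  by rewrite boundaryE; apply: eq_bigr => x _; rewrite boundaryE.
rewrite [LHS]exchange_big -sumrN; apply: eq_bigr => x _; rewrite -sumrN.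
by apply: eq_bigr => y _; exact: alternating_swap.
Qed.

Lemma boundaries_cycles X p : closed_complex X -> (boundaries K X p <= cycles K X p)%VS.
Proof.
move=> Xc; apply/subvP => _ /memv_imgP[c cX ->].
case: p c cX => [|p] c cX /=; first exact: boundary_chain.
by rewrite memv_cap boundary_chain //= memv_ker (boundary_boundary cX).
Qed.

Definition face p (u : p.+1.-tuple T) (i : 'I_p.+1) : p.-tuple T :=
  [tuple tnth u (lift i k) | k < p].

(** The join with v, written for alternating functions as an expansion along the position of v; on
    oriented simplices it puts v in front ([cone_osimplex]). *)
Definition cone_fun (v : T) p (c : chain p) : chain p.+1 :=
  [ffun u : p.+1.-tuple T => \sum_(i < p.+1) (-1) ^+ i * ((tnth u i == v)%:R * c (face u i))].

Lemma cone_is_linear (v : T) p : linear (@cone_fun v p).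
Proof.
move=> k c c'; apply/ffunP=> u; rewrite !ffunE scaler_sumr -big_split /=.
by apply: eq_bigr => i _; rewrite !ffunE !mulrDr !scalerAr.
Qed.
HB.instance Definition _ (v : T) p :=
  GRing.isLinear.Build K _ _ _ (@cone_fun v p) (@cone_is_linear v p).

Definition cone (v : T) p : 'Hom(chain p, chain p.+1) := linfun (@cone_fun v p).

Lemma coneE v p (c : chain p) u :
  cone v p c u = \sum_(i < p.+1) (-1) ^+ i * ((tnth u i == v)%:R * c (face u i)).
Proof. by rewrite lfunE ffunE. Qed.

(** A permutation amounts to the point i sent to 0 and a permutation of the remaining points. *)
Lemma lift_perm_bij p : bijective (fun x : 'I_p.+1 * 'S_p => lift_perm x.1 ord0 x.2).
Proof.
apply: inj_card_bij => [[i r] [j s] /= E|]; last first.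
  by rewrite card_prod !card_Sn card_ord factS.
have ij : i = j.
  by apply: (@perm_inj _ (lift_perm i ord0 r)); rewrite lift_perm_id E lift_perm_id.
subst j; congr (_, _); apply/permP=> k; apply: (@lift_inj _ ord0).
by rewrite -!(lift_perm_lift i) E.
Qed.

Lemma cone_osimplex v p (t : p.-tuple T) :
  cone v p (osimplex K t) = osimplex K [tuple of v :: t].
Proof.
apply/ffunP=> u; rewrite coneE [RHS]ffunE [RHS](big_mkcond (fun s => _ == _)) /=.
rewrite (reindex _ (onW_bij _ (lift_perm_bij p))) /=.
rewrite -(pair_bigA _ (fun i s => if u == reorder [tuple of v :: t] (lift_perm i ord0 s)
   then (-1) ^+ (lift_perm i ord0 s) else 0)) /=.
apply: eq_bigr => i _; rewrite ffunE (big_mkcond (fun s => _ == _)) /= !mulr_sumr.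
apply: eq_bigr => s _; rewrite -/(reorder _ _) odd_lift_perm addbF signr_addb signr_odd.
have -> : (u == reorder [tuple of v :: t] (lift_perm i ord0 s)) =
          (tnth u i == v) && (face u i == reorder t s).
  apply/eqP/andP => [->|[/eqP ui /eqP ur]].
    rewrite tnth_mktuple lift_perm_id tnth0 eqxx; split=> //; apply/eqP.
    by apply: eq_from_tnth => k; rewrite !tnth_mktuple lift_perm_lift tnth_cons_lift.
  apply: eq_from_tnth => k; rewrite tnth_mktuple; case: (unliftP i k) => [k'|] ->.
    have := congr1 (fun w : p.-tuple T => tnth w k') ur.
    by rewrite !tnth_mktuple lift_perm_lift tnth_cons_lift.
  by rewrite lift_perm_id tnth0.
by case: (tnth u i == v); case: eqP => _; rewrite /= ?mul1r ?mul0r ?mulr0.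
Qed.

Lemma face0 p x (t : p.-tuple T) : face [tuple of x :: t] ord0 = t.
Proof. by apply: eq_from_tnth => k; rewrite tnth_mktuple tnth_cons_lift. Qed.

Lemma face_lift p x (t : p.+1.-tuple T) i :
  face [tuple of x :: t] (lift ord0 i) = [tuple of x :: face t i].
Proof.
apply: eq_from_tnth => k; rewrite tnth_mktuple; case: (unliftP ord0 k) => [k'|] ->.
  rewrite tnth_cons_lift tnth_mktuple -[in RHS](tnth_cons_lift x).
  by congr (tnth _ _); apply: val_inj; rewrite /= /bump /= !add1n ltnS addnS.
have -> : lift (lift ord0 i) ord0 = ord0 by apply: val_inj.
by rewrite !tnth0.
Qed.

Lemma boundary_cone0 v (c : chain 0) : boundary K T 0 (cone v 0 c) = c.
Proof.
apply/ffunP=> t; rewrite boundaryE (bigD1 v) //= big1 => [|x xv]; rewrite coneE big_ord1.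
  by rewrite tnth0 eqxx face0 expr0 !mul1r addr0.
by rewrite tnth0 (negPf xv) mul0r mulr0.
Qed.

(** The homotopy formula: the term where v is the added vertex gives c, and in the others removing
    one more place shifts the sign of the expansion. *)
Lemma boundary_cone v p (c : chain p.+1) :
  boundary K T p.+1 (cone v p.+1 c) = c - cone v p (boundary K T p c).
Proof.
apply/ffunP=> t; rewrite boundaryE !ffunE coneE.
under eq_bigr do rewrite coneE big_ord_recl; rewrite big_split /=; congr (_ + _).
  rewrite (bigD1 v) //= big1 => [|x xv]; rewrite tnth0 ?(negPf xv) ?mul0r ?mulr0 //.
  by rewrite eqxx face0 expr0 !mul1r addr0.
rewrite exchange_big -sumrN; apply: eq_bigr => i _.
rewrite boundaryE !mulr_sumr -sumrN; apply: eq_bigr => x _.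
by rewrite tnth_cons_lift face_lift /bump /= add1n exprS mulN1r mulNr.
Qed.

End Simplicial.

(** * Chains of packing complexes *)

Section Generation.
Variables (K : fieldType) (J0 : finType) (d : J0 -> nat).
Variables (I : {set J0}) (A : J0 -> finType) (p : nat).
Hypothesis char0 : [pchar K] =i pred0.
Local Notation J := {j | j \notin I}.
Local Notation T B := (subset_tuple (@glue J0 I A B)).
Local Notation F := (restriction (tuple_mod K J0 p) I A).
Local Notation C B := (chains K (packing d (glue A B)) p).

Local Notation simplex t := (is_simplex (packing d (glue A _)) t).

Definition unused B (t : p.-tuple (T B)) j (x : B j) := letter t x == [ffun=> false].

Lemma unusedP B (t : p.-tuple (T B)) j (x : B j) :
  reflect (forall i, gin A x \notin tnth t i (val j)) (unused t x).
Proof.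
apply: (iffP eqP) => [/ffunP tx i|tx]; first by have := tx i; rewrite !ffunE => ->.
by apply/ffunP=> i; rewrite !ffunE; apply/negbTE.
Qed.

Lemma simplex_card B (t : p.-tuple (T B)) i j : simplex t -> #|tnth t i j| = d j.
Proof.
case/andP=> _; rewrite inE => /andP[/forall_inP/(_ (tnth t i)) + _].
by rewrite inE mem_tnth => /(_ isT)/forallP/(_ j)/eqP.
Qed.

Lemma simplex_disj B (t : p.-tuple (T B)) i i' j : simplex t -> i != i' ->
  [disjoint tnth t i j & tnth t i' j].
Proof.
case/andP=> ut; rewrite inE => /andP[_ /forall_inP/(_ (tnth t i))].
rewrite inE mem_tnth => /(_ isT)/forall_inP/(_ (tnth t i')).
rewrite inE mem_tnth => /(_ isT)/implyP disj ii'.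
apply: (forallP (disj _)); apply: contra ii' => /eqP tt.
by apply/eqP; apply: (tuple_uniqP t ut).
Qed.

Lemma card_used B (t : p.-tuple (T B)) (j : J) : simplex t ->
  (#|[set x : B j | ~~ unused t x]| <= p * d (val j))%N.
Proof.
move=> ts; rewrite -(card_imset _ (@gin_inj _ _ A _ j)).
apply: (@leq_trans #|\bigcup_i tnth t i (val j)|).
  apply/subset_leq_card/subsetP => _ /imsetP[x + ->]; rewrite inE => /unusedP nx.
  apply/bigcupP; apply/exists_inP; apply: contraT => /existsPn H.
  by case: nx => i; have := H i.
apply: (@leq_trans (\sum_i #|tnth t i (val j)|)).
  elim/big_rec2: _ => [|i m U _ Um]; first by rewrite cards0.
  by apply: leq_trans (leq_card_setU _ _).1 _; rewrite leq_add2l.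
by rewrite (eq_bigr (fun=> d (val j))) ?sum_nat_const ?card_ord // => i _; rewrite simplex_card.
Qed.

(** The p vertices have pairwise disjoint j-th components, of d_j elements each. *)
Lemma simplex_bound B (t : p.-tuple (T B)) j : simplex t -> (p * d j <= #|glue A B j|)%N.
Proof.
move=> ts; have <- : (\sum_(i < p) #|tnth t i j| = p * d j)%N.
  by rewrite (eq_bigr (fun=> d j)) ?sum_nat_const ?card_ord // => i _; rewrite simplex_card.
under eq_bigr do rewrite -sum1_card big_mkcond.
rewrite exchange_big -sum1_card leq_sum //= => x _.
rewrite -big_mkcond sum1_card; apply/card_le1_eqP => i i' ii ii'.
have {}ii : x \in tnth t i j := ii; have {}ii' : x \in tnth t i' j := ii'.
apply/eqP; apply: contraT => /(simplex_disj j ts)/pred0P/(_ x).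
by rewrite /= ii ii'.
Qed.

Section Action.
Variables (N : J -> nat) (row col : J -> nat -> nat).
Local Notation actF := (algact (@sym_action K J F N)).
Implicit Types (t : p.-tuple (T (ordJ N))).

Lemma sym_action_osimplex s t :
  sym_action F s (osimplex K t) = osimplex K (tuple_perm s t).
Proof. exact: F_osimplex. Qed.

Lemma unused_tuple_perm s t j (x : 'I_(N j)) : unused (tuple_perm s t) (s j x) = unused t x.
Proof. by rewrite /unused letter_tuple_perm. Qed.

Lemma simplex_tuple_perm s t : simplex t -> simplex (tuple_perm s t).
Proof.
case/andP=> ut tp; apply/andP; split.
  by rewrite map_inj_uniq //; exact: subset_map_inj.
have -> : [set a in tuple_perm s t] = subset_map (glue_hom A (perm_hom s)) @: [set a in t].
  apply/setP=> a; rewrite inE; apply/mapP/imsetP => -[b bt ->]; exists b => //.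
    by rewrite inE.
  by rewrite inE in bt.
exact: subset_map_packing.
Qed.

(** The swap of y and z fixes t, as both boxes are empty, but acts by -1 through the column
    antisymmetrizer. *)
Lemma clash_alt_eq0 t j (y z : 'I_(N j)) : y != z -> col j y = col j z ->
  unused t y -> unused t z -> actF (alt K N col) (osimplex K t) = 0.
Proof.
move=> yz cyz /eqP ty /eqP tz; pose s := swapJ y z.
have st : tuple_perm s t = t.
  apply: tuple_perm_eq => // k x; have [kj|kj] := eqVneq k j; last first.
    by rewrite swapJ_out // perm1.
  by subst k; rewrite swapJ_in; case: tpermP => [->|->|_ _] //; rewrite ty tz.
apply: (eq_opp0 char0); rewrite -[in LHS]st -sym_action_osimplex -algact_gdelta.
rewrite -algactM; last exact: sym_action_rep.
by rewrite alt_stab_l ?swapJ_stab // sgn_swapJ // scaleN1r -[RHS]scaleN1r -algactZ scaleN1r.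
Qed.

Lemma swap_conv_alt j (y z : 'I_(N j)) :
  (forall x : 'I_(N j), col j y = col j x -> y = x) ->
  (forall x : 'I_(N j), col j z = col j x -> z = x) ->
  gdelta K (swapJ y z) ** alt K N col = alt K N col ** gdelta K (swapJ y z).
Proof.
move=> y1 z1; rewrite altE big_mkcond conv_sumr conv_suml; apply: eq_bigr => q _.
case: stabP => [qC|_]; last by rewrite conv0l /conv algact0.
rewrite convZr convZl !gdeltaM swapJ_conj.
by rewrite -(y1 (q j y)) ?qC // -(z1 (q j z)) ?qC.
Qed.

(** The column group fixes boxes that are alone in their columns, so the swap commutes with b; being
    in the row group, it is absorbed by a. *)
Lemma swap_alt_sym t j (y z : 'I_(N j)) :
  (forall x : 'I_(N j), col j y = col j x -> y = x) ->
  (forall x : 'I_(N j), col j z = col j x -> z = x) -> row j y = row j z ->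
  actF (alt K N col ** sym K N row) (osimplex K t) =
  actF (alt K N col ** sym K N row) (osimplex K (tuple_perm (swapJ y z) t)).
Proof.
move=> y1 z1 ryz; rewrite -sym_action_osimplex -algact_gdelta -algactM; last first.
  exact: sym_action_rep.
by rewrite convA swap_conv_alt // -convA sym_stab_l // swapJ_stab.
Qed.

End Action.

Section Extension.
Variables (N N' : J -> nat) (le : leJ N N') (row col : J -> nat -> nat).
Local Notation actF := (algact (@sym_action K J F N')).
Implicit Types (t : p.-tuple (T (ordJ N'))).

(* Enough room: unless t is killed by the column antisymmetrizer, a used box *)
(* outside N can be exchanged with an unused box of N.                       *)
Definition roomy := forall t, simplex t ->
  (exists j, exists y z : 'I_(N' j),
     [/\ y != z, col j y = col j z, unused t y & unused t z]) \/
  forall j (x : 'I_(N' j)), (N j <= x)%N -> ~~ unused t x ->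
    exists y : 'I_(N' j), [/\ (y < N j)%N, unused t y, row j y = 0%N &
      forall z : 'I_(N' j), col j y = col j z -> y = z].

Hypothesis new : first_row_ext N N' row col.
Hypothesis room : roomy.

Lemma tuple_incl_used t : simplex t ->
  (forall j (x : 'I_(N' j)), (N j <= x)%N -> unused t x) ->
  exists2 t0, simplex t0 & t = tuple_incl le t0.
Proof.
move=> ts tu; pose f := glue_hom A (incl_hom le).
pose pre (a : T (ordJ N')) : T (ordJ N) := [ffun j => f j @^-1: a j].
have preK i : subset_map f (pre (tnth t i)) = tnth t i.
  apply/ffunP=> j; rewrite !ffunE; apply/setP=> y.
  apply/imsetP/idP => [[z + ->]|yt]; first by rewrite inE.
  suff [z yz] : exists z, y = f j z by exists z; rewrite // inE -yz.
  have [jI|jI] := boolP (j \in I); first exact: glue_fun_out_surj.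
  have [x yx] := @gin_surj _ _ _ _ (exist _ j jI) y; subst y.
  have [[x' xx']|Nx] := ord_widenP (le (exist _ j jI)) x.
    by exists (gin A x'); rewrite xx'; exact: (esym (glue_fun_gin A (incl_hom le) x')).
  by have /unusedP/(_ i) := tu _ x Nx; rewrite yt.
have tE : t = tuple_incl le [tuple of map pre t].
  by apply: eq_from_tnth => i; rewrite !tnth_map preK.
exists [tuple of map pre t] => //; case/andP: ts => ut tp; apply/andP; split.
  by move: ut; rewrite {1}tE => /map_uniq.
have fI j : injective (f j) by exact: glue_fun_inj.
move: tp; rewrite {1}tE !inE => /andP[/forall_inP sz /forall_inP dj].
apply/andP; split.
  apply/forall_inP=> a at_; apply/forallP=> j.
  have := sz (subset_map f a); rewrite inE map_f; last by rewrite inE in at_.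
  by move=> /(_ isT)/forallP/(_ j); rewrite ffunE card_imset.
apply/forall_inP=> a at_; apply/forall_inP=> b bt; apply/implyP=> ab.
rewrite !inE in at_ bt.
have := dj (subset_map f a); rewrite inE map_f // => /(_ isT)/forall_inP/(_ (subset_map f b)).
rewrite inE map_f // => /(_ isT)/implyP; rewrite (inj_eq (@subset_map_inj _ _ _ f)).
move=> /(_ ab)/forallP dab; apply/forallP=> j; have := dab j; rewrite !ffunE.
by rewrite imset_disjoint //; exact: in2W.
Qed.

Lemma chain_generated c : c \in C (ordJ N') ->
  exists2 c0, c0 \in C (ordJ N) &
    actF (alt K N' col ** sym K N' row) c =
    actF (alt K N' col ** sym K N' row) (FImap F (incl_hom le) c0).
Proof.
move: c; apply: chains_ind => [|k u v [u0 u0C uE] [v0 v0C vE]|t].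
- by exists 0; rewrite ?mem0v // !linear0.
- exists (k *: u0 + v0); first by rewrite memvD // memvZ.
  by rewrite !linearP /= uE vE.
pose used t := [set z : {j & 'I_(N' j)} | (N (tag z) <= tagged z)%N & ~~ unused t (tagged z)].
have [n] := ubnP #|used t|; elim: n t => // n IH t /ltnSE tn ts.
have [[j [y [z [yz cyz ty tz]]]]|swap] := room ts.
  exists 0; first exact: mem0v.
  rewrite algactM; last exact: sym_action_rep.
  by rewrite (clash_alt_eq0 yz cyz ty tz) !linear0.
have [/pred0P u0|/pred0Pn[[j x]]] := boolP (pred0b [in used t]).
  have [j x Nx|t0 t0s ->] := tuple_incl_used ts.
    by have := u0 (Tagged (fun j => 'I_(N' j)) x); rewrite !inE Nx => /negbFE.
  by exists (osimplex K t0); rewrite ?osimplex_chain // F_osimplex.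
rewrite !inE /= => /andP[Nx tx].
have [y [yN ty ry y1]] := swap j x Nx tx.
have [rx x1] := new Nx.
rewrite (swap_alt_sym t x1 y1) ?rx ?ry //.
apply: IH; last exact: simplex_tuple_perm.
apply: leq_trans tn; apply: proper_card; apply/properP; split; last first.
  exists (Tagged (fun j => 'I_(N' j)) x); rewrite inE /= Nx //= negbK.
  by rewrite -[x in unused _ x](tpermR x y) -[tperm x y](swapJ_in x y) unused_tuple_perm.
apply/subsetP=> -[k z]; rewrite !inE /= => /andP[Nz tz]; rewrite Nz.
apply: contra tz => tz; have [kj|kj] := eqVneq k j; last first.
  have -> : z = swapJ x y k z by rewrite swapJ_out // perm1.
  by rewrite unused_tuple_perm.
subst k; have [->|zx] := eqVneq z x.
  by rewrite -[x in unused _ x](tpermR x y) -[tperm x y](swapJ_in x y) unused_tuple_perm.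
have zy : z != y by apply: contraTneq Nz => ->; rewrite -ltnNge.
have -> : z = swapJ x y j z by rewrite swapJ_in tpermD // eq_sym.
by rewrite unused_tuple_perm.
Qed.

End Extension.

End Generation.

Section Room.
Variables (J0 : finType) (d : J0 -> nat).
Variables (I : {set J0}) (A : J0 -> finType) (p : nat).
Local Notation J := {j | j \notin I}.
Local Notation T B := (subset_tuple (@glue J0 I A B)).
Local Notation simplex t := (is_simplex (packing d (glue A _)) t).
Variables (la : J -> seq nat) (N N' : J -> nat) (le : leJ N N').
Hypothesis laP : forall j, is_partition (la j).
Hypothesis laN' : pad_defined la N'.
Local Notation col := (pad_col la).
Implicit Types (t : p.-tuple (T (ordJ N'))).

Definition clash t := exists j, exists y z : 'I_(N' j),
     [/\ y != z, col j y = col j z, unused t y & unused t z].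

Lemma clash_dec t : clash t \/ forall j, {in [set x : 'I_(N' j) | unused t x] &,
  injective (fun x : 'I_(N' j) => col j x)}.
Proof.
have [/existsP[j /existsP[y /existsP[z /and4P[yz /eqP cyz ty tz]]]]|noclash] :=
    boolP [exists j, exists y : 'I_(N' j), exists z : 'I_(N' j),
      [&& y != z, col j y == col j z, unused t y & unused t z]].
  by left; exists j, y, z.
right=> j y z; rewrite !inE => ty tz cyz; apply/eqP; move: noclash; apply: contraNT => yz.
apply/existsP; exists j; apply/existsP; exists y; apply/existsP; exists z.
by rewrite yz cyz eqxx ty tz.
Qed.

Lemma card_unused t (j : J) : simplex t ->
  (N' j <= p * d (val j) + #|[set x : 'I_(N' j) | unused t x]|)%N.
Proof.
move=> ts; have /= := cardsC [set x : 'I_(N' j) | unused t x].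
rewrite card_ord => {1}<-; rewrite addnC leq_add2r.
have -> : ~: [set x : 'I_(N' j) | unused t x] = [set x : ordJ N' j | ~~ unused t x].
  by apply/setP=> x; rewrite !inE.
exact: card_used.
Qed.

Lemma pad_size t j : simplex t ->
  {in [set x : 'I_(N' j) | unused t x] &, injective (fun x : 'I_(N' j) => col j x)} ->
  (sumn (la j) <= p * d (val j))%N.
Proof.
move=> ts ci; have sN := sumn_le laN' j.
have le_card : (#|[set x : 'I_(N' j) | unused t x]| <= N' j - sumn (la j))%N.
  apply: leq_card_inj ci _ => x _; case: (ltnP x (sumn (la j))) => xs.
    apply: leq_trans (pad_col_head laP xs) _.
    by rewrite leq_subRL // (pad_definedP laN').
  by rewrite /pad_col (ltnNge x) xs /= ltn_sub2r // (leq_ltn_trans xs).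
have := card_unused j ts; rewrite -(leq_add2r (sumn (la j))) -addnA => h.
have {}h := leq_trans h (leq_add (leqnn _) (leq_add le_card (leqnn _))).
by rewrite subnK // addnC leq_add2r in h.
Qed.

Lemma head_le_sumn (s : seq nat) : (head 0 s <= sumn s)%N.
Proof. by case: s => //= *; rewrite leq_addr. Qed.

Hypothesis big : forall t, simplex t -> forall j, (2 * p * d (val j) <= N j)%N.

(** Without a clash, [pad_size] gives |la| + la_1 <= 2 |la| <= 2 p d_j <= N_j, and la[N] is
    defined. *)
Lemma pad_undefined_clash t : ~~ pad_defined la N -> simplex t -> clash t.
Proof.
move=> ndef ts; have [//|ci] := clash_dec t; case/negP: ndef; apply/forallP=> j.
have h := pad_size ts (ci j); apply: leq_trans (big ts j).
by rewrite -mulnA mul2n -addnn leq_add // (leq_trans (head_le_sumn _)).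
Qed.

Hypothesis laN : pad_defined la N.

Lemma pad_roomy : @roomy _ d I A p N N' (pad_row la) (pad_col la).
Proof.
move=> t ts; have [|ci] := clash_dec t; [by left|right].
move=> j x Nx tx.
have [/existsP[y /and4P[yN ty yh yh']]|no] := boolP [exists y : 'I_(N' j),
   [&& (y < N j)%N, unused t y, (sumn (la j) + head 0 (la j) <= y)%N & true]].
  exists y.
  (* At the least size for which la[N0] is defined, y counts as an added box: it is in the first row
     and alone in its column. *)
  pose N0 k := (sumn (la k) + head 0 (la k))%N.
  have laN0 : pad_defined la N0 by apply/forallP=> k.
  by have [? ?] := pad_first_row_ext laP laN0 yh; split.
have h := pad_size ts (ci j); have ha := head_le_sumn (la j).
exfalso; pose E := [set x : 'I_(N' j) | unused t x].
have E1 : (#|E :&: [set z : 'I_(N' j) | (z < N j)%N]| <= head 0 (la j))%N.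
  apply: (@leq_card_inj _ _ (fun z : 'I_(N' j) => col j z)) => [y z|y].
    by rewrite !in_setI => /andP[yE _] /andP[zE _]; apply: ci.
  rewrite !inE => /andP[ty yN].
  case: (ltnP y (sumn (la j))) => ys; first exact: pad_col_head.
  rewrite /pad_col (ltnNge y) ys /= ltn_subLR // ltnNge; apply: contra no => yh.
  by apply/existsP; exists y; rewrite ty yN yh.
have E2 : (#|E :\: [set z : 'I_(N' j) | (z < N j)%N]| < N' j - N j)%N.
  apply: (@leq_trans #|[set z : 'I_(N' j) | (N j <= z)%N]|).
    apply: proper_card; apply/properP; split.
      by apply/subsetP=> y; rewrite !inE -leqNgt => /andP[].
    by exists x; rewrite !inE ?Nx ?(negPf tx) ?andbF.
  apply: (@leq_card_inj _ _ (fun z : 'I_(N' j) => z - N j)%N) => [y z|y]; rewrite !inE.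
    by move=> yN zN e; apply: val_inj; rewrite /= -(subnK yN) -(subnK zN) e.
  by move=> yN; rewrite ltn_sub2r // (leq_ltn_trans yN).
have := card_unused j ts; rewrite -/E -(cardsID [set z : 'I_(N' j) | (z < N j)%N] E).
have := big ts j; have := le j; have := big ts j.
move: E1 E2 h ha; set e1 := #|_|; set e2 := #|_|; set D := (p * _)%N.
rewrite -mulnA -/D => e1h e2N hD hh DN NN' _ N'D.
lia.
Qed.

End Room.

(** * Acyclicity *)

Definition first_elts (T : finType) (A : {set T}) n := [set x in take n (enum A)].

Lemma first_elts_sub (T : finType) (A : {set T}) n : first_elts A n \subset A.
Proof. by apply/subsetP=> x; rewrite inE => /mem_take; rewrite mem_enum. Qed.

Lemma card_first_elts (T : finType) (A : {set T}) n :
  (n <= #|A|)%N -> #|first_elts A n| = n.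
Proof.
move=> nA; have /card_uniqP : uniq (take n (enum A)) by rewrite take_uniq ?enum_uniq.
by rewrite cardsE size_takel // -cardE.
Qed.

Section Acyclic.
Variables (K : fieldType) (J : finType) (d : J -> nat) (A : J -> finType).
Hypothesis char0 : [pchar K] =i pred0.
Local Notation T := (subset_tuple A).
Implicit Types (a b v w : T) (W : {set T}) (M : forall j, {set A j}).

Definition vertex a := [forall j, #|a j| == d j].
Definition apart a b := [forall j, [disjoint a j & b j]].

Definition packing_on W : {set {set T}} := [set s in packing d A | s \subset W].

Lemma apart_sym a b : apart a b = apart b a.
Proof. by apply: eq_forallb => j; rewrite disjoint_sym. Qed.

Lemma packingP (s : {set T}) : reflect ((forall a, a \in s -> vertex a) /\
    (forall a b, a \in s -> b \in s -> a != b -> apart a b)) (s \in packing d A).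
Proof.
rewrite inE; apply: (iffP andP) => [[/forall_inP sv /forall_inP sd]|[sv sd]].
  split=> // a b sa sb; exact: (implyP (forall_inP (sd a sa) b sb)).
split; first exact/forall_inP.
by apply/forall_inP=> a sa; apply/forall_inP=> b sb; apply/implyP; apply: sd.
Qed.

Lemma packing_onE W s : (s \in packing_on W) = (s \in packing d A) && (s \subset W).
Proof. by rewrite [LHS]in_set. Qed.

Lemma packing_on_closed W : closed_complex (packing_on W).
Proof.
move=> s s' /subsetP ss'; rewrite !packing_onE => /andP[/packingP[sv sd] sW].
apply/andP; split; last by apply: subset_trans sW; apply/subsetP.
apply/packingP; split=> [a /ss'|a b /ss' sa /ss' sb]; [exact: sv|exact: sd].
Qed.

Lemma simplexP W p (t : p.-tuple T) : reflect
  [/\ uniq t, {in t, forall a, (a \in W) && vertex a} & {in t &, forall a b, a != b -> apart a b}]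
  (is_simplex (packing_on W) t).
Proof.
rewrite /is_simplex packing_onE; apply: (iffP and3P) => [[ut /packingP[tv td] /subsetP tW]|[ut tW td]].
  split=> // [a at_|a b at_ bt]; last by apply: td; rewrite inE.
  by rewrite tv ?tW ?inE.
split=> //; last by apply/subsetP=> a; rewrite inE => /tW/andP[].
by apply/packingP; split=> [a|a b]; rewrite !inE; [move=> /tW/andP[]|exact: td].
Qed.

Lemma simplex_cons W p v (t : p.-tuple T) : reflect
  [/\ (v \in W) && vertex v, v \notin t, {in t, forall a, apart v a} & is_simplex (packing_on W) t]
  (is_simplex (packing_on W) [tuple of v :: t]).
Proof.
apply: (iffP idP) => [vts|[vW vt va /simplexP[ut tW td]]].
  have ts := is_simplex_behead (@packing_on_closed W) vts.
  have /simplexP[/= /andP[vt ut] tW td] := vts; split=> //.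
    by apply: tW; rewrite inE eqxx.
  move=> a at_; apply: td; rewrite ?inE ?eqxx ?at_ ?orbT //.
  by apply: contraNneq vt => ->.
apply/simplexP; split=> [|a|a b]; rewrite ?inE /=.
- by rewrite vt.
- by case/predU1P => [->|/tW].
case/predU1P => [->|at_]; case/predU1P => [->|bt]; rewrite ?eqxx //.
- by move=> _; apply: va.
- by move=> _; rewrite apart_sym; apply: va.
exact: td.
Qed.

Lemma chains_on_sub W W' p c : W \subset W' -> c \in chains K (packing_on W) p ->
  c \in chains K (packing_on W') p.
Proof.
move=> /subsetP WW' /(chainsP char0)[ca cW]; apply/(chainsP char0); split=> // u /cW/simplexP[uu uW ud].
by apply/simplexP; split=> // a /uW/andP[/WW'-> ->].
Qed.

Lemma cycles_chains (X : {set {set T}}) p c : c \in cycles K X p -> c \in chains K X p.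
Proof. by case: p c => [|p] c //=; rewrite memv_cap => /andP[]. Qed.

Lemma cone_chain W W' v p (c : {ffun p.-tuple T -> K^o}) :
  W' \subset W -> v \in W -> vertex v ->
  (forall a, a \in W' -> vertex a -> v = a \/ apart v a) ->
  c \in chains K (packing_on W') p -> cone K v p c \in chains K (packing_on W) p.+1.
Proof.
move=> /subsetP W'W vW vv va; move: c; apply: chains_ind => [|k x y xC yC|t ts].
- by rewrite linear0 mem0v.
- by rewrite linearP memvD // memvZ.
rewrite cone_osimplex; have [ut|nut] := boolP (uniq [tuple of v :: t]); last first.
  by rewrite osimplex_not_uniq // mem0v.
have /simplexP[_ tW' td] := ts; have /= /andP[vt _] := ut.
apply/osimplex_chain/simplex_cons; split=> //; first by rewrite vW.
  move=> a at_; have /andP[aW' av] := tW' a at_; have [va'|//] := va a aW' av.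
  by case/negP: vt; rewrite va'.
have /simplexP[ut' _ _] := ts.
by apply/simplexP; split=> // a /tW'/andP[/W'W-> ->].
Qed.

Definition touching v W := [set w in W | [&& w != v, vertex w & ~~ apart v w]].

(* Remove from the support of a cycle, one by one, the vertices that touch a *)
(* fixed vertex v: the link of such a vertex is acyclic by induction.  Then  *)
(* the cone with apex v kills what remains.                                  *)
Lemma boundaries_on_sub W W' p : W \subset W' ->
  (boundaries K (packing_on W) p <= boundaries K (packing_on W') p)%VS.
Proof. by move=> WW'; apply: limgS; apply/subvP => c; apply: chains_on_sub. Qed.

(** The part of c on the simplices through w, read as a chain on the link of w. *)
Lemma link_chain W w p (c : {ffun p.+1.-tuple T -> K^o}) : c \in chains K (packing_on W) p.+1 ->
  [ffun t : p.-tuple T => c [tuple of w :: t]] \in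
    chains K (packing_on [set u in W | apart w u]) p.
Proof.
move=> /(chainsP char0)[ca cW]; apply/(chainsP char0); split=> [t s|t]; rewrite !ffunE.
  exact: alternating_cons.
move=> /cW/simplex_cons[_ _ wt /simplexP[ut tW td]]; apply/simplexP; split=> // a at_.
by have /andP[aW ->] := tW a at_; rewrite inE aW wt.
Qed.

Lemma link_cycle W w p (c : {ffun p.+1.-tuple T -> K^o}) : c \in cycles K (packing_on W) p.+1 ->
  [ffun t : p.-tuple T => c [tuple of w :: t]] \in
    cycles K (packing_on [set u in W | apart w u]) p.
Proof.
move=> cZ; have cC := cycles_chains cZ; have lC := link_chain w cC.
case: p c cZ cC lC => [|p] c //= cZ cC lC; rewrite memv_cap lC memv_ker.
have [ca _] := (chainsP char0 _ _).1 cC.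
move: cZ; rewrite memv_cap memv_ker cC /= => /eqP c0.
apply/eqP/ffunP=> t; rewrite boundaryE [RHS]ffunE.
have := congr1 (fun f : {ffun p.+1.-tuple T -> K^o} => - f [tuple of w :: t]) c0.
rewrite boundaryE -sumrN ffunE oppr0; apply: etrans; apply: eq_bigr => x _.
by rewrite ffunE -alternating_swap.
Qed.

Lemma alternating_front p (c : {ffun p.+1.-tuple T -> K^o}) w (u : p.+1.-tuple T) :
  alternating c -> (forall t : p.-tuple T, c [tuple of w :: t] = 0) -> w \in u -> c u = 0.
Proof.
move=> ca cw /tnthP[i wi]; pose s : 'S_p.+1 := tperm ord0 i.
have E := ca u s; have ws : thead (reorder u s) = w.
  by rewrite /thead tnth_mktuple tpermL wi.
move: E; rewrite (tuple_eta (reorder u s)) ws cw => /esym/eqP.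
by rewrite mulf_eq0 signr_eq0 /= => /eqP.
Qed.

(** M is a reserve: all vertices with components in M belong to W. Passing to the link of w removes
    v and w from the reserve, that is at most 2 d_j elements, and lowers p by one; the last d_j
    elements provide an apex for p = 0. *)
Lemma packing_acyclic p W M : (forall a, vertex a -> (forall j, a j \subset M j) -> a \in W) ->
  (forall j, 2 * p * d j + d j <= #|M j|)%N ->
  (cycles K (packing_on W) p <= boundaries K (packing_on W) p)%VS.
Proof.
elim: p W M => [|p IH] W M MW dM.
  pose v : T := [ffun j => first_elts (M j) (d j)].
  have vv : vertex v.
    by apply/forallP=> j; rewrite ffunE card_first_elts // (leq_trans _ (dM j)).
  have vM j : v j \subset M j by rewrite ffunE first_elts_sub.
  apply/subvP => c /= cC; rewrite -(boundary_cone0 v c) memv_img //.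
  apply: (cone_chain (W' := set0)) => //.
  - exact: sub0set.
  - exact: MW.
  - by move=> a; rewrite inE.
  move/(chainsP char0): cC => [ca cX]; apply/(chainsP char0); split=> // u /cX/simplexP[uu uW ud].
  by apply/simplexP; split=> // a; rewrite [u]tuple0.
pose v : T := [ffun j => first_elts (M j) (d j)].
have vM j : v j \subset M j by rewrite ffunE first_elts_sub.
have cv j : #|v j| = d j by rewrite ffunE card_first_elts // (leq_trans _ (dM j)) // leq_addl.
have vv : vertex v by apply/forallP=> j; rewrite cv.
have : v \in W by exact: MW.
(* While vertices touching v are removed from W, only v and the vertices of M away from v have to
   stay; the inner induction keeps just this. *)
have : forall a, vertex a -> (forall j, a j \subset M j :\: v j) -> a \in W.
  by move=> a av aM; apply: MW => // j; apply: subset_trans (aM j) (subsetDl _ _).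
have [n] := ubnP #|touching v W|; elim: n W {MW} => // n IHn W /ltnSE le_n MW vW.
apply/subvP => c cZ; have cC := cycles_chains cZ.
have c0 : boundary K T p c = 0.
  by move: cZ; rewrite /= memv_cap memv_ker => /andP[_ /eqP].
have [T0|[w]] := set_0Vmem (touching v W).
  rewrite -[c](addrK (- cone K v p (boundary K T p c))) opprK.
  rewrite -boundary_cone c0 linear0 addr0 memv_img //.
  apply: (cone_chain (W' := W)) => // a aW av; have [->|va] := eqVneq v a; [by left|right].
  apply: contraT => nva; have : a \in touching v W by rewrite inE aW eq_sym va av.
  by rewrite T0 inE.
rewrite inE => /and3P[wW wv /andP[vw nvw]].
pose W' := [set u in W | apart w u].
pose c' : {ffun p.-tuple T -> K^o} := [ffun t : p.-tuple T => c [tuple of w :: t]].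
have c'Z : c' \in cycles K (packing_on W') p by exact: link_cycle.
have /memv_imgP[y yC yE] : c' \in boundaries K (packing_on W') p.
  apply: (subvP (IH W' (fun j => (M j :\: v j) :\: w j) _ _)) => // [a av aM|j].
    rewrite inE MW //=; last by move=> j; apply: subset_trans (aM j) (subsetDl _ _).
    by apply/forallP=> j; rewrite disjoint_sym; have := aM j; rewrite subsetD => /andP[].
  have := cardsID (v j) (M j); have := subset_leq_card (subsetIr (M j) (v j)).
  have := cardsID (w j) (M j :\: v j).
  have := subset_leq_card (subsetIr (M j :\: v j) (w j)).
  have /eqP -> := forallP vw j; have := dM j; rewrite cv.
  lia.
(* Otherwise all components of w would be empty and w would not touch v. *)
have nww : ~~ apart w w.
  apply: contra nvw => /forallP ww; apply/forallP=> j.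
  by have := ww j; rewrite -!setI_eq0 setIid => /eqP->; rewrite setI0.
have coneC : cone K w p.+1 y \in chains K (packing_on W) p.+2.
  apply: (cone_chain (W' := W')) yC => //.
    by apply/subsetP=> u; rewrite inE => /andP[].
  by move=> a; rewrite inE => /andP[_ wa] _; right.
(* z is homologous to c. The cone over c' carries all the simplices of c through w, and y lives on
   the link of w, so w leaves the support. *)
pose z := c + boundary K T p.+1 (cone K w p.+1 y).
have zE : z = c - cone K w p c' + y by rewrite /z boundary_cone -yE addrCA addrC.
have [cl cl'] := (@packing_on_closed W, @packing_on_closed (W :\ w)).
have zC : z \in chains K (packing_on W) p.+1.
  by rewrite memvD // boundary_chain.
have zC' : z \in chains K (packing_on (W :\ w)) p.+1.
  move/(chainsP char0): zC => [za zW]; apply/(chainsP char0); split=> // u zu.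
  have /simplexP[uu uW ud] := zW u zu; apply/simplexP; split=> // a au.
  rewrite in_setD1 -andbA uW // andbT; apply: contraNneq zu => aw; rewrite {a}aw in au.
  apply/eqP; apply: alternating_front za _ au => t.
  have [//|zt] := eqVneq (z [tuple of w :: t]) 0.
  have /simplexP[/= /andP[wt _] _ _] := zW _ zt.
  rewrite zE !ffunE coneE big_ord_recl tnth0 eqxx expr0 !mul1r face0.
  rewrite big1 => [|i _]; last first.
    rewrite tnth_cons_lift; case: eqP => [E|_]; last by rewrite mul0r mulr0.
    by case/negP: wt; rewrite -E mem_tnth.
  rewrite addr0 ffunE subrr add0r; apply/eqP; apply: contraR nww => yt.
  have [_ yW] := (chainsP char0 _ _).1 yC.
  by have /simplex_cons[/andP[]] := yW _ yt; rewrite inE => /andP[].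
have : z \in boundaries K (packing_on (W :\ w)) p.+1.
  apply: (subvP (IHn (W :\ w) _ _ _)) => [|a av aM||].
  - apply: leq_trans le_n; apply: proper_card; apply/properP; split.
      by apply/subsetP=> u; rewrite !inE => /andP[/andP[_ ->]].
    by exists w; rewrite !inE ?eqxx // wW wv vw nvw.
  - rewrite !inE MW // andbT; apply: contraNneq nvw => <-; apply/forallP=> j.
    by have := aM j; rewrite subsetD disjoint_sym => /andP[].
  - by rewrite !inE vW eq_sym wv.
  rewrite /= memv_cap zC' memv_ker /z linearD /= c0 add0r.
  by rewrite (boundary_boundary char0 coneC).
move/(subvP (boundaries_on_sub _ (subsetDl _ _))) => zB.
rewrite -[c](addrK (boundary K T p.+1 (cone K w p.+1 y))) -/z.
by rewrite memvB // memv_img.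
Qed.

Lemma packing_cycles p : (forall j, 2 * p * d j + d j <= #|A j|)%N ->
  cycles K (packing d A) p = boundaries K (packing d A) p.
Proof.
have E : packing_on setT = packing d A.
  by apply/setP=> s; rewrite packing_onE subsetT andbT.
move=> dA; apply/eqP; rewrite eqEsubv -E boundaries_cycles ?andbT //.
  apply: (packing_acyclic (M := fun j => setT)) => [a _ _|j]; first by rewrite inE.
  by rewrite cardsT.
exact: packing_on_closed.
Qed.

End Acyclic.

(** * Homology of packing complexes *)

Section HomologyStability.
Variables (K : fieldType) (J0 : finType) (d : J0 -> nat) (k : int).
Variables (I : {set J0}) (A : J0 -> finType).
Hypothesis char0 : [pchar K] =i pred0.
Local Notation p := (absz (k + 1)).
Local Notation J := {j | j \notin I}.
Local Notation X B := (packing d (@glue J0 I A B)).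
Local Notation F q := (restriction (tuple_mod K J0 q) I A).
Local Notation V := (restriction (packing_homology K d k) I A).
Implicit Types B C : J -> finType.

Definition homology_class B : 'Hom(F p B, V B) :=
  quotv_class (cycles K (X B) p) (boundaries K (X B) p).

Definition bd q B : 'Hom(F q.+1 B, F q B) := boundary K _ q.

Lemma X_closed B : closed_complex (X B).
Proof.
have := @packing_on_closed J0 d (glue A B) setT.
by have -> : packing_on d [set: subset_tuple (glue A B)] = X B;
  [apply/setP=> s; rewrite packing_onE subsetT andbT|].
Qed.

Lemma F_map_chains q B C (f : FIhom B C) c :
  c \in chains K (X B) q -> FImap (F q) f c \in chains K (X C) q.
Proof.
move=> cC; apply: (subvP (push_chains K q (@subset_map_inj _ _ _ (glue_hom A f))
  (@subset_map_packing _ d _ _ (glue_hom A f)))).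
exact: memv_img.
Qed.

Lemma F_map_cycles q B C (f : FIhom B C) c :
  c \in cycles K (X B) q -> FImap (F q) f c \in cycles K (X C) q.
Proof.
move=> cC; apply: (subvP (push_cycles K q (@subset_map_inj _ _ _ (glue_hom A f))
  (@subset_map_packing _ d _ _ (glue_hom A f)))).
exact: memv_img.
Qed.

Lemma F_map_bd q B C (f : FIhom B C) c :
  bd q C (FImap (F q.+1) f c) = FImap (F q) f (bd q B c).
Proof. by rewrite -!comp_lfunE; congr (fun_of_lfun _ c); apply/esym/push_boundary. Qed.

Lemma class_map B C (f : FIhom B C) z : z \in cycles K (X B) p ->
  FImap V f (homology_class B z) = homology_class C (FImap (F p) f z).
Proof.
move=> zZ; apply: quotv_mapE => //.
exact: (push_boundaries K p (@subset_map_inj _ _ _ (glue_hom A f))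
  (@subset_map_packing _ d _ _ (glue_hom A f))).
Qed.

Lemma class_surj B (v : V B) : exists2 z, z \in cycles K (X B) p & v = homology_class B z.
Proof.
exists (quotv_repr _ _ v); first exact: quotv_repr_in.
exact/esym/quotv_reprK.
Qed.

Lemma class_eq0 B z : z \in cycles K (X B) p ->
  (homology_class B z == 0) = (z \in boundaries K (X B) p).
Proof.
by move=> zZ; apply: quotv_class_eq0 => //; apply/boundaries_cycles/X_closed.
Qed.

Lemma bd_algact q N x c :
  algact (@sym_action K J (F q) N) x (bd q _ c) = bd q _ (algact (@sym_action K J (F q.+1) N) x c).
Proof. by apply/esym/algact_hom => g u; apply: F_map_bd. Qed.

Lemma chains_subrep q N : is_subrep (@sym_action K J (F q) N) (chains K (X (ordJ N)) q).
Proof. by move=> g c; apply: F_map_chains. Qed.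

Lemma cycles_subrep q N : is_subrep (@sym_action K J (F q) N) (cycles K (X (ordJ N)) q).
Proof. by move=> g c; apply: F_map_cycles. Qed.

Lemma class_algact N x z : z \in cycles K (X (ordJ N)) p ->
  algact (@sym_action K J V N) x (homology_class _ z) =
  homology_class _ (algact (@sym_action K J (F p) N) x z).
Proof.
move=> zZ; rewrite !algactE linear_sum; apply: eq_bigr => g _.
by rewrite linearZ /= -class_map.
Qed.

Variables (la : J -> seq nat) (N N' : J -> nat) (le : leJ N N').
Hypothesis laP : forall j, is_partition (la j).
(** Chains with p vertices carry the cycles, and those with p + 1 vertices the boundaries. *)
Hypothesis big : forall q, (q == p) || (q == p.+1) ->
  forall t : q.-tuple (subset_tuple (glue A (ordJ N'))), is_simplex (X (ordJ N')) t ->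
  forall j : J, (2 * q * d (val j) <= N j)%N.
Local Notation y := (ysym K la N).
Local Notation y' := (ysym K la N').

(** Since b' = emb(b), phi(h) b' = phi(h b), and [sym_incl_eq0] applies to h b. *)
Lemma ysym_incl_inj q (h : F q (ordJ N)) : pad_defined la N ->
  algact (@sym_action K J (F q) N') y' (FImap (F q) (incl_hom le) h) = 0 ->
  algact (@sym_action K J (F q) N) y h = 0.
Proof.
move=> laN; rewrite /ysym algactM; last exact: sym_action_rep.
rewrite -(emb_alt_pad K laP le laN) -algact_emb => /(sym_incl_eq0 char0).
by rewrite algactM //; exact: sym_action_rep.
Qed.

Lemma ysym_generated q c : pad_defined la N -> (q == p) || (q == p.+1) ->
  c \in chains K (X (ordJ N')) q -> exists2 c0, c0 \in chains K (X (ordJ N)) q &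
  algact (@sym_action K J (F q) N') y' c =
  algact (@sym_action K J (F q) N') y' (FImap (F q) (incl_hom le) c0).
Proof.
move=> laN qp; have laN' := pad_defined_leJ le laN.
apply: chain_generated => //; first exact: pad_first_row_ext.
exact: (pad_roomy le laP laN' (big qp) laN).
Qed.

(** Write D for the boundary. phi(D c) y' = D(z y') = 0, so (D c) y = 0 by [ysym_incl_inj]. *)
Lemma ysym_cycle q z c : pad_defined la N ->
  z \in cycles K (X (ordJ N')) q -> c \in chains K (X (ordJ N)) q ->
  algact (@sym_action K J (F q) N') y' z =
  algact (@sym_action K J (F q) N') y' (FImap (F q) (incl_hom le) c) ->
  algact (@sym_action K J (F q) N) y c \in cycles K (X (ordJ N)) q.
Proof.
move=> laN zZ cC; have ycC := algact_inv y (@chains_subrep q N) cC.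
case: q z c zZ cC ycC => [//|q] z c zZ cC ycC E.
rewrite /= memv_cap ycC memv_ker -[boundary _ _ _ _]/(bd q _ _) -bd_algact.
apply/eqP/ysym_incl_inj => //; rewrite -F_map_bd bd_algact -E -bd_algact.
move: zZ; rewrite /= memv_cap memv_ker -[boundary _ _ _ _]/(bd q _ _) => /andP[_ /eqP->].
by rewrite linear0.
Qed.

(** Let z represent v and phi(z) y' = D c, with D the boundary. Multiplying by y' gives s' phi(z) y'
    = D(c y') = phi(D c0) y' for a chain c0 of N. By [ysym_incl_inj], s' z y = D(c0 y), so z y is a
    boundary. *)
Lemma class_ysym_inj v : pad_defined la N ->
  algact (@sym_action K J V N') y' (FImap V (incl_hom le) v) = 0 ->
  algact (@sym_action K J V N) y v = 0.
Proof.
move=> laN; have laN' := pad_defined_leJ le laN.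
have [z zZ ->] := class_surj v; rewrite class_map // !class_algact //; last first.
  exact: F_map_cycles.
move/eqP; rewrite class_eq0; last first.
  by apply: algact_inv; [exact: cycles_subrep|exact: F_map_cycles].
case/memv_imgP=> c cC /= cE.
have [s s0 sE] := ba_sqr char0 (pad_tableau laP laN).
have [s' s'0 s'E] := ba_sqr char0 (pad_tableau laP laN').
have [c0 c0C c0E] := ysym_generated laN (introT orP (or_intror (eqxx _))) cC.
have : algact (@sym_action K J (F p) N') y'
    (FImap (F p) (incl_hom le) (s' *: z - bd p _ c0)) = 0.
  rewrite !linearB !linearZ /= -F_map_bd bd_algact -c0E -bd_algact -[bd _ _ c]cE.
  by rewrite -algactM ?s'E ?algactZ ?subrr //; exact: sym_action_rep.
move=> /(ysym_incl_inj laN); rewrite linearB linearZ /= => /eqP; rewrite subr_eq0 => /eqP E.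
apply/eqP; rewrite class_eq0; last by apply: algact_inv => //; exact: cycles_subrep.
rewrite -[algact _ _ _](scalerK s'0) E bd_algact memvZ // memv_img //.
by apply: algact_inv => //; exact: chains_subrep.
Qed.

(** A cycle z has z y' = phi(c) y' with c only a chain, but c y is a cycle by [ysym_cycle], and
    phi(c y) y' = s phi(c) y'. *)
Lemma class_ysym_generated v : pad_defined la N -> exists u,
  algact (@sym_action K J V N') y' v =
  algact (@sym_action K J V N') y' (FImap V (incl_hom le) u).
Proof.
move=> laN; have laN' := pad_defined_leJ le laN.
have [z zZ ->] := class_surj v; have zC := cycles_chains zZ.
have [s s0 sE] := ba_sqr char0 (pad_tableau laP laN).
have [c cC cE] := ysym_generated laN (introT orP (or_introl (eqxx _))) zC.
have ycZ : algact (@sym_action K J (F p) N) y c \in cycles K (X (ordJ N)) p.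
  exact: ysym_cycle cE.
exists (s^-1 *: homology_class _ (algact (@sym_action K J (F p) N) y c)).
rewrite linearZ /= class_map // linearZ /= !class_algact //; last first.
  exact: F_map_cycles.
rewrite (ysym_incl_idem char0 laP le laN _ sE) linearZ /= scalerA mulVf // scale1r.
by rewrite cE.
Qed.

(** If la[N'] is defined but la[N] is not, the source is 0 by convention, and so is the target,
    because every simplex has a clash and is killed by b'. *)
Lemma homology_phi_iso : phi_iso V le la.
Proof.
have [laN'|nlaN'] := boolP (pad_defined la N'); last first.
  rewrite /phi_iso /phi_source /phi_target /pad_isotypic (negPf nlaN').
  by rewrite limg0 cap0v.
have [laN|nlaN] := boolP (pad_defined la N).
  apply: (phi_iso_criterion char0 laP laN) => [v|v].
    exact: class_ysym_inj.
  exact: class_ysym_generated.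
rewrite /phi_iso; have -> : phi_target V N' la = 0%VS.
  rewrite /phi_target pad_isotypicE //; [|exact: sym_action_rep|by move=> g u _; exact: memvf].
  apply/eqP; rewrite -subv0; apply: alggen_least => [g u|v _].
    by rewrite !memv0 => /eqP->; rewrite linear0.
  have [z zZ ->] := class_surj v; rewrite class_algact // memv0.
  suff -> : algact (@sym_action K J (F p) N') y' z = 0 by rewrite linear0.
  have := cycles_chains zZ; move: z {zZ}; apply: chains_ind => [|c u w u0 w0|t ts].
  - by rewrite linear0.
  - by rewrite linearP /= u0 w0 scaler0 addr0.
  have [j [x1 [x2 [x12 c12 t1 t2]]]] :=
    pad_undefined_clash laP laN' (big (introT orP (or_introl (eqxx _)))) nlaN ts.
  rewrite algactM; last exact: sym_action_rep.
  by rewrite (clash_alt_eq0 char0 x12 c12 t1 t2) linear0.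
have -> : phi_source V le la = 0%VS.
  apply/eqP; rewrite -subv0.
  have i0 : induced le (pad_isotypic la (@sym_action K J V N) fullv) = 0%VS.
    apply/eqP; rewrite -subv0; apply/subvP => f /inducedP[+ _].
    rewrite /pad_isotypic (negPf nlaN) => f0; rewrite memv0; apply/eqP/ffunP=> g.
    by have := f0 g; rewrite memv0 ffunE => /eqP.
  rewrite /phi_source i0 /pad_isotypic laN'; apply: vsum_least => W [W0 _].
  exact: W0.
by split; rewrite ?limg0 ?cap0v.
Qed.

End HomologyStability.

Theorem theorem5p1 (K : fieldType) (char0 : [pchar K] =i pred0)
    (n : nat) (n_gt0 : (0 < n)%N) (d : 'I_n -> nat) (d_gt0 : forall i, (0 < d i)%N)
    (k : int) (k_ge : -1 <= k) :
  (representation_superstable (packing_homology K d k) /\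
   trivial_FImod (packing_homology K d k)) /\
  (forall r : nat, (r < n)%N -> forall (A : 'I_n -> finType) (m : nat),
    is_min_over (fun j : 'I_n => r <= j)%N (fun j => #|A j| %/ d j)%N m ->
    stable_range (restriction (packing_homology K d k) [set j : 'I_n | r <= j]%N A)
      (fun j => 2 * m * d (val j))%N).
Proof.
set p := absz (k + 1); split; [split|].
- move=> I A; exists (fun j => 2 * p.+1 * d (val j))%N => N leN N' le la laP.
  apply: homology_phi_iso => // q qp t _ j; apply: leq_trans (leN j).
  by rewrite leq_mul2r leq_mul2l /=; case/orP: qp => /eqP->; rewrite ?leqnSn ?leqnn orbT.
- exists (fun j => 2 * p * d j + d j)%N => N leN.
  apply/eqP; rewrite -subv0; apply/subvP => v _; rewrite memv0; apply/eqP.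
  (* In this range every cycle is a boundary, in particular a representative of v. *)
  rewrite -[v]quotv_reprK; apply: quotv_class0.
  have ZB : (cycles K (packing d (ordJ N)) p <= boundaries K (packing d (ordJ N)) p)%VS.
    by rewrite packing_cycles // => j; rewrite card_ord leN.
  exact/(subvP ZB)/quotv_repr_in.
move=> r _ A m [[j0 rj0 mE] _] N' le la laP.
apply: homology_phi_iso => // q _ t ts j; rewrite leq_mul2r leq_mul2l.
(* A simplex with q vertices has q d_j0 <= #|A j0| at the index j0 where the minimum is attained, so
   q <= m. *)
have j0I : j0 \in [set j : 'I_n | r <= j]%N by rewrite inE.
have := simplex_bound j0 ts.
have -> : #|glue A (ordJ N') j0| = #|A j0|.
  by rewrite /glue; case: insubP => // u; rewrite j0I.
by rewrite -leq_divRL // [(_ %/ _)%N]mE => ->; rewrite !orbT.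
Qed.
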